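(* Let $G=(A,\Delta)$ be a locally compact quantum group, let $(B_1,\beta_1,\psi_1)$ and $(B_2,\beta_2,\psi_2)$ be $G$-products, let $(D_1,\alpha_1)$ and $(D_2,\alpha_2)$ be the corresponding Landstad $G$-dynamical systems, and let $\imath:D_1\to D_2$ be an isomorphism of $(D_1,\alpha_1)$ and $(D_2,\alpha_2)$. Then the $G$-products $(B_1,\beta_1,\psi_1)$ and $(B_2,\beta_2,\psi_2)$ are isomorphic: there exists a unique isomorphism $\jmath:B_1\to B_2$ of the $G$-products extending $\imath$ (i.e. whose extension to $M(B_1)$ restricts to $\imath$ on $D_1$).
   Context: Conventions. For a C*-algebra $X$, $M(X)$ is its multiplier algebra, $1_X$ the unit of $M(X)$, $\mathrm{id}_X$ the identity map. $\otimes$ is the minimal tensor product of C*-algebras. $B(K)$, $B_0(K)$ are the bounded, resp. compact, operators on a Hilbert space $K$, $B(K)_*$ the normal functionals on $B(K)$. For norm closed subsets $X,Y$ of a C*-algebra, $XY$ is the norm closed linear span of $\{xy:x\in X,y\in Y\}$. $\mathrm{Mor}(X,Y)$ is the set of *-homomorphisms $\varphi:X\to M(Y)$ with $\varphi(X)Y=Y$; each extends uniquely to a unital *-homomorphism $M(X)\to M(Y)$, and this extension is used for compositions. $\mathrm{Rep}(X,K)=\mathrm{Mor}(X,B_0(K))$. Slice maps are extended to multiplier algebras. ''C*-algebra generated by a set'' means the smallest C*-algebra containing it. Leg numbering. A numerical index indicates the tensor position in which a leg is placed; a morphism as index means that it is applied to that leg (placed in its target); remaining legs are filled with units. E.g.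 $V_{\hat\sigma 3}=1\otimes(\hat\sigma\otimes\mathrm{id}_A)V$, $V_{1\sigma}=(\mathrm{id}_{\hat A}\otimes\sigma)V\otimes 1_A$, $V_{\psi2}=(\psi\otimes\mathrm{id}_A)V$. Quantum groups. A locally compact quantum group is a pair $G=(A,\Delta)$ constructed from a manageable (modular) multiplicative unitary in the sense of Woronowicz: $W$ is a unitary on $H\otimes H$ with $W_{23}W_{12}=W_{12}W_{13}W_{23}$ for which there are a positive selfadjoint $Q$ on $H$ with $\ker Q=0$ and a unitary $\widetilde W$ on $\overline H\otimes H$ such that $W^*(Q\otimes Q)W=Q\otimes Q$ and $(x\otimes u|W|z\otimes y)=(\bar z\otimes Qu|\widetilde W|\bar x\otimes Q^{-1}y)$ for $x,z\in H$, $u\in\mathrm{dom}\,Q$, $y\in\mathrm{dom}\,Q^{-1}$ (modular unitaries are a variant yielding the same class of quantum groups). Then $A$ is the norm closure of $\{(\omega\otimes\mathrm{id})W:\omega\in B(H)_*\}$, $\Delta(a)=W(a\otimes1)W^*$, $\hat A$ is the norm closure of $\{(\mathrm{id}\otimes\omega)W:\omega\in B(H)_*\}$, $\hat\Delta(\hat a)=\mathrm{flip}(W^*(1\otimes\hat a)W)$, and $\hat G=(\hat A,\hat\Delta)$ is the dual. $W$ comes from a unitary $V\in M(\hat A\otimes A)$ (the canonical bicharacter) with $(\mathrm{id}\otimes\Delta)V=V_{12}V_{13}$, $(\hat\Delta\otimes\mathrm{id})V=V_{23}V_{13}$. A Heisenberg pair on $H$ is $\sigma\in\mathrm{Rep}(A,H)$,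 $\hat\sigma\in\mathrm{Rep}(\hat A,H)$ with $V_{\hat\sigma3}V_{1\sigma}=V_{1\sigma}V_{13}V_{\hat\sigma3}$. $A_*=\{\mu\circ\sigma:\mu\in B(H)_*\}$ (independent of the Heisenberg pair $(\sigma,\hat\sigma)$). $G$-products. A continuous left action of $\hat G$ on a C*-algebra $B$ is an injective $\beta\in\mathrm{Mor}(B,\hat A\otimes B)$ with $(\mathrm{id}_{\hat A}\otimes\beta)\beta=(\hat\Delta\otimes\mathrm{id}_B)\beta$ and $(\hat A\otimes1_B)\beta(B)=\hat A\otimes B$. A $G$-product is a triple $(B,\beta,\psi)$ where $B$ is a C*-algebra, $\beta$ is a continuous left action of $\hat G$ on $B$ and $\psi\in\mathrm{Mor}(\hat A,B)$ is injective with $\beta\circ\psi=(\mathrm{id}_{\hat A}\otimes\psi)\circ\hat\Delta$. An isomorphism of $G$-products $(B_1,\beta_1,\psi_1)\to(B_2,\beta_2,\psi_2)$ is a C*-algebra isomorphism $\jmath:B_1\to B_2$ with $\jmath\circ\psi_1=\psi_2$ and $(\mathrm{id}_{\hat A}\otimes\jmath)\circ\beta_1=\beta_2\circ\jmath$. Landstad algebra and system. A C*-subalgebra $D\subset M(B)$ is a Landstad algebra of $(B,\beta,\psi)$ if: (C1) $\beta(d)=1_{\hat A}\otimes d$ for all $d\in D$; (C2) $B=\psi(\hat A)D$; (C3) the C*-algebra generated by the norm closed linear span of $\{(\mathrm{id}_B\otimes\omega)(V_{\psi2}(d\otimes1_A)V_{\psi2}^* ):\omega\in A_*,d\in D\}$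 coincides with $D$. Every $G$-product has exactly one Landstad algebra $D$; its Landstad $G$-dynamical system is $(D,\alpha)$ with $\alpha:A_*\times D\to D$, $\alpha(\omega,d)=(\mathrm{id}_B\otimes\omega)(V_{\psi2}(d\otimes1_A)V_{\psi2}^* )$. An isomorphism $(D_1,\alpha_1)\to(D_2,\alpha_2)$ is a C*-algebra isomorphism $\imath:D_1\to D_2$ with $\imath(\alpha_1(\omega,d))=\alpha_2(\omega,\imath(d))$ for all $d\in D_1$, $\omega\in A_*$. *)

(* Defs.v *)
From HB Require Import structures.
From mathcomp Require Import all_boot all_order all_algebra.
From mathcomp Require Import complex.
From mathcomp Require Import boolp classical_sets functions reals topology
  normedtype sequences.

Set Implicit Arguments.
Unset Strict Implicit.
Unset Printing Implicit Defensive.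

Import Order.TTheory GRing.Theory Num.Theory numFieldNormedType.Exports.

Local Open Scope classical_set_scope.
Local Open Scope ring_scope.

(* Many operators and morphisms below are determined by their values on         *)
(* elementary tensors (or by nondegeneracy).  Such unique objects are denoted   *)
(* with [xget default spec]; the default value is never reached in the intended *)
(* use cases, where existence and uniqueness are standard facts.                *)

(* The inner product is antilinear in the first variable.  The norm of a normed *)
(* module over [R[i]] takes its values in [R[i]].                               *)
HB.mixin Record isHilbert (R : realType) H of CompleteNormedModule R[i] H := {
  dot : H -> H -> R[i];
  dotDr : forall x y z : H, dot x (y + z) = dot x y + dot x z;
  dotZr : forall (a : R[i]) (x y : H), dot x (a *: y) = a * dot x y;
  dotC : forall x y : H, dot y x = Num.conj (dot x y);
  dot_norm : forall x : H, dot x x = `|x| ^+ 2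
}.

#[short(type="hilbertType")]
HB.structure Definition Hilbert (R : realType) :=
  {H of isHilbert R H & CompleteNormedModule R[i] H}.

Section Operators.
Context {R : realType}.
Implicit Types H K : hilbertType R.

Definition bounded_op {V W : normedModType R[i]} (T : V -> W) : Prop :=
  linear T /\ continuous T.

Definition adj {H K} (T : H -> K) : K -> H :=
  xget (fun=> 0) [set S | forall x y, dot (T x) y = dot x (S y)].

Definition unitary {H K} (U : H -> K) : Prop :=
  [/\ linear U, forall x y, dot (U x) (U y) = dot x y
    & forall z, exists x, U x = z].

Definition op_closure {H K} (S : set (H -> K)) : set (H -> K) :=
  [set T | bounded_op T /\ forall e : R[i], 0 < e ->
     exists2 T', S T' & forall x, `|T x - T' x| <= e * `|x|].

Record conj_hilbert H := ConjHilbert {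
  conj_car :> hilbertType R;
  conj_vec : H -> conj_car;
  conj_vecP : forall (a : R[i]) (x y : H),
    conj_vec (a *: x + y) = Num.conj a *: conj_vec x + conj_vec y;
  conj_dot : forall x y, dot (conj_vec x) (conj_vec y) = dot y x;
  conj_surj : forall z, exists x, conj_vec x = z
}.

(* [H ⊗ K]; bilinearity of [hpair] follows from [hpair_dot]. *)
Record hilbert_tensor H K := HilbertTensor {
  ht_car :> hilbertType R;
  hpair : H -> K -> ht_car;
  hpair_dot : forall x x' y y',
    dot (hpair x y) (hpair x' y') = dot x x' * dot y y';
  hpair_total :
    closure (range (fun s : seq (H * K) =>
      \sum_(p <- s) hpair p.1 p.2)) = setT
}.

(* Normal functionals [T |-> \sum_k <x_k, T y_k>] with square-summable          *)
(* [x] and [y]; the sum runs over the sequence of partial sums.                 *)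
Record normal_functional H := NormalFunctional {
  nf_left : nat -> H;
  nf_right : nat -> H;
  nf_leftP : exists M : R[i],
    forall n, \sum_(k < n) `|nf_left k| ^+ 2 <= M;
  nf_rightP : exists M : R[i],
    forall n, \sum_(k < n) `|nf_right k| ^+ 2 <= M
}.

Definition nf_sum {H} (mu : normal_functional H) (f : H -> H -> R[i]) : R[i] :=
  lim ((fun n => \sum_(k < n) f (nf_left mu k) (nf_right mu k) : R[i]^o)
    @ \oo).

Definition nf_app {H} (mu : normal_functional H) (T : H -> H) : R[i] :=
  nf_sum mu (fun x y => dot x (T y)).

(* A positive selfadjoint operator [Q] with domain [dom] and trivial kernel;    *)
(* the values of [Q] outside [dom] are irrelevant.                              *)
Definition positive_selfadjoint_inj {H} (dom : set H) (Q : H -> H) : Prop :=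
  [/\ dom 0 /\ (forall (a : R[i]) x y, dom x -> dom y ->
        dom (a *: x + y) /\ Q (a *: x + y) = a *: Q x + Q y),
      closure dom = setT,
      forall y z, (forall x, dom x -> dot (Q x) y = dot x z) <->
                  (dom y /\ z = Q y),
      forall x, dom x -> 0 <= dot x (Q x)
    & forall x, dom x -> Q x = 0 -> x = 0].

End Operators.

(* Algebras are not assumed to have a unit. *)
HB.mixin Record isStarAlgebra (R : realType) X of GRing.Lmodule R[i] X := {
  smul : X -> X -> X;
  star : X -> X;
  smulA : forall x y z, smul x (smul y z) = smul (smul x y) z;
  smulDl : forall x y z, smul (x + y) z = smul x z + smul y z;
  smulDr : forall x y z, smul x (y + z) = smul x y + smul x z;
  smulZl : forall (a : R[i]) x y, smul (a *: x) y = a *: smul x y;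
  smulZr : forall (a : R[i]) x y, smul x (a *: y) = a *: smul x y;
  starD : forall x y, star (x + y) = star x + star y;
  starZ : forall (a : R[i]) x, star (a *: x) = Num.conj a *: star x;
  starM : forall x y, star (smul x y) = smul (star y) (star x);
  starK : forall x, star (star x) = x
}.

#[short(type="starAlgType")]
HB.structure Definition StarAlgebra (R : realType) :=
  {X of isStarAlgebra R X & GRing.Lmodule R[i] X}.

Notation "x ** y" := (smul x y) (at level 40, left associativity) : ring_scope.

HB.mixin Record isCStar (R : realType) X
    of CompleteNormedModule R[i] X & StarAlgebra R X := {
  norm_smul : forall x y : X, `|x ** y| <= `|x| * `|y|;
  norm_star_smul : forall x : X, `|star x ** x| = `|x| ^+ 2
}.

#[short(type="cstarType")]
HB.structure Definition CStar (R : realType) :=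
  {X of isCStar R X & CompleteNormedModule R[i] X & StarAlgebra R X}.

Definition star_hom {R : realType} {X Y : starAlgType R} (f : X -> Y) : Prop :=
  [/\ linear f, forall x y, f (x ** y) = f x ** f y
    & forall x, f (star x) = star (f x)].

Section Nondegenerate.
Context {R : realType} {X : cstarType R}.
Implicit Types x y z : X.

Lemma smul0l x : 0 ** x = 0 :> X.
Proof. by rewrite -[X in X ** _](scale0r (0 : X)) smulZl scale0r. Qed.

Lemma smul0r x : x ** 0 = 0 :> X.
Proof. by rewrite -[X in _ ** X](scale0r (0 : X)) smulZr scale0r. Qed.

Lemma smulBl x y z : (x - y) ** z = x ** z - y ** z.
Proof. by rewrite smulDl -scaleN1r smulZl scaleN1r. Qed.

Lemma smulBr x y z : x ** (y - z) = x ** y - x ** z.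
Proof. by rewrite smulDr -scaleN1r smulZr scaleN1r. Qed.

Lemma smul_injr x y : (forall z, z ** x = z ** y) -> x = y.
Proof.
move=> h; apply/eqP; rewrite -subr_eq0 -normr_eq0 -sqrf_eq0 -norm_star_smul.
by rewrite smulBr h subrr normr0.
Qed.

Lemma smul_injl x y : (forall z, x ** z = y ** z) -> x = y.
Proof.
move=> h; rewrite -[x]starK -[y]starK; congr star.
by apply: smul_injr => z; rewrite -[z]starK -!starM h.
Qed.

End Nondegenerate.

(* [M(X)], realized as the algebra of double centralizers of [X]. *)
Record multiplier (R : realType) (X : cstarType R) := Multiplier {
  mleft :> X -> X;
  mright : X -> X;
  multiplierP : forall x y : X, x ** mleft y = mright x ** y
}.

HB.instance Definition _ (R : realType) (X : cstarType R) :=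
  gen_eqMixin (multiplier X).
HB.instance Definition _ (R : realType) (X : cstarType R) :=
  gen_choiceMixin (multiplier X).

Section MultiplierAlgebra.
Context {R : realType} {X : cstarType R}.
Implicit Types m n : multiplier X.

Lemma multiplier_eq m n :
  (forall x, m x = n x) -> (forall x, mright m x = mright n x) -> m = n.
Proof.
case: m n => [l r P] [l' r' P'] /= /funext el /funext er.
by subst l' r'; congr Multiplier; exact: Prop_irrelevance.
Qed.

Lemma mleft_linear m (a : R[i]) x y : m (a *: x + y) = a *: m x + m y.
Proof.
by apply: smul_injr => z;
   rewrite multiplierP !smulDr !smulZr !multiplierP.
Qed.

Lemma mright_linear m (a : R[i]) x y :
  mright m (a *: x + y) = a *: mright m x + mright m y.
Proof.
by apply: smul_injl => z;
   rewrite -multiplierP !smulDl !smulZl !multiplierP.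
Qed.

Definition mzero : multiplier X.
Proof.
by refine (@Multiplier R X (fun=> 0) (fun=> 0) _) => x y;
   rewrite smul0l smul0r.
Defined.

Definition mone : multiplier X.
Proof. by refine (@Multiplier R X id id _). Defined.

Definition madd m n : multiplier X.
Proof.
by refine (@Multiplier R X (fun x => m x + n x)
     (fun x => mright m x + mright n x) _) => x y;
   rewrite smulDl smulDr !multiplierP.
Defined.

Definition mscale (a : R[i]) m : multiplier X.
Proof.
by refine (@Multiplier R X (fun x => a *: m x) (fun x => a *: mright m x) _)
   => x y; rewrite smulZl smulZr multiplierP.
Defined.

Definition mmul m n : multiplier X.
Proof.
by refine (@Multiplier R X (fun x => m (n x))
     (fun x => mright n (mright m x)) _) => x y;
   rewrite !multiplierP.
Defined.

Definition mstar m : multiplier X.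
Proof.
by refine (@Multiplier R X (fun x => star (mright m (star x)))
     (fun x => star (m (star x))) _) => x y;
   rewrite -{1}[x]starK -starM -multiplierP starM starK.
Defined.

Definition minj (x : X) : multiplier X.
Proof.
by refine (@Multiplier R X (fun y => x ** y) (fun y => y ** x) _) => y z;
   rewrite smulA.
Defined.

Definition mopp m : multiplier X := mscale (-1) m.

Fact maddA : associative madd.
Proof. by move=> m n p; apply: multiplier_eq => x /=; rewrite addrA. Qed.
Fact maddC : commutative madd.
Proof. by move=> m n; apply: multiplier_eq => x /=; rewrite addrC. Qed.
Fact madd0 : left_id mzero madd.
Proof. by move=> m; apply: multiplier_eq => x /=; rewrite add0r. Qed.
Fact maddN : left_inverse mzero mopp madd.
Proof.
by move=> m; apply: multiplier_eq => x /=; rewrite scaleN1r addNr.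
Qed.

HB.instance Definition _ :=
  GRing.isZmodule.Build (multiplier X) maddA maddC madd0 maddN.

Fact mscaleA (a b : R[i]) m : mscale a (mscale b m) = mscale (a * b) m.
Proof. by apply: multiplier_eq => x /=; rewrite scalerA. Qed.
Fact mscale1 : left_id 1 mscale.
Proof. by move=> m; apply: multiplier_eq => x /=; rewrite scale1r. Qed.
Fact mscaleDr : right_distributive mscale +%R.
Proof. by move=> a m n; apply: multiplier_eq => x /=; rewrite scalerDr. Qed.
Fact mscaleDl m : {morph mscale^~ m : a b / a + b}.
Proof. by move=> a b; apply: multiplier_eq => x /=; rewrite scalerDl. Qed.

HB.instance Definition _ :=
  GRing.Zmodule_isLmodule.Build R[i] (multiplier X)
    mscaleA mscale1 mscaleDr mscaleDl.

Fact mleftD m x y : m (x + y) = m x + m y.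
Proof. by rewrite -[x]scale1r mleft_linear !scale1r. Qed.
Fact mrightD m x y : mright m (x + y) = mright m x + mright m y.
Proof. by rewrite -[x]scale1r mright_linear !scale1r. Qed.
Fact mleft0 m : m 0 = 0.
Proof. by apply: (addrI (m 0)); rewrite -mleftD !addr0. Qed.
Fact mright0 m : mright m 0 = 0.
Proof. by apply: (addrI (mright m 0)); rewrite -mrightD !addr0. Qed.
Fact mleftZ m (a : R[i]) x : m (a *: x) = a *: m x.
Proof. by rewrite -[a *: x]addr0 mleft_linear mleft0 addr0. Qed.
Fact mrightZ m (a : R[i]) x : mright m (a *: x) = a *: mright m x.
Proof. by rewrite -[a *: x]addr0 mright_linear mright0 addr0. Qed.

Fact mmulA m n p : mmul m (mmul n p) = mmul (mmul m n) p.
Proof. exact: multiplier_eq. Qed.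
Fact mmulDl m n p : mmul (m + n) p = mmul m p + mmul n p.
Proof. by apply: multiplier_eq => x //=; rewrite mrightD. Qed.
Fact mmulDr m n p : mmul m (n + p) = mmul m n + mmul m p.
Proof. by apply: multiplier_eq => x //=; rewrite mleftD. Qed.
Fact mmulZl (a : R[i]) m n : mmul (a *: m) n = a *: mmul m n.
Proof. by apply: multiplier_eq => x //=; rewrite mrightZ. Qed.
Fact mmulZr (a : R[i]) m n : mmul m (a *: n) = a *: mmul m n.
Proof. by apply: multiplier_eq => x //=; rewrite mleftZ. Qed.
Fact mstarD m n : mstar (m + n) = mstar m + mstar n.
Proof. by apply: multiplier_eq => x /=; rewrite starD. Qed.
Fact mstarZ (a : R[i]) m : mstar (a *: m) = Num.conj a *: mstar m.
Proof. by apply: multiplier_eq => x /=; rewrite starZ. Qed.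
Fact mstarM m n : mstar (mmul m n) = mmul (mstar n) (mstar m).
Proof. by apply: multiplier_eq => x /=; rewrite starK. Qed.
Fact mstarK m : mstar (mstar m) = m.
Proof. by apply: multiplier_eq => x /=; rewrite !starK. Qed.

HB.instance Definition _ :=
  isStarAlgebra.Build R (multiplier X) mmulA mmulDl mmulDr mmulZl mmulZr
    mstarD mstarZ mstarM mstarK.

(* Norm-closedness in [M(X)], whose norm is the operator norm of [mleft]. *)
Definition mclosed (S : set (multiplier X)) : Prop :=
  forall m, (forall e : R[i], 0 < e ->
    exists2 n, S n & forall x, `|m x - n x| <= e * `|x|) -> S m.

Definition closed_subspace (S : set (multiplier X)) : Prop :=
  [/\ S 0, forall (a : R[i]) m n, S m -> S n -> S (a *: m + n) & mclosed S].

Definition closed_span (S : set (multiplier X)) : set (multiplier X) :=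
  smallest closed_subspace S.

Definition cstar_subalgebra (S : set (multiplier X)) : Prop :=
  [/\ closed_subspace S, forall m n, S m -> S n -> S (m ** n)
    & forall m, S m -> S (star m)].

Definition generated_cstar (S : set (multiplier X)) : set (multiplier X) :=
  smallest cstar_subalgebra S.

Definition closed_product (S T : set (multiplier X)) : set (multiplier X) :=
  closed_span [set p.1 ** p.2 | p in S `*` T].

End MultiplierAlgebra.

Section Morphisms.
Context {R : realType}.
Implicit Types X Y : cstarType R.
Implicit Types H K : hilbertType R.

(* [Mor(X, Y)] *)
Definition mor {X Y} (f : X -> multiplier Y) : Prop :=
  star_hom f /\ closed_product (range f) (range minj) = range minj.

(* The extension of a morphism to [M(X)]. *)
Definition ext {X Y} (f : X -> multiplier Y) (m : multiplier X) :
    multiplier Y :=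
  xget 0 [set n : multiplier Y | forall x, n ** f x = f (m x)].

(* [Rep(X, H)]: as [M(B_0(H)) = B(H)], these are the nondegenerate              *)
(* representations of [X] on [H].                                               *)
Definition rep {X H} (pi : X -> H -> H) : Prop :=
  [/\ forall x, bounded_op (pi x),
      forall (a : R[i]) x y v, pi (a *: x + y) v = a *: pi x v + pi y v,
      forall x y v, pi (x ** y) v = pi x (pi y v),
      forall x v w, dot (pi x v) w = dot v (pi (star x) w)
    & closure (range (fun s : seq (X * H) => \sum_(p <- s) pi p.1 p.2)) = setT].

Definition rep_ext {X H} (pi : X -> H -> H) (m : multiplier X) : H -> H :=
  xget (fun=> 0)
    [set T | bounded_op T /\ forall x v, T (pi x v) = pi (m x) v].

(* The minimal (spatial) tensor product [X ⊗ Y]: a C*-algebra generated by      *)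
(* elementary tensors and faithfully represented on [H ⊗ K] by [pi ⊗ rho],      *)
(* where [pi] and [rho] are faithful representations of [X] and [Y].            *)
Record min_tensor X Y := MinTensor {
  mt_car :> cstarType R;
  mt_pair : X -> Y -> mt_car;
  mt_total : closure (range (fun s : seq (X * Y) =>
    \sum_(p <- s) mt_pair p.1 p.2)) = setT;
  mt_spatial : exists (H K : hilbertType R) (T : hilbert_tensor H K)
      (pi : X -> H -> H) (rho : Y -> K -> K) (tau : mt_car -> T -> T),
    [/\ rep pi /\ injective pi, rep rho /\ injective rho,
        rep tau /\ injective tau
      & forall x y v w, tau (mt_pair x y) (hpair T v w) =
                        hpair T (pi x v) (rho y w)]
}.

End Morphisms.

(* A choice of a model for each tensor product of two Hilbert spaces and each   *)
(* minimal tensor product of two C*-algebras (both exist and are unique up to   *)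
(* a canonical isomorphism).                                                    *)
Record tensor_models (R : realType) := TensorModels {
  hilbert_model : forall H K : hilbertType R, hilbert_tensor H K;
  cstar_model : forall X Y : cstarType R, min_tensor X Y
}.

Section TensorCalculus.
Context {R : realType} {t : tensor_models R}.
Implicit Types H K L : hilbertType R.
Implicit Types X Y Z : cstarType R.

Definition hten H K : hilbertType R := hilbert_model t H K.
Definition vten {H K} (x : H) (y : K) : hten H K :=
  hpair (hilbert_model t H K) x y.

Definition op_ten {H K H' K'} (S : H -> H') (T : K -> K') :
    hten H K -> hten H' K' :=
  xget (fun=> 0) [set U | bounded_op U /\
    forall x y, U (vten x y) = vten (S x) (T y)].

Definition hflip {H K} : hten H K -> hten K H :=
  xget (fun=> 0) [set U | bounded_op U /\
    forall x y, U (vten x y) = vten y x].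

Definition hassoc {H K L} : hten (hten H K) L -> hten H (hten K L) :=
  xget (fun=> 0) [set U | bounded_op U /\
    forall x y z, U (vten (vten x y) z) = vten x (vten y z)].

(* Leg numbering on [H ⊗ (H ⊗ H)] for an operator on [H ⊗ H]. *)
Definition op12 {H} (W : hten H H -> hten H H) :
    hten H (hten H H) -> hten H (hten H H) :=
  hassoc \o op_ten W id \o adj hassoc.
Definition op23 {H} (W : hten H H -> hten H H) :
    hten H (hten H H) -> hten H (hten H H) :=
  op_ten id W.
Definition op13 {H} (W : hten H H -> hten H H) :
    hten H (hten H H) -> hten H (hten H H) :=
  op_ten id hflip \o op12 W \o op_ten id hflip.

Definition cten X Y : cstarType R := cstar_model t X Y.
Definition aten {X Y} (x : X) (y : Y) : cten X Y :=
  mt_pair (cstar_model t X Y) x y.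

(* [m ⊗ n] in [M(X ⊗ Y)] for [m] in [M(X)] and [n] in [M(Y)] *)
Definition mten {X Y} (m : multiplier X) (n : multiplier Y) :
    multiplier (cten X Y) :=
  xget 0 [set k : multiplier (cten X Y) |
    forall x y, k (aten x y) = aten (m x) (n y)].

(* [f ⊗ g] in [Mor(X ⊗ Y, X' ⊗ Y')] *)
Definition mor_ten {X Y X' Y' : cstarType R}
    (f : X -> multiplier X') (g : Y -> multiplier Y') :
    cten X Y -> multiplier (cten X' Y') :=
  xget (fun=> 0) [set F : cten X Y -> multiplier (cten X' Y') |
    mor F /\ forall x y, F (aten x y) = mten (f x) (g y)].

(* Since [minj] is the identity morphism, [leg1] and [leg2] are the morphisms   *)
(* [x |-> x ⊗ 1] and [y |-> 1 ⊗ y].                                             *)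
Definition leg1 {X Y} (x : X) : multiplier (cten X Y) := mten (minj x) mone.
Definition leg2 {X Y} (y : Y) : multiplier (cten X Y) := mten mone (minj y).

Definition cassoc {X Y Z} :
    cten (cten X Y) Z -> multiplier (cten X (cten Y Z)) :=
  xget (fun=> 0)
    [set F : cten (cten X Y) Z -> multiplier (cten X (cten Y Z)) |
     mor F /\
     forall x y z, F (aten (aten x y) z) = minj (aten x (aten y z))].

Definition rep_ten {X Y H K} (pi : X -> H -> H) (rho : Y -> K -> K) :
    cten X Y -> hten H K -> hten H K :=
  xget (fun=> fun=> 0) [set tau : cten X Y -> hten H K -> hten H K |
    rep tau /\ forall x y, tau (aten x y) = op_ten (pi x) (rho y)].

Definition bounded_functional {X} (om : X -> R[i]) : Prop :=
  bounded_op (om : X -> R[i]^o).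

(* [id ⊗ om] on [X ⊗ Y] *)
Definition slice0 {X Y} (om : Y -> R[i]) : cten X Y -> X :=
  xget (fun=> 0) [set S : cten X Y -> X | bounded_op S /\
    forall x y, S (aten x y) = om y *: x].

(* [id ⊗ om] on [M(X ⊗ Y)].  A bounded functional [om] on [Y] factorizes as     *)
(* [om = om'(_ ** y')], and then                                                *)
(*   [(id ⊗ om)(m) x = (id ⊗ om')(m (x ⊗ y'))]                                  *)
(* does not depend on the factorization.                                        *)
Definition slice {X Y} (om : Y -> R[i]) (m : multiplier (cten X Y)) :
    multiplier X :=
  xget 0 [set n : multiplier X | exists (om' : Y -> R[i]) (y' : Y),
    [/\ bounded_functional om', forall y, om y = om' (y ** y')
      & forall x, n x = slice0 om' (m (aten x y'))]].

Definition munitary {X} (m : multiplier X) : Prop :=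
  star m ** m = mone /\ m ** star m = mone.

Definition multiplicative_unitary {H} (W : hten H H -> hten H H) : Prop :=
  unitary W /\ op23 W \o op12 W = op12 W \o op13 W \o op23 W.

(* The graph of the (closed) operator [Q ⊗ Q]. *)
Definition graph_QQ {H} (dom : set H) (Q : H -> H) :
    set (hten H H * hten H H) :=
  closure [set p | exists2 s : seq (H * H),
    (forall q, q \in s -> dom q.1 /\ dom q.2) &
    p = (\sum_(q <- s) vten q.1 q.2, \sum_(q <- s) vten (Q q.1) (Q q.2))].

(* In the last clause [y] is in the domain of [Q^-1], with [Q^-1 y = v]. *)
Definition manageable {H} (W : hten H H -> hten H H) : Prop :=
  exists (dom : set H) (Q : H -> H) (Hc : conj_hilbert H)
      (Wt : hten Hc H -> hten Hc H),
    [/\ positive_selfadjoint_inj dom Q,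
        unitary Wt,
        forall v w, graph_QQ dom Q (v, w) <-> graph_QQ dom Q (W v, W w)
      & forall x z u y v, dom u -> dom v -> Q v = y ->
          dot (vten x u) (W (vten z y)) =
          dot (vten (conj_vec Hc z) (Q u)) (Wt (vten (conj_vec Hc x) v))].

(* [(mu ⊗ id) W] and [(id ⊗ mu) W] *)
Definition lslice {H} (mu : normal_functional H) (W : hten H H -> hten H H) :
    H -> H :=
  xget (fun=> 0) [set S | bounded_op S /\ forall v w,
    dot v (S w) = nf_sum mu (fun x y => dot (vten x v) (W (vten y w)))].
Definition rslice {H} (mu : normal_functional H) (W : hten H H -> hten H H) :
    H -> H :=
  xget (fun=> 0) [set S | bounded_op S /\ forall v w,
    dot v (S w) = nf_sum mu (fun x y => dot (vten v x) (W (vten w y)))].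

End TensorCalculus.

Arguments hten {R} t H K.
Arguments cten {R} t X Y.

(* [qA] and [qAd] are the algebras of the quantum group and of its dual, which  *)
(* the faithful representations [qsig] and [qsigd] identify with algebras of    *)
(* operators on [qH]; they form a Heisenberg pair by the pentagon equation.     *)
Record lcqg (R : realType) (t : tensor_models R) := LCQG {
  qH : hilbertType R;
  qW : hten t qH qH -> hten t qH qH;
  qW_mu : multiplicative_unitary qW;
  qW_manageable : manageable qW;
  qA : cstarType R;
  qsig : qA -> qH -> qH;
  qsig_rep : rep qsig;
  qsig_inj : injective qsig;
  qsig_range : range qsig = op_closure (range (fun mu => lslice mu qW));
  qAd : cstarType R;
  qsigd : qAd -> qH -> qH;
  qsigd_rep : rep qsigd;
  qsigd_inj : injective qsigd;
  qsigd_range : range qsigd = op_closure (range (fun mu => rslice mu qW));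
  qDelta : qA -> multiplier (cten t qA qA);
  qDelta_mor : mor qDelta;
  qDeltaE : forall a, rep_ext (rep_ten qsig qsig) (qDelta a) =
    qW \o op_ten (qsig a) id \o adj qW;
  qDeltad : qAd -> multiplier (cten t qAd qAd);
  qDeltad_mor : mor qDeltad;
  qDeltadE : forall a, rep_ext (rep_ten qsigd qsigd) (qDeltad a) =
    hflip \o (adj qW \o op_ten id (qsigd a) \o qW) \o hflip;
  qV : multiplier (cten t qAd qA);
  qV_unitary : munitary qV;
  qVE : rep_ext (rep_ten qsigd qsig) qV = qW;
  qV_Delta : ext (mor_ten minj qDelta) qV =
    ext (mor_ten minj leg1) qV ** ext (mor_ten minj leg2) qV;
  qV_Deltad : ext (mor_ten qDeltad minj) qV =
    ext (mor_ten leg2 minj) qV ** ext (mor_ten leg1 minj) qV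
}.

Arguments qV {R t} _.
Arguments qDeltad {R t} _ _.

Section GProducts.
Context {R : realType} {t : tensor_models R}.
Implicit Types G : lcqg t.

(* [A_*] *)
Definition predual G : set (qA G -> R[i]) :=
  [set om | exists mu, forall a, om a = nf_app mu (qsig a)].

Arguments predual : clear implicits.

(* Continuous left actions of the dual of [G]. *)
Definition dual_action G (B : cstarType R)
    (beta : B -> multiplier (cten t (qAd G) B)) : Prop :=
  [/\ mor beta, injective beta,
      forall b, ext (mor_ten minj beta) (beta b) =
        ext cassoc (ext (mor_ten (qDeltad G) minj) (beta b))
    & closed_product (range leg1) (range beta) = range minj].

Record gproduct G := GProduct {
  gB :> cstarType R;
  gbeta : gB -> multiplier (cten t (qAd G) gB);
  gpsi : qAd G -> multiplier gB;
  gbeta_action : dual_action gbeta;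
  gpsi_mor : mor gpsi;
  gpsi_inj : injective gpsi;
  gbeta_psi : forall a,
    ext gbeta (gpsi a) = ext (mor_ten minj gpsi) (qDeltad G a)
}.

Arguments gbeta {G} _ _.
Arguments gpsi {G} _ _.

(* [V_{psi 2}] *)
Definition Vpsi G (P : gproduct G) : multiplier (cten t P (qA G)) :=
  ext (mor_ten (gpsi P) minj) (qV G).

(* [(id_B ⊗ om)(v (d ⊗ 1) (star v))] with [v = V_{psi 2}] *)
Definition landstad_action G (P : gproduct G) (om : qA G -> R[i])
    (d : multiplier P) : multiplier P :=
  slice om (Vpsi P ** mten d mone ** star (Vpsi P)).

Definition landstad_algebra G (P : gproduct G) (D : set (multiplier P)) :
    Prop :=
  [/\ cstar_subalgebra D,
      forall d, D d -> ext (gbeta P) d = mten mone d,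
      range minj = closed_product (range (gpsi P)) D
    & generated_cstar (closed_span
        [set landstad_action p.1 p.2 | p in predual G `*` D]) = D].

(* Isomorphisms of the Landstad systems [(D1, alpha1)] and [(D2, alpha2)]; only *)
(* the restriction of [i] to [D1] matters.                                      *)
Definition landstad_iso G (P1 P2 : gproduct G)
    (D1 : set (multiplier P1)) (D2 : set (multiplier P2))
    (i : multiplier P1 -> multiplier P2) : Prop :=
  [/\ set_bij D1 D2 i,
      forall (a : R[i]) d d', D1 d -> D1 d' ->
        i (a *: d + d') = a *: i d + i d',
      forall d d', D1 d -> D1 d' -> i (d ** d') = i d ** i d',
      forall d, D1 d -> i (star d) = star (i d)
    & forall om d, predual G om -> D1 d ->
        i (landstad_action om d) = landstad_action om (i d)].

Definition gproduct_iso G (P1 P2 : gproduct G) (j : P1 -> P2) : Prop :=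
  [/\ star_hom j, bijective j,
      forall a, ext (minj \o j) (gpsi P1 a) = gpsi P2 a
    & forall b, ext (mor_ten minj (minj \o j)) (gbeta P1 b) = gbeta P2 (j b)].

End GProducts.

(* Main.v *)
(* Let [J] be the closed span of the pairs [(psi1 a d, psi2 a (i d))] in the     *)
(* direct sum of [B1] and [B2], and [J'] its adjoint.  As [alpha] is defined by  *)
(* the slices of [V_psi (d ⊗ 1) V_psi^*] and the slices of [V] are dense in the  *)
(* dual algebra, [J'] is invariant under left multiplication by the pairs        *)
(* [(psi1 a, psi2 a)], and it is invariant under the pairs [(d, i d)].  Hence    *)
(* the intersection of [J] and [J'] is a C*-algebra, and its projections to [B1] *)
(* and [B2] have dense range.  They are injective: by the Heisenberg relation,   *)
(* [beta b] followed by conjugation with [V_psi] maps [psi a d] to               *)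
(* [(1 ⊗ a) V_psi (d ⊗ 1) V_psi^*], whose slices are determined, for the second  *)
(* component, by [i] and those for the first one.  Injective homomorphisms of    *)
(* C*-algebras being isometric, the intersection is the graph of an isomorphism. *)

Require Import Defs.
From HB Require Import structures.
From mathcomp Require Import all_boot all_order all_algebra.
From mathcomp Require Import complex.
From mathcomp Require Import boolp classical_sets functions reals topology
  normedtype sequences.
From mathcomp Require Import ring lra prodnormedzmodule.

Set Implicit Arguments.
Unset Strict Implicit.
Unset Printing Implicit Defensive.

Import Order.TTheory GRing.Theory Num.Theory numFieldNormedType.Exports.

Local Open Scope classical_set_scope.
Local Open Scope ring_scope.

(** An isomorphism [j] extending [i] must send [psi1 a d] to [psi2 a (i d)], and by (C2) such
    products span [B1]; this gives uniqueness. For existence the graph of [j] is constructed inside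
    the C*-algebra [P1 * P2]. Let [L] be the closed span of the pairs [(psi1 a d, psi2 a (i d))]
    ([gens]), and [L'] that of the pairs [(d psi1 a, i d psi2 a)] ([cogens]), which is the adjoint
    of [L]. The candidate, [graph], is the intersection of the two.

    It is single-valued and injective ([gens0l], [gens0r]). With [B] represented faithfully on [K],
    conjugation of the flipped [beta b] by [V_psi] gives an operator [Xop b] on [K ⊗ H]; by the
    Heisenberg relation ([heisenberg]) it equals [(1 ⊗ a) V_psi (d ⊗ 1) star V_psi] when
    [b = psi a d] ([Xop_gen]). Its slices in the second leg are, up to limits, values of the
    Landstad action at [d]. Hence they lie in [D], and [i] carries the slices of the first component
    to those of the second. This passes to closed spans because [D1] is closed and [i] is
    contractive ([matched_closed]). If one component vanishes, all slices of the other one vanish,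
    hence its [Xop], hence the component itself since [beta] is injective.

    It is a C*-algebra ([cogens_psi], [graph_alg]). Slices [a = (id ⊗ om) V] are dense in the dual
    algebra ([slice_dense]). For these, [psi a d psi x] is the slice of [V_psi (d ⊗ 1) star V_psi]
    times [V_psi (psi x ⊗ 1)]. Writing [om = om'(_ y)] and approximating [V (x ⊗ y)] by sums of
    [x_k ⊗ y_k] yields sums of [alpha(om'(_ y_k), d) psi x_k], formed identically in both
    components. So [L'] is stable under left multiplication by the pairs [(psi1 a, psi2 a)], and
    clearly by [(d, i d)]; it is therefore an algebra, as is its adjoint [L].

    It is everywhere defined and onto ([graph_total], [graph_onto]). It contains the pairs made of
    [psi a d psi x], whose components are total in [B1] and [B2], and its projections are injective
    *-homomorphisms, hence isometric ([graph_contr]), so their ranges are closed.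

    The C*-algebra theory underneath rests on one iterative square root, [msqrt]. From it follow
    contractivity of *-homomorphisms ([mhom_contr]), isometry of faithful representations
    ([rep_isom]), extension to multipliers ([gram_multiplier]), and tensor products of
    representations and morphisms ([rep_ten_ex], [mor_ten_ex]); these show that the objects chosen
    by [xget] satisfy their specifications. *)

(* [zmod] decides equations between sums and differences of atoms. *)
Inductive zterm := ZVar of nat | ZAdd of zterm & zterm | ZOpp of zterm | ZZero.

Section ZTerm.
Context {V : zmodType}.
Fixpoint zeval (env : seq V) (e : zterm) : V :=
  match e with
  | ZVar i => nth 0 env i
  | ZAdd e1 e2 => zeval env e1 + zeval env e2
  | ZOpp e1 => - zeval env e1
  | ZZero => 0
  end.

Fixpoint zcoef (e : zterm) (i : nat) : int :=
  match e with
  | ZVar j => (i == j)%:Z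
  | ZAdd e1 e2 => zcoef e1 i + zcoef e2 i
  | ZOpp e1 => - zcoef e1 i
  | ZZero => 0
  end.

Lemma zevalE env e : zeval env e = \sum_(i < size env) nth 0 env i *~ zcoef e i.
Proof.
elim: e => [j|e1 IH1 e2 IH2|e1 IH1|] /=.
- have [js|js] := ltnP j (size env); last first.
    rewrite nth_default // big1 // => i _.
    by rewrite (_ : _ == _ = false) ?mulr0z //; apply/ltn_eqF/(leq_trans _ js).
  rewrite (bigD1 (Ordinal js)) //= eqxx mulr1z big1 ?addr0 // => i ij.
  by rewrite (_ : (i : nat) == j = false) ?mulr0z //; apply/negbTE.
- by rewrite IH1 IH2 -big_split; apply: eq_bigr => i _; rewrite mulrzDr.
- by rewrite IH1 -sumrN; apply: eq_bigr => i _; rewrite mulrNz.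
- by rewrite big1 // => i _; rewrite mulr0z.
Qed.

Lemma zterm_eq n env e1 e2 : size env = n ->
  all (fun i => zcoef e1 i == zcoef e2 i) (iota 0 n) ->
  zeval env e1 = zeval env e2.
Proof.
move=> <- /allP h; rewrite !zevalE; apply: eq_bigr => i _.
by rewrite (eqP (h i _)) // mem_iota ltn_ord.
Qed.
End ZTerm.

(* Atoms are compared up to unification, because canonical instances may differ *)
(* syntactically.                                                               *)
Ltac zsame x y :=
  match goal with
  | _ => let _ := match goal with _ => unify x y end in constr:(true)
  | _ => constr:(false)
  end.
Ltac zindex x l :=
  lazymatch l with
  | cons ?y ?l' =>
    lazymatch zsame x y with
    | true => constr:(0%N)
    | false => let n := zindex x l' in constr:(S n)
    end
  end.
Ltac zmem x l :=
  lazymatch l with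
  | nil => constr:(false)
  | cons ?y ?l' =>
    lazymatch zsame x y with true => constr:(true) | false => zmem x l' end
  end.
Ltac zinsert x l :=
  lazymatch zmem x l with true => l | false => constr:(cons x l) end.
Ltac zatoms e l :=
  lazymatch e with
  | (?a + ?b)%R => let l' := zatoms a l in zatoms b l'
  | (- ?a)%R => zatoms a l
  | 0%R => l
  | _ => zinsert e l
  end.
Ltac zreify e l :=
  lazymatch e with
  | (?a + ?b)%R => let a' := zreify a l in let b' := zreify b l in constr:(ZAdd a' b')
  | (- ?a)%R => let a' := zreify a l in constr:(ZOpp a')
  | 0%R => constr:(ZZero)
  | _ => let n := zindex e l in constr:(ZVar n)
  end.
Ltac zlength l :=
  lazymatch l with
  | cons _ ?l' => let n := zlength l' in constr:(S n)
  | nil => constr:(0%N)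
  end.
Ltac zmod :=
  lazymatch goal with
  | |- ?a = ?b :> ?V =>
    let l := zatoms a (@nil V) in let l := zatoms b l in
    let a' := zreify a l in let b' := zreify b l in let n := zlength l in
    refine (@zterm_eq _ n l a' b' erefl _); vm_compute; reflexivity
  end.

(** * Normed spaces and Hilbert spaces *)

Section RealNorm.
Context {R : realType}.
Implicit Types (r : R) (a b : R[i]).

(** Norms take values in [R[i]]; [cn] and [nrm] extract the real number and [rc] embeds it back, so
    that all estimates take place in the ordered field [R]. *)
Definition cn a : R := complex.Re `|a|.
Definition rc r : R[i] := Complex r 0.

Lemma cnE a : rc (cn a) = `|a|.
Proof. by rewrite /rc /cn normc_def. Qed.

Lemma rc_le r r' : (rc r <= rc r') = (r <= r').
Proof. by rewrite lecE /= eqxx. Qed.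

Lemma rc_lt r r' : (rc r < rc r') = (r < r').
Proof. by rewrite ltcE /= eqxx. Qed.

Lemma rcD r r' : rc (r + r') = rc r + rc r'.
Proof. exact: (rmorphD (real_complex R)). Qed.

Lemma rcB r r' : rc (r - r') = rc r - rc r'.
Proof. exact: (rmorphB (real_complex R)). Qed.

Lemma rcM r r' : rc (r * r') = rc r * rc r'.
Proof. exact: (rmorphM (real_complex R)). Qed.

Lemma rc_inj r r' : rc r = rc r' -> r = r'.
Proof. by case. Qed.

Lemma rc_pos a : 0 < a -> exists2 r, 0 < r & a = rc r.
Proof.
case: a => x y; rewrite ltcE /= => /andP[/eqP -> x0]; by exists x.
Qed.

Lemma cn_rc r : cn (rc r) = `|r|.
Proof. by rewrite /cn normc_def /= expr0n /= addr0 sqrtr_sqr. Qed.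

Lemma cn_ge0 a : 0 <= cn a.
Proof. by rewrite -rc_le cnE normr_ge0. Qed.

Lemma cnM a b : cn (a * b) = cn a * cn b.
Proof. by apply: rc_inj; rewrite rcM !cnE normrM. Qed.

Lemma cnD a b : cn (a + b) <= cn a + cn b.
Proof. by rewrite -rc_le rcD !cnE ler_normD. Qed.

Lemma cn0 : cn 0 = 0.
Proof. by apply: rc_inj; rewrite cnE normr0. Qed.

Lemma cn1 : cn 1 = 1.
Proof. by apply: rc_inj; rewrite cnE normr1. Qed.

Lemma cnN a : cn (- a) = cn a.
Proof. by apply: rc_inj; rewrite !cnE normrN. Qed.

Lemma cn_eq0 a : cn a = 0 -> a = 0.
Proof. by move=> h; apply/normr0_eq0; rewrite -cnE h. Qed.

Lemma conjE a : Num.conj a = conjc a.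
Proof. by []. Qed.

Lemma conj_rc r : Num.conj (rc r) = rc r.
Proof. by rewrite conjE /rc /= oppr0. Qed.

Lemma cn_conj a : cn (Num.conj a) = cn a.
Proof. by apply: rc_inj; rewrite !cnE conjE normcJ. Qed.

Lemma Re_le_cn a : complex.Re a <= cn a.
Proof.
rewrite -rc_le cnE; apply: le_trans (normc_ge_Re a).
by rewrite lecR ler_norm.
Qed.

Section Normed.
Context {V W : normedModType R[i]}.
Implicit Types x y : V.

Definition nrm {V : normedModType R[i]} (x : V) : R := complex.Re `|x|.

Lemma nrmE x : rc (nrm x) = `|x|.
Proof.
rewrite /rc /nrm; have := normr_ge0 x; case: (`|x|) => u v.
by rewrite lecE /= => /andP[/eqP -> _].
Qed.

Lemma nrm_ge0 x : 0 <= nrm x.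
Proof. by rewrite -rc_le nrmE normr_ge0. Qed.

Lemma nrmD x y : nrm (x + y) <= nrm x + nrm y.
Proof. by rewrite -rc_le rcD !nrmE ler_normD. Qed.

Lemma nrmN x : nrm (- x) = nrm x.
Proof. by apply: rc_inj; rewrite !nrmE normrN. Qed.

Lemma nrmB x y : nrm (x - y) <= nrm x + nrm y.
Proof. by rewrite -(nrmN y); exact: nrmD. Qed.

Lemma nrmC x y : nrm (x - y) = nrm (y - x).
Proof. by rewrite -nrmN opprB. Qed.

Lemma nrmZ a x : nrm (a *: x) = cn a * nrm x.
Proof. by apply: rc_inj; rewrite rcM cnE !nrmE normrZ. Qed.

Lemma nrm0 : nrm (0 : V) = 0.
Proof. by apply: rc_inj; rewrite nrmE normr0. Qed.

Lemma nrm_eq0 x : nrm x = 0 -> x = 0.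
Proof. by move=> h; apply/normr0_eq0; rewrite -nrmE h. Qed.

Lemma nrm_le0 x : nrm x <= 0 -> x = 0.
Proof. by move=> h; apply: nrm_eq0; apply: le_anti; rewrite h nrm_ge0. Qed.

Lemma nrm_tri x y z : nrm (x - z) <= nrm (x - y) + nrm (y - z).
Proof. by rewrite -[x - z](subrKA y); exact: nrmD. Qed.

Lemma nrm_small x : (forall e : R, 0 < e -> nrm x <= e) -> x = 0.
Proof.
move=> h; apply: nrm_le0; apply/ler_addgt0Pr => e e0; rewrite add0r; exact: h.
Qed.

Lemma nrm_eq x y : (forall e : R, 0 < e -> nrm (x - y) <= e) -> x = y.
Proof. by move=> h; apply/eqP; rewrite -subr_eq0; apply/eqP/nrm_small. Qed.

Lemma nrm_closureP (S : set V) x :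
  closure S x <-> forall e : R, 0 < e -> exists2 y, S y & nrm (x - y) <= e.
Proof.
split=> [cl e e0|h B /nbhs_ballP[a /= /rc_pos[e e0 ->] hB]].
- have /cl[y [Sy hy]] : nbhs x (ball x (rc e)) by apply: nbhsx_ballx; rewrite rc_lt.
  exists y => //; move: hy; rewrite -ball_normE /ball_ /= -nrmE rc_lt.
  exact: ltW.
- have e20 : 0 < e / 2 by rewrite divr_gt0.
  have [y Sy hy] := h _ e20; exists y; split=> //; apply: hB.
  rewrite -ball_normE /ball_ /= -nrmE rc_lt; apply: le_lt_trans hy _.
  by rewrite ltr_pdivrMr // ltr_pMr // ltr1n.
Qed.

Lemma closureT_dense (S : set V) :
  closure S = setT -> forall x (e : R), 0 < e -> exists2 y, S y & nrm (x - y) <= e.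
Proof. by move=> cl x; apply/nrm_closureP; rewrite cl. Qed.

End Normed.

Section Linear.
Context {V W : lmodType R[i]} {f : V -> W}.
Hypothesis lf : linear f.
Lemma lin0 : f 0 = 0.
Proof. by have := lf (-1) 0 0; rewrite scaler0 addr0 scaleN1r addNr. Qed.
Lemma linD x y : f (x + y) = f x + f y.
Proof. by have := lf 1 x y; rewrite !scale1r. Qed.
Lemma linZ a x : f (a *: x) = a *: f x.
Proof. by have := lf a x 0; rewrite lin0 !addr0. Qed.
Lemma linN x : f (- x) = - f x.
Proof. by rewrite -scaleN1r linZ scaleN1r. Qed.
Lemma linB x y : f (x - y) = f x - f y.
Proof. by rewrite linD linN. Qed.
Lemma lin_sum (I : Type) (s : seq I) (F : I -> V) :
  f (\sum_(i <- s) F i) = \sum_(i <- s) f (F i).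
Proof. by elim/big_ind2 : _ => [|u u' v v' <- <-|//]; [exact: lin0|exact: linD]. Qed.
End Linear.

Lemma bounded_opP {V W : normedModType R[i]} (f : V -> W) :
  bounded_op f <->
  linear f /\ exists2 C : R, 0 <= C & forall x, nrm (f x) <= C * nrm x.
Proof.
split=> [[lf cf]|[lf [C C0 hC]]].
- split=> //; have /cvgrPdist_lt/(_ 1 ltr01) := cf 0.
  move=> /nbhs_ballP[a /= /rc_pos[d d0 ->] hd].
  exists (2 / d) => [|x]; first by rewrite divr_ge0 // ltW.
  have [->|x0] := eqVneq x 0; first by rewrite (lin0 lf) !nrm0 mulr0.
  have nx : 0 < nrm x.
    rewrite lt_def nrm_ge0 andbT; apply: contra_neq x0; exact: nrm_eq0.
  pose c := d / 2 / nrm x.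
  have c0 : 0 < c by rewrite !divr_gt0.
  have : ball 0 (rc d) (rc c *: x).
    rewrite -ball_normE /ball_ /= sub0r normrN -nrmE rc_lt nrmZ cn_rc gtr0_norm //.
    by rewrite divfK ?gt_eqF // ltr_pdivrMr // ltr_pMr // ltr1n.
  move=> /hd /=; rewrite (lin0 lf) sub0r normrN (linZ lf) -nrmE -[1]/(rc 1) rc_lt.
  rewrite nrmZ cn_rc gtr0_norm // => /ltW.
  rewrite mulrC -ler_pdivlMr // mul1r /c !invfM !invrK.
  by move=> h; apply: le_trans h _; rewrite mulrC [2 / d]mulrC [leRHS]mulrC mulrCA.
- split=> //; have := @linear_bounded_continuous R[i] V W
     (HB.pack f (GRing.isLinear.Build _ _ _ _ _ lf)).
  case=> + _; apply => /=.
  apply/ex_bound; exists (rc C); apply/nbhs_normP; exists 1 => //= x /=.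
  rewrite sub0r normrN -!nrmE -[1]/(rc 1) rc_lt rc_le => hx.
  apply: le_trans (hC x) _; rewrite -[leRHS]mulr1; apply: ler_wpM2l => //.
  exact: ltW.
Qed.

Lemma nrm_complete {V : completeNormedModType R[i]} (u : nat -> V) :
  (forall e : R, 0 < e -> exists N, forall n m, (N <= n)%N -> (N <= m)%N ->
     nrm (u n - u m) <= e) ->
  exists l, forall e : R, 0 < e -> exists N, forall n, (N <= n)%N ->
     nrm (u n - l) <= e.
Proof.
move=> cu.
have : cauchy (u @ \oo).
  apply: cauchy_exP => a /= /rc_pos[e e0 ->].
  have e20 : 0 < e / 2 by rewrite divr_gt0.
  have [N hN] := cu _ e20; exists (u N).
  exists N => // n /= Nn; rewrite -ball_normE /ball_ /= -nrmE rc_lt.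
  apply: le_lt_trans (hN _ _ _ _) _ => //.
  by rewrite ltr_pdivrMr // ltr_pMr // ltr1n.
move=> /cauchy_cvg; rewrite cvg_ex => -[l hl]; exists l => e e0.
have /cvgrPdist_lt/(_ (rc e)) := hl.
rewrite rc_lt => /(_ e0) [N _ hN]; exists N => n Nn.
by have := hN n Nn; rewrite /= -nrmE rc_lt nrmC => /ltW.
Qed.

End RealNorm.

(** * Extension of bounded maps from dense sets *)

Section Extension.
Context {R : realType}.

Lemma small_inv (e : R) : 0 < e -> exists N, forall n, (N <= n)%N -> n.+1%:R^-1 <= e.
Proof.
move=> e0; exists (Num.truncn e^-1) => n Nn.
rewrite -[leRHS]invrK lef_pV2 ?posrE ?invr_gt0 ?ltr0Sn //.
apply/ltW; apply: lt_le_trans (truncnS_gt _) _.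
by rewrite ler_nat.
Qed.

Lemma small_factor (C e : R) : 0 <= C -> 0 < e -> exists2 d : R, 0 < d & C * d <= e.
Proof.
move=> C0 e0; exists (e / (C + 1)); first by rewrite divr_gt0 // ltr_wpDl.
rewrite mulrA ler_pdivrMr ?ltr_wpDl // mulrDr mulr1 mulrC lerDl; exact: ltW.
Qed.

(** The closure [G] of the relation between [phi i] and [th i] is total by completeness and
    single-valued by the norm bound; the bound also makes [th] depend on [phi i] only. Indices
    instead of a subspace allow formal sums as the domain. *)
Lemma blt {V : normedModType R[i]} {W : completeNormedModType R[i]} (I : Type)
    (phi : I -> V) (th : I -> W) (C : R) :
  (forall (a : R[i]) i j, exists k, phi k = a *: phi i + phi j /\
     th k = a *: th i + th j) ->
  0 <= C -> (forall i, nrm (th i) <= C * nrm (phi i)) ->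
  closure (range phi) = setT ->
  exists S : V -> W, [/\ linear S, forall x, nrm (S x) <= C * nrm x
    & forall i, S (phi i) = th i].
Proof.
move=> lc C0 hC dn.
pose G x y := forall e : R, 0 < e -> exists i, nrm (x - phi i) <= e /\
  nrm (y - th i) <= e.
have thB i j : nrm (th i - th j) <= C * nrm (phi i - phi j).
  have [k [pk tk]] := lc (-1) j i.
  have -> : th i - th j = th k by rewrite tk scaleN1r addrC.
  have -> : phi i - phi j = phi k by rewrite pk scaleN1r addrC.
  exact: hC.
have Gex x : exists y, G x y.
  have hs n : exists i, nrm (x - phi i) <= n.+1%:R^-1.
    have n0 : (0 : R) < n.+1%:R^-1 by rewrite invr_gt0.
    by have [_ [i _ <-] hi] := closureT_dense dn x n0; exists i.
  have [s hs'] := choice hs.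
  have [|y hy] := nrm_complete (u := th \o s).
    move=> e e0; have e20 : 0 < e / 2 by rewrite divr_gt0.
    have [d d0 hd] := small_factor C0 e20.
    have [N hN] := small_inv d0; exists N => n m Nn Nm /=.
    apply: le_trans (thB _ _) _; apply: le_trans (_ : C * (d + d) <= _).
      apply: ler_wpM2l => //; apply: le_trans (nrm_tri _ x _) _.
      by rewrite nrmC; apply: lerD; apply: le_trans (hs' _) _; exact: hN.
    by rewrite mulrDr [leRHS]splitr lerD.
  exists y => e e0; have [N hN] := hy e e0; have [N' hN'] := small_inv e0.
  exists (s (maxn N N')); split.
    by apply: le_trans (hs' _) _; apply: hN'; exact: leq_maxr.
  by rewrite nrmC; apply: hN; exact: leq_maxl.
have [S hS] := choice Gex.
have Gf x y y' : G x y -> G x y' -> y = y'.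
  move=> g g'; apply: nrm_eq => e e0.
  have D0 : 0 <= C * 2 + 2 by rewrite addr_ge0 // mulr_ge0.
  have [d d0 hd] := small_factor D0 e0.
  have [i [hi1 hi2]] := g d d0; have [j [hj1 hj2]] := g' d d0.
  apply: le_trans hd; apply: le_trans (nrm_tri _ (th i) _) _.
  apply: le_trans (_ : d + (C * (d + d) + d) <= _); last by lra.
  apply: lerD => //; apply: le_trans (nrm_tri _ (th j) _) _.
  apply: lerD; last by rewrite nrmC.
  apply: le_trans (thB _ _) _; apply: ler_wpM2l => //.
  by apply: le_trans (nrm_tri _ x _) _; rewrite nrmC lerD.
exists S; split=> [a x y|x|i].
- apply: Gf (hS _) _ => e e0.
  have D0 : 0 <= cn a + 1 by rewrite addr_ge0 // cn_ge0.
  have [d d0 hd] := small_factor D0 e0.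
  have [i [hi1 hi2]] := hS x d d0; have [j [hj1 hj2]] := hS y d d0.
  have [k [ek ek']] := lc a i j; exists k; rewrite ek ek'.
  have key (V' : normedModType R[i]) (u u' v v' : V') : nrm (u - u') <= d ->
      nrm (v - v') <= d -> nrm (a *: u + v - (a *: u' + v')) <= e.
    move=> h h'; apply: le_trans hd; rewrite opprD addrACA -scalerBr.
    apply: le_trans (nrmD _ _) _; rewrite nrmZ mulrDl mul1r lerD //.
    by apply: ler_wpM2l => //; exact: cn_ge0.
  by split; apply: key.
- apply/ler_addgt0Pr => e e0.
  have D0 : 0 <= C + 1 by rewrite addr_ge0.
  have [d d0 hd] := small_factor D0 e0.
  have [i [hi1 hi2]] := hS x d d0.
  rewrite -[S x](subrK (th i)); apply: le_trans (nrmD _ _) _.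
  apply: le_trans (_ : d + C * (nrm x + d) <= _); last by nra.
  apply: lerD => //; apply: le_trans (hC _) _; apply: ler_wpM2l => //.
  rewrite -[phi i](subrK x); apply: le_trans (nrmD _ _) _.
  by rewrite nrmC addrC lerD.
- by apply: Gf (hS _) _ => e e0; exists i; rewrite !subrr !nrm0 ltW.
Qed.

(** All total sets below have this shape: elementary tensors, vectors [pi x v] of a nondegenerate
    representation, elements [f x y] for a morphism [f]. *)
Definition psum {V : zmodType} {A B : Type} (f : A -> B -> V) (s : seq (A * B)) :=
  \sum_(p <- s) f p.1 p.2.

Lemma psum_lc {V W : lmodType R[i]} {A : lmodType R[i]} {B : Type}
    (f : A -> B -> V) (g : A -> B -> W) :
  (forall (a : R[i]) x b, f (a *: x) b = a *: f x b) ->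
  (forall (a : R[i]) x b, g (a *: x) b = a *: g x b) ->
  forall (a : R[i]) s s', exists k, psum f k = a *: psum f s + psum f s' /\
     psum g k = a *: psum g s + psum g s'.
Proof.
move=> fZ gZ a s s'; exists ([seq (a *: p.1, p.2) | p <- s] ++ s').
rewrite /psum !big_cat !big_map /= !scaler_sumr.
by split; congr (_ + _); apply: eq_bigr => p _; rewrite ?fZ ?gZ.
Qed.

(** Additivity of the extension comes from concatenating formal sums, so only homogeneity in the
    first argument enters as an algebraic hypothesis. *)
Lemma blt2 {V : normedModType R[i]} {W : completeNormedModType R[i]}
    {A : lmodType R[i]} {B : Type} (f : A -> B -> V) (g : A -> B -> W) (C : R) :
  (forall (a : R[i]) x b, f (a *: x) b = a *: f x b) ->
  (forall (a : R[i]) x b, g (a *: x) b = a *: g x b) ->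
  closure (range (psum f)) = setT ->
  0 <= C -> (forall s, nrm (psum g s) <= C * nrm (psum f s)) ->
  exists S : V -> W, [/\ linear S, forall x, nrm (S x) <= C * nrm x
    & forall x b, S (f x b) = g x b].
Proof.
move=> fZ gZ dn C0 hC.
have [S [lS bS hS]] := blt (psum_lc fZ gZ) C0 hC dn.
exists S; split=> // x b.
by have := hS [:: (x, b)]; rewrite /psum !big_seq1.
Qed.

Lemma psum_map {V W : lmodType R[i]} {A B : Type} (f : A -> B -> V) (S : V -> W)
  (s : seq (A * B)) : linear S -> S (psum f s) = psum (fun a b => S (f a b)) s.
Proof. by move=> lS; rewrite /psum (lin_sum lS). Qed.

Lemma bop_ext {V W : normedModType R[i]} {A B : Type} (f : A -> B -> V) (S S' : V -> W) :
  bounded_op S -> bounded_op S' -> closure (range (psum f)) = setT ->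
  (forall a b, S (f a b) = S' (f a b)) -> S = S'.
Proof.
move=> /bounded_opP[lS [C C0 hC]] /bounded_opP[lS' [C' C0' hC']] dn h.
apply/funext => x; apply: nrm_eq => e e0.
have D0 : 0 <= C + C' by rewrite addr_ge0.
  have [d d0 hd] := small_factor D0 e0.
have [_ [s _ <-] hs] := closureT_dense dn x d0.
apply: le_trans hd; rewrite mulrDl.
apply: le_trans (nrm_tri _ (S (psum f s)) _) _; apply: lerD.
  by rewrite -(linB lS); apply: le_trans (hC _) _; apply: ler_wpM2l.
have -> : S (psum f s) = S' (psum f s).
  by rewrite !psum_map //; apply: eq_bigr => p _; rewrite h.
rewrite -(linB lS'); apply: le_trans (hC' _) _; apply: ler_wpM2l => //.
by rewrite nrmC.
Qed.

Lemma bopI {V W : normedModType R[i]} (f : V -> W) (C : R) :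
  linear f -> 0 <= C -> (forall x, nrm (f x) <= C * nrm x) -> bounded_op f.
Proof. by move=> lf C0 h; apply/bounded_opP; split=> //; exists C. Qed.

Lemma bop_comp {U V W : normedModType R[i]} (g : V -> W) (f : U -> V) :
  bounded_op g -> bounded_op f -> bounded_op (g \o f).
Proof.
move=> /bounded_opP[lg [C C0 hC]] /bounded_opP[lf [C' C0' hC']].
apply: (bopI (C := C * C')); rewrite ?mulr_ge0 //.
  by move=> a x y; rewrite /= lf lg.
move=> x; apply: le_trans (hC _) _; rewrite -mulrA; exact: ler_wpM2l.
Qed.

Lemma bop_id {V : normedModType R[i]} : bounded_op (@id V).
Proof. by apply: (bopI (C := 1)) => // x; rewrite mul1r. Qed.

Lemma bop_lin {V W : normedModType R[i]} (f : V -> W) : bounded_op f -> linear f.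
Proof. by case. Qed.

Lemma bop_lc {V W : normedModType R[i]} (f g : V -> W) (a : R[i]) :
  bounded_op f -> bounded_op g -> bounded_op (fun x => a *: f x + g x).
Proof.
move=> /bounded_opP[lf [C C0 hC]] /bounded_opP[lg [C' C0' hC']].
apply: (bopI (C := cn a * C + C')); rewrite ?addr_ge0 ?mulr_ge0 ?cn_ge0 //.
  move=> b x y; rewrite lf lg !scalerDr !scalerA [a * b]mulrC -!addrA; congr (_ + _).
  by rewrite addrCA.
move=> x; apply: le_trans (nrmD _ _) _; rewrite nrmZ mulrDl -mulrA lerD //.
by apply: ler_wpM2l; rewrite ?cn_ge0.
Qed.

End Extension.

(** * Inner products and Hilbert tensor products *)

Section HilbertBasics.
Context {R : realType}.
Implicit Types H K : hilbertType R.

Section One.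
Context {H : hilbertType R}.
Implicit Types x y z : H.

Lemma dotDl x y z : dot (x + y) z = dot x z + dot y z.
Proof. by rewrite dotC dotDr rmorphD /= -!dotC. Qed.
Lemma dotZl (a : R[i]) x y : dot (a *: x) y = Num.conj a * dot x y.
Proof. by rewrite dotC dotZr rmorphM /= -dotC. Qed.
Lemma dot0r x : dot x 0 = 0.
Proof. by rewrite -(scale0r 0) dotZr mul0r. Qed.
Lemma dot0l x : dot 0 x = 0.
Proof. by rewrite dotC dot0r rmorph0. Qed.
Lemma dotNr x y : dot x (- y) = - dot x y.
Proof. by rewrite -scaleN1r dotZr mulN1r. Qed.
Lemma dotNl x y : dot (- x) y = - dot x y.
Proof. by rewrite dotC dotNr rmorphN /= -dotC. Qed.
Lemma dotBr x y z : dot x (y - z) = dot x y - dot x z.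
Proof. by rewrite dotDr dotNr. Qed.
Lemma dotBl x y z : dot (x - y) z = dot x z - dot y z.
Proof. by rewrite dotDl dotNl. Qed.
Lemma dot_sumr (I : Type) (s : seq I) x (F : I -> H) :
  dot x (\sum_(i <- s) F i) = \sum_(i <- s) dot x (F i).
Proof. by elim/big_rec2 : _ => [|i y z _ <-]; rewrite ?dot0r ?dotDr. Qed.
Lemma dot_suml (I : Type) (s : seq I) x (F : I -> H) :
  dot (\sum_(i <- s) F i) x = \sum_(i <- s) dot (F i) x.
Proof. by elim/big_rec2 : _ => [|i y z _ <-]; rewrite ?dot0l ?dotDl. Qed.

Lemma dotxx x : dot x x = rc (nrm x ^+ 2).
Proof. by rewrite dot_norm -nrmE expr2 -rcM -expr2. Qed.

Lemma dot_linear x : linear (dot x : H -> R[i]^o).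
Proof. by move=> a y z; rewrite dotDr dotZr. Qed.

Lemma mulcJ (a : R[i]) : a * Num.conj a = rc (cn a ^+ 2).
Proof. by rewrite conjE -sqr_normc -cnE expr2 -rcM. Qed.

Lemma cauchy_schwarz x y : cn (dot x y) <= nrm x * nrm y.
Proof.
have [->|x0] := eqVneq x 0; first by rewrite dot0l cn0 nrm0 mul0r.
set a := dot x y; pose n := nrm x ^+ 2.
have n0 : 0 < n.
  rewrite exprn_gt0 // lt_def nrm_ge0 andbT; apply: contra_neq x0; exact: nrm_eq0.
have : 0 <= n * (n * nrm y ^+ 2 - cn a ^+ 2).
  rewrite -rc_le.
  have -> : rc (n * (n * nrm y ^+ 2 - cn a ^+ 2)) =
      dot (rc n *: y - a *: x) (rc n *: y - a *: x).
    rewrite !(dotBl, dotBr, dotZl, dotZr) !conj_rc !dotxx -/n [dot y x]dotC -/a.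
    rewrite rcM rcB rcM -mulcJ; ring.
  by rewrite dotxx rc_le sqr_ge0.
rewrite pmulr_rge0 // subr_ge0 /n -exprMn ler_pXn2r // nnegrE ?cn_ge0 //.
by rewrite mulr_ge0 // nrm_ge0.
Qed.

Lemma dot_eqP x y : (forall z, dot z x = dot z y) -> x = y.
Proof.
move=> h; apply/eqP; rewrite -subr_eq0; apply/eqP/nrm_eq0/eqP.
rewrite -sqrf_eq0; apply/eqP/rc_inj.
by rewrite -dotxx dotBr h subrr.
Qed.

Lemma nrm_dot_le x (c : R) : 0 <= c ->
  (forall z, cn (dot z x) <= c * nrm z) -> nrm x <= c.
Proof.
move=> c0 /(_ x); rewrite dotxx cn_rc ger0_norm ?sqr_ge0 // expr2.
have [-> //|x0] := eqVneq (nrm x) 0.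
by rewrite ler_pM2r // lt_def x0 nrm_ge0.
Qed.

Lemma dot_bop x : bounded_op (dot x : H -> R[i]^o).
Proof.
apply: (bopI (C := nrm x)); [exact: dot_linear|exact: nrm_ge0|].
exact: cauchy_schwarz.
Qed.

End One.

Lemma adjP H K (T : H -> K) (S : K -> H) :
  (forall x y, dot (T x) y = dot x (S y)) -> adj T = S.
Proof.
move=> h; apply/funext => y; apply: dot_eqP => x.
rewrite -h /adj; case: xgetP => [S' _ /= -> //|/(_ S)]; by [].
Qed.

Lemma unitary_adj H K (U : H -> K) : unitary U ->
  [/\ forall x y, dot (U x) y = dot x (adj U y),
      forall x, adj U (U x) = x & forall y, U (adj U y) = y].
Proof.
move=> [lU dU sU]; have [S hS] := choice sU.
have h : forall x y, dot (U x) y = dot x (S y) by move=> x y; rewrite -{1}(hS y) dU.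
rewrite (adjP h); split=> // x; apply: dot_eqP => z.
by rewrite -h dU.
Qed.

Lemma unitary_nrm H K (U : H -> K) x : unitary U -> nrm (U x) = nrm x.
Proof.
move=> [_ dU _]; have := dU x x; rewrite !dotxx => /rc_inj /eqP.
by rewrite eqrXn2 ?nrm_ge0 // => /eqP.
Qed.

Lemma unitary_bop H K (U : H -> K) : unitary U -> bounded_op U.
Proof.
move=> uU; apply: (bopI (C := 1)) => //; first by case: uU.
by move=> x; rewrite mul1r unitary_nrm.
Qed.

End HilbertBasics.

Section HilbertTensor.
Context {R : realType} {H K : hilbertType R} (T : hilbert_tensor H K).
Local Notation "x ⊠ y" := (hpair T x y) (at level 30).

Lemma hdense : closure (range (psum (hpair T))) = setT.
Proof. exact: hpair_total. Qed.

Lemma hsep (u v : T) : (forall x y, dot (x ⊠ y) u = dot (x ⊠ y) v) -> u = v.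
Proof.
move=> h; apply: dot_eqP => z.
have e : (dot u : T -> R[i]^o) = dot v.
  by apply: bop_ext hdense _; [exact: dot_bop|exact: dot_bop|];
    move=> x y; rewrite dotC h -dotC.
by rewrite dotC -/(dot u z) e -dotC.
Qed.

Lemma hpairDl x x' y : (x + x') ⊠ y = x ⊠ y + x' ⊠ y.
Proof. by apply: hsep => u v; rewrite dotDr !hpair_dot dotDr mulrDl. Qed.
Lemma hpairDr x y y' : x ⊠ (y + y') = x ⊠ y + x ⊠ y'.
Proof. by apply: hsep => u v; rewrite dotDr !hpair_dot dotDr mulrDr. Qed.
Lemma hpairZl (a : R[i]) x y : (a *: x) ⊠ y = a *: (x ⊠ y).
Proof. by apply: hsep => u v; rewrite dotZr !hpair_dot dotZr mulrA. Qed.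
Lemma hpairZr (a : R[i]) x y : x ⊠ (a *: y) = a *: (x ⊠ y).
Proof. by apply: hsep => u v; rewrite dotZr !hpair_dot dotZr mulrCA. Qed.

Lemma hpair_linl y : linear (fun x => x ⊠ y).
Proof. by move=> a u v; rewrite hpairDl hpairZl. Qed.
Lemma hpair_linr x : linear (fun y => x ⊠ y).
Proof. by move=> a u v; rewrite hpairDr hpairZr. Qed.

Lemma hpair_nrm x y : nrm (x ⊠ y) = nrm x * nrm y.
Proof.
apply/eqP; rewrite -(@eqrXn2 _ 2) ?nrm_ge0 ?mulr_ge0 ?nrm_ge0 //.
by apply/eqP/rc_inj; rewrite -dotxx hpair_dot !dotxx -rcM exprMn.
Qed.

Lemma hpair_bopl y : bounded_op (fun x => x ⊠ y).
Proof.
apply: (bopI (C := nrm y)); [exact: hpair_linl|exact: nrm_ge0|].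
by move=> x; rewrite hpair_nrm mulrC.
Qed.

Lemma hpair_bopr x : bounded_op (fun y => x ⊠ y).
Proof.
apply: (bopI (C := nrm x)); [exact: hpair_linr|exact: nrm_ge0|].
by move=> y; rewrite hpair_nrm.
Qed.

Lemma hbop_ext (W : normedModType R[i]) (S S' : T -> W) :
  bounded_op S -> bounded_op S' ->
  (forall x y, S (x ⊠ y) = S' (x ⊠ y)) -> S = S'.
Proof. by move=> b b'; exact: bop_ext hdense. Qed.

End HilbertTensor.

(** * Multiplier algebras *)

Section StarAlg.
Context {R : realType} {A : starAlgType R}.
Implicit Types x y z : A.

Lemma sm_lin_l y : linear (fun x => x ** y).
Proof. by move=> a u v; rewrite smulDl smulZl. Qed.
Lemma sm_lin_r x : linear (fun y => x ** y).
Proof. by move=> a u v; rewrite smulDr smulZr. Qed.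
Lemma sm0l x : 0 ** x = 0. Proof. exact: (lin0 (sm_lin_l x)). Qed.
Lemma sm0r x : x ** 0 = 0. Proof. exact: (lin0 (sm_lin_r x)). Qed.
Lemma smNl x y : (- x) ** y = - (x ** y). Proof. exact: (linN (sm_lin_l y)). Qed.
Lemma smNr x y : x ** (- y) = - (x ** y). Proof. exact: (linN (sm_lin_r x)). Qed.
Lemma smBl x y z : (x - y) ** z = x ** z - y ** z.
Proof. by rewrite smulDl smNl. Qed.
Lemma smBr x y z : x ** (y - z) = x ** y - x ** z.
Proof. by rewrite smulDr smNr. Qed.
Lemma sm_suml (I : Type) (s : seq I) (F : I -> A) y :
  (\sum_(i <- s) F i) ** y = \sum_(i <- s) F i ** y.
Proof. exact: (lin_sum (sm_lin_l y)). Qed.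
Lemma sm_sumr (I : Type) (s : seq I) (F : I -> A) y :
  y ** (\sum_(i <- s) F i) = \sum_(i <- s) y ** F i.
Proof. exact: (lin_sum (sm_lin_r y)). Qed.
Lemma star0 : star 0 = 0 :> A.
Proof. by apply: (addrI (star 0)); rewrite -starD !addr0. Qed.
Lemma starN x : star (- x) = - star x.
Proof. by apply: (addrI (star x)); rewrite -starD !subrr star0. Qed.
Lemma starB x y : star (x - y) = star x - star y.
Proof. by rewrite starD starN. Qed.
Lemma starZr (r : R) x : star (rc r *: x) = rc r *: star x.
Proof. by rewrite starZ conj_rc. Qed.
Lemma star_sum (I : Type) (s : seq I) (F : I -> A) :
  star (\sum_(i <- s) F i) = \sum_(i <- s) star (F i).
Proof. by elim/big_rec2 : _ => [|i y z _ <-]; rewrite ?star0 ?starD. Qed.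
End StarAlg.

Section StarHom.
Context {R : realType} {X Y : starAlgType R} {f : X -> Y}.
Hypothesis hf : star_hom f.
Lemma sh_lin : linear f. Proof. by case: hf. Qed.
Lemma shM x y : f (x ** y) = f x ** f y. Proof. by case: hf. Qed.
Lemma sh_star x : f (star x) = star (f x). Proof. by case: hf. Qed.
Lemma shD x y : f (x + y) = f x + f y. Proof. exact: (linD sh_lin). Qed.
Lemma shB x y : f (x - y) = f x - f y. Proof. exact: (linB sh_lin). Qed.
Lemma shZ a x : f (a *: x) = a *: f x. Proof. exact: (linZ sh_lin). Qed.
Lemma sh0 : f 0 = 0. Proof. exact: (lin0 sh_lin). Qed.
End StarHom.

Lemma sh_comp (R : realType) (X Y Z : starAlgType R) (f : X -> Y) (g : Y -> Z) :
  star_hom f -> star_hom g -> star_hom (g \o f).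
Proof.
move=> hf hg; split=> [a x y|x y|x] /=.
- by rewrite (sh_lin hf) (sh_lin hg).
- by rewrite (shM hf) (shM hg).
- by rewrite (sh_star hf) (sh_star hg).
Qed.

Section CStarNorm.
Context {R : realType} {X : cstarType R}.
Implicit Types x y z : X.

Lemma nrmM x y : nrm (x ** y) <= nrm x * nrm y.
Proof. by rewrite -rc_le rcM !nrmE norm_smul. Qed.

Lemma nrm_starM x : nrm (star x ** x) = nrm x ^+ 2.
Proof. by apply: rc_inj; rewrite expr2 rcM !nrmE norm_star_smul. Qed.

Lemma nrm_star x : nrm (star x) = nrm x.
Proof.
suff h y : nrm y <= nrm (star y).
  by apply/le_anti; rewrite h andbT -{2}[x]starK h.
have [->|y0] := eqVneq (nrm y) 0; first exact: nrm_ge0.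
have := nrmM (star y) y; rewrite nrm_starM expr2 ler_pM2r //.
by rewrite lt_def y0 nrm_ge0.
Qed.

Lemma nrm_mul_le x (c : R) : 0 <= c ->
  (forall z, nrm (x ** z) <= c * nrm z) -> nrm x <= c.
Proof.
move=> c0 /(_ (star x)); rewrite -{1}[x]starK nrm_starM nrm_star expr2.
have [-> //|x0] := eqVneq (nrm x) 0.
by rewrite ler_pM2r // lt_def x0 nrm_ge0.
Qed.

Lemma sm_bop_r x : bounded_op (fun y => x ** y).
Proof.
by apply: (bopI (C := nrm x)); [exact: sm_lin_r|exact: nrm_ge0|move=> y; exact: nrmM].
Qed.
Lemma sm_bop_l y : bounded_op (fun x => x ** y).
Proof.
apply: (bopI (C := nrm y)); [exact: sm_lin_l|exact: nrm_ge0|].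
by move=> x; rewrite mulrC; exact: nrmM.
Qed.
End CStarNorm.

Section MultiplierBound.
Context {R : realType} {X : cstarType R}.
Implicit Types (m : multiplier X) (x y z : X).

(** Norm estimates in [M(X)] are phrased through this relation instead of a norm function on
    multipliers. *)
Definition mbnd m (c : R) := forall x, nrm (m x) <= c * nrm x.

Lemma mE_add m (n : multiplier X) x : (m + n) x = m x + n x. Proof. by []. Qed.
Lemma mE_scale a m x : (a *: m) x = a *: m x. Proof. by []. Qed.
Lemma mE_opp m x : (- m) x = - m x.
Proof. by rewrite -scaleN1r mE_scale scaleN1r. Qed.
Lemma mE_sub m (n : multiplier X) x : (m - n) x = m x - n x.
Proof. by rewrite mE_add mE_opp. Qed.
Lemma mE_mul m (n : multiplier X) x : (m ** n) x = m (n x). Proof. by []. Qed.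
Lemma mE_0 x : (0 : multiplier X) x = 0. Proof. by []. Qed.
Lemma mE_sum (I : Type) (s : seq I) (F : I -> multiplier X) x :
  (\sum_(i <- s) F i) x = \sum_(i <- s) F i x.
Proof. by elim/big_rec2 : _ => // i y z _ <-. Qed.

Lemma m_lin m : linear m. Proof. by move=> a x y; rewrite mleft_linear. Qed.

Lemma mleftM m x y : m (x ** y) = m x ** y.
Proof. by apply: smul_injr => z; rewrite multiplierP !smulA multiplierP. Qed.

Lemma mstar_dot m x y : star (m x) ** y = star x ** (star m) y.
Proof. by rewrite (multiplierP (star m)) /= starK. Qed.

Lemma mrightE m x : mright m x = star ((star m) (star x)).
Proof. by rewrite /= !starK. Qed.

Lemma meq m (n : multiplier X) : (forall x, m x = n x) -> m = n.
Proof.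
move=> h; apply: multiplier_eq => // x; apply: smul_injl => z.
by rewrite -!multiplierP h.
Qed.

Lemma mone_mul m : mone ** m = m. Proof. exact: meq. Qed.
Lemma mul_mone m : m ** mone = m. Proof. exact: meq. Qed.
Lemma star_mone : star mone = mone :> multiplier X.
Proof. by apply: meq => x; rewrite /= starK. Qed.

Lemma minj_star_hom : star_hom (@minj R X).
Proof.
split=> [a x y|x y|x]; apply: meq => z /=.
- by rewrite smulDl smulZl.
- by rewrite smulA.
- by rewrite starM starK.
Qed.

Lemma minj_inj : injective (@minj R X).
Proof.
move=> x y /(congr1 (fun m : multiplier X => m : X -> X)) h; apply: smul_injl => z.
exact: (congr1 (@^~ z) h).
Qed.

Lemma mul_minj m x : m ** minj x = minj (m x).
Proof. by apply: meq => y; rewrite /= mleftM. Qed.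
Lemma minj_mul m x : minj x ** m = minj (mright m x).
Proof. by apply: meq => y; rewrite /= multiplierP. Qed.

Lemma minj_bnd x c : 0 <= c -> (mbnd (minj x) c <-> nrm x <= c).
Proof.
move=> c0; split=> [h|h y]; first exact: nrm_mul_le.
by apply: le_trans (nrmM _ _) _; apply: ler_wpM2r; rewrite ?nrm_ge0.
Qed.

Lemma mbnd_le m c c' : c <= c' -> mbnd m c -> mbnd m c'.
Proof.
by move=> h hc x; apply: le_trans (hc x) _; apply: ler_wpM2r; rewrite ?nrm_ge0.
Qed.
Lemma mbndD m (n : multiplier X) c c' : mbnd m c -> mbnd n c' -> mbnd (m + n) (c + c').
Proof. by move=> h h' x; apply: le_trans (nrmD _ _) _; rewrite mulrDl lerD. Qed.
Lemma mbndZ a m c : mbnd m c -> mbnd (a *: m) (cn a * c).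
Proof. by move=> h x; rewrite mE_scale nrmZ -mulrA ler_wpM2l // cn_ge0. Qed.
Lemma mbndM m (n : multiplier X) c c' : 0 <= c -> mbnd m c -> mbnd n c' -> mbnd (m ** n) (c * c').
Proof.
move=> c0 h h' x; apply: le_trans (h _) _; rewrite -mulrA; exact: ler_wpM2l.
Qed.
Lemma mbnd0 : mbnd 0 0. Proof. by move=> x; rewrite mE_0 nrm0 mul0r. Qed.

Lemma mbnd_star m c : 0 <= c -> mbnd m c -> mbnd (star m) c.
Proof.
move=> c0 h x; have [->|x0] := eqVneq (nrm (star m x)) 0.
  by rewrite mulr_ge0 // nrm_ge0.
have : nrm (star m x) ^+ 2 <= nrm x * c * nrm (star m x).
  rewrite -nrm_starM mstar_dot starK; apply: le_trans (nrmM _ _) _.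
  by rewrite nrm_star -mulrA; apply: ler_wpM2l; rewrite ?nrm_ge0.
by rewrite expr2 ler_pM2r ?[c * _]mulrC // lt_def x0 nrm_ge0.
Qed.

(* Uniform boundedness: the gliding hump along [z_n], which is the closed graph *)
(* theorem for [mright m].                                                      *)
Lemma mright_bound m : exists2 c, 0 <= c & forall x, nrm (mright m x) <= c * nrm x.
Proof.
pose r := mright m.
have [h|h] := pselect (exists2 c : R, 0 <= c & forall x, nrm (r x) <= c * nrm x).
  by [].
have [|z hz] := @choice nat X (fun n z => nrm z <= 1 /\ (4 ^+ n : R) < nrm (r z)).
  move=> n; apply: contrapT => hn; apply: h; exists (4 ^+ n); first exact: exprn_ge0.
  move=> x; have [->|x0] := eqVneq x 0; first by rewrite /r mright0 !nrm0 mulr0.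
  have nx : 0 < nrm x.
    rewrite lt_def nrm_ge0 andbT; apply: contra_neq x0; exact: nrm_eq0.
  have cnx : cn (rc (nrm x)^-1) = (nrm x)^-1 by rewrite cn_rc gtr0_norm // invr_gt0.
  rewrite leNgt; apply/negP => hx; apply: hn; exists (rc (nrm x)^-1 *: x).
  rewrite /r mrightZ !nrmZ cnx mulVf ?gt_eqF //; split=> //.
  by rewrite mulrC ltr_pdivlMr.
have Nz n : 0 < nrm (r (z n)) by apply: lt_trans (hz n).2; exact: exprn_gt0.
(* [u n] has norm [3^-n] and is aligned with [r (z n)]: by the C*-identity the product
   [r (z n) ** u n] has the largest possible norm. *)
pose u n : X := rc (3^-1 ^+ n / nrm (r (z n))) *: star (r (z n)).
have q0 n : 0 <= 3^-1 ^+ n / nrm (r (z n)).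
  by rewrite divr_ge0 ?nrm_ge0 // exprn_ge0 // invr_ge0.
have nu n : nrm (u n) = 3^-1 ^+ n.
  by rewrite nrmZ cn_rc nrm_star ger0_norm // divfK // gt_eqF.
have hu n : nrm (r (z n) ** u n) = 3^-1 ^+ n * nrm (r (z n)).
  rewrite smulZr nrmZ cn_rc ger0_norm //.
  by rewrite -{2}[r (z n)]starK nrm_starM nrm_star expr2 mulrA divfK ?gt_eqF.
(* One of [y (x + v)] and [y (x - v)] is at least as large as [y v], since their difference is
   [2 y v]. Choosing the sign this way keeps each new hump visible. *)
pose big (x v : X) y := if nrm (y ** (x + v)) >= nrm (y ** v) then x + v else x - v.
have bigP x v y : nrm (y ** v) <= nrm (y ** big x v y).
  rewrite /big; case: ifP => // /negbT; rewrite -ltNge => hlt.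
  have := nrmB (y ** (x + v)) (y ** (x - v)).
  rewrite -smBr opprB [X in _ ** X]addrC subrKA -mulr2n -scaler_nat smulZr nrmZ.
  have -> : (2 : R[i]) = rc 2 by rewrite -[2]/(1 + 1) rcD.
  by rewrite cn_rc ger0_norm //; move: hlt; lra.
have bigN x v y : nrm (big x v y - x) = nrm v.
  by rewrite /big; case: ifP => _; rewrite addrAC subrr add0r ?nrmN.
pose X_ := fix X_ n : X := if n is k.+1 then big (X_ k) (u k) (r (z k)) else 0.
have p3 n : 0 < (3^-1 : R) ^+ n by apply: exprn_gt0; rewrite invr_gt0.
have Xstep n k : nrm (X_ (n + k)%N - X_ n) <= (1 - 3^-1 ^+ k) * (3 / 2) * 3^-1 ^+ n.
  elim: k => [|k IH]; first by rewrite addn0 expr0 !subrr nrm0 !mul0r.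
  apply: le_trans (nrm_tri _ (X_ (n + k)%N) _) _.
  rewrite addnS [X_ _.+1]/= bigN nu exprD (exprS _ k).
  move: IH (p3 n) (p3 k); set q := _ ^+ k; set p := _ ^+ n; nra.
have Xle n k : nrm (X_ (n + k)%N - X_ n) <= 3 / 2 * 3^-1 ^+ n.
  by apply: le_trans (Xstep n k) _; have := p3 n; have := p3 k; nra.
have p3le n : (3^-1 : R) ^+ n <= n.+1%:R^-1.
  rewrite exprVn lef_pV2 ?posrE ?ltr0Sn ?exprn_gt0 //.
  elim: n => [|n IH]; first by rewrite expr0.
  rewrite exprS -[n.+2]addn1 natrD.
  have : (1 : R) <= n.+1%:R by rewrite ler1n.
  by move: IH; lra.
have [|l hl] := nrm_complete (u := X_).
  move=> e e0; have e30 : 0 < e / 3 by rewrite divr_gt0.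
  have [N hN] := small_inv e30; exists N => a b Na Nb.
  apply: le_trans (nrm_tri _ (X_ N) _) _.
  rewrite -(subnKC Na) -(subnKC Nb) [nrm (X_ N - _)]nrmC.
  apply: le_trans (lerD (Xle _ _) (Xle _ _)) _.
  by move: (p3le N) (hN N (leqnn N)); set q := _ ^+ N; set q' := _^-1; lra.
have hX n : nrm (l - X_ n) <= 3 / 2 * 3^-1 ^+ n.
  apply/ler_addgt0Pr => e e0; have [N hN] := hl e e0.
  apply: le_trans (nrm_tri _ (X_ (n + N)%N) _) _.
  rewrite addrC lerD // nrmC; apply: hN; exact: leq_addl.
(* The product [r (z n) ** l = z n ** m l] is bounded uniformly in [n], whereas the terms after the
   hump remove at most half of [3^-n * nrm (r (z n))], which exceeds [(4/3)^n]. *)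
suff key n : (4 / 3) ^+ n <= 2 * nrm (m l).
  have b0 : 0 <= 2 * nrm (m l) by rewrite mulr_ge0 // nrm_ge0.
  have bern n : 1 + n%:R / 3 <= (4 / 3 : R) ^+ n.
    elim: n => [|n IH]; first by rewrite expr0 mul0r addr0.
    have n0 : (0 : R) <= n%:R by [].
    by rewrite exprS -[n.+1]addn1 natrD; nra.
  have := le_trans (bern _) (key (Num.truncn (3 * (2 * nrm (m l)))).+1).
  have := truncnS_gt (3 * (2 * nrm (m l))); lra.
have zn := (hz n).1; have N4 := (hz n).2.
have h1 : nrm (r (z n) ** l) <= nrm (m l).
  rewrite -multiplierP; apply: le_trans (nrmM _ _) _.
  by rewrite -[leRHS]mul1r; apply: ler_wpM2r; rewrite ?nrm_ge0.
have h2 : 3^-1 ^+ n * nrm (r (z n)) <= nrm (r (z n) ** X_ n.+1).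
  by rewrite -hu; exact: bigP.
have h3 : nrm (r (z n) ** (X_ n.+1 - l)) <= nrm (r (z n)) * (2^-1 * 3^-1 ^+ n).
  apply: le_trans (nrmM _ _) _; apply: ler_wpM2l; first exact: nrm_ge0.
  by rewrite nrmC; apply: le_trans (hX _) _; rewrite exprS; lra.
have h4 : nrm (r (z n) ** X_ n.+1) <= nrm (r (z n) ** (X_ n.+1 - l)) + nrm (r (z n) ** l).
  by rewrite -[X in nrm (_ ** X) <= _](subrK l) smulDr; exact: nrmD.
have h5 : (4 / 3 : R) ^+ n <= 3^-1 ^+ n * nrm (r (z n)).
  by rewrite exprMn mulrC; apply: ler_wpM2l; rewrite ltW.
by move: h1 h2 h3 h4 h5; lra.
Qed.

Lemma mbound m : exists2 c, 0 <= c & mbnd m c.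
Proof.
have [c c0 hc] := mright_bound (star m); exists c => // x.
by have := hc (star x); rewrite /= starK !nrm_star.
Qed.

Lemma m_bop m : bounded_op m.
Proof. by have [c c0 hc] := mbound m; apply: (bopI (C := c)) => //; exact: m_lin. Qed.

End MultiplierBound.

(** * Square roots and isometry of injective representations *)

Section SquareRoot.
Context {R : realType}.

(** The iteration of [msqrt] for the scalar [s = 1]. It increases to 1 and dominates the norms of
    the iterates and of their increments. *)
Fixpoint sqt (n : nat) : R := if n is k.+1 then (1 + sqt k ^+ 2) / 2 else 0.

Lemma sqt_bounds n : [/\ 0 <= sqt n, sqt n <= 1 & 1 - sqt n <= 2 / n.+2%:R].
Proof.
elim: n => [|n [h0 h1 h2]]; first by split=> //=; lra.
split; rewrite /=; [nra|nra|].
have n0 : (0 : R) <= n%:R by [].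
have n2 : (0 : R) < n.+2%:R by [].
have n3 : (0 : R) < n.+3%:R by [].
set a := 2 / _ in h2.
have ha : a * n.+2%:R = 2 by rewrite divfK ?gt_eqF.
have a1 : a <= 1 by rewrite ler_pdivrMr // mul1r ler_nat.
have a0 : 0 <= a by rewrite divr_ge0.
rewrite ler_pdivlMr //.
have -> : n.+3%:R = n.+2%:R + 1 :> R by rewrite -natr1.
have -> : 1 - (1 + sqt n ^+ 2) / 2 = (1 - sqt n) - (1 - sqt n) ^+ 2 / 2 by field.
set r := 1 - sqt n in h2 *.
(* The gap [1 - sqt n] evolves by [r -> r - r^2 / 2], an increasing map on [[0, 1]], and it takes
   [a = 2 / (n + 2)] below [2 / (n + 3)]. *)
have hr : r - r ^+ 2 / 2 <= a - a ^+ 2 / 2 by nra.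
apply: le_trans (_ : (a - a ^+ 2 / 2) * (n.+2%:R + 1) <= _).
  by apply: ler_wpM2r => //; lra.
have -> : (a - a ^+ 2 / 2) * (n.+2%:R + 1) = a * n.+2%:R - a * (a * n.+2%:R) / 2 + a - a ^+ 2 / 2.
  by field.
rewrite ha; nra.
Qed.

Lemma sqt_mono n : sqt n <= sqt n.+1.
Proof. by have [h0 h1 _] := sqt_bounds n; rewrite /=; nra. Qed.

Lemma sqt_small (e : R) : 0 < e -> exists N, forall n, (N <= n)%N -> 1 - sqt n <= e.
Proof.
move=> e0; have e20 : 0 < e / 2 by rewrite divr_gt0.
have [N hN] := small_inv e20; exists N => n Nn.
have [_ _ h] := sqt_bounds n; apply: le_trans h _.
by move: (hN n.+1 (leqW Nn)); set q := _^-1; lra.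
Qed.

Context {X : cstarType R}.
Implicit Types (m : multiplier X) (S : set (multiplier X)).

Lemma cs_lin S (a : R[i]) m n : cstar_subalgebra S -> S m -> S n -> S (a *: m + n).
Proof. by case=> -[_ h _] _ _; exact: h. Qed.
Lemma cs0 S : cstar_subalgebra S -> S 0. Proof. by case=> -[]. Qed.
Lemma csZ S (a : R[i]) m : cstar_subalgebra S -> S m -> S (a *: m).
Proof. by move=> hS Sm; rewrite -[_ *: _]addr0; apply: cs_lin => //; exact: cs0. Qed.
Lemma csD S m n : cstar_subalgebra S -> S m -> S n -> S (m + n).
Proof. by move=> hS Sm Sn; rewrite -[m]scale1r; exact: cs_lin. Qed.
Lemma csB S m n : cstar_subalgebra S -> S m -> S n -> S (m - n).
Proof. by move=> hS Sm Sn; rewrite addrC -scaleN1r; exact: cs_lin. Qed.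
Lemma csM S m n : cstar_subalgebra S -> S m -> S n -> S (m ** n).
Proof. by case=> _ h _; exact: h. Qed.
Lemma cs_star S m : cstar_subalgebra S -> S m -> S (star m).
Proof. by case=> _ _; exact. Qed.
Lemma cs_closed S m : cstar_subalgebra S -> (forall e : R, 0 < e ->
  exists2 n, S n & mbnd (m - n) e) -> S m.
Proof.
move=> [[_ _ h] _ _] hm; apply: h => _ /rc_pos[e e0 ->].
have [n Sn hn] := hm e e0; exists n => // x.
by rewrite -!nrmE -rcM rc_le -mE_sub.
Qed.

Lemma half2 : (rc 2^-1 : R[i]) + rc 2^-1 = 1.
Proof. by rewrite -rcD (_ : 2^-1 + 2^-1 = 1) //; lra. Qed.

(* With [g = \lim y n] for [y n.+1 = (s + y n ^2) / 2], the element [1 - g] is  *)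
(* the positive square root of [1 - s].                                         *)
Lemma msqrt S s : cstar_subalgebra S -> S s -> star s = s -> mbnd s 1 ->
  exists g, [/\ S g, star g = g, mbnd g 1, g + g - g ** g = s
    & forall u, u ** s = s ** u -> u ** g = g ** u].
Proof.
move=> hS Ss ss sb.
pose y := fix y n : multiplier X :=
  if n is k.+1 then rc 2^-1 *: (s + y k ** y k) else 0.
have yS n : S (y n).
  elim: n => [|n IH] /=; first exact: cs0.
  by apply: csZ => //; apply: csD => //; exact: csM.
have ys n : star (y n) = y n.
  elim: n => [|n IH] /=; first exact: star0.
  by rewrite starZr starD starM IH ss.
have c2 : cn (rc 2^-1 : R[i]) = 2^-1 by rewrite cn_rc ger0_norm // invr_ge0.
have t0 n : 0 <= sqt n by have [] := sqt_bounds n.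
have t1 n : sqt n <= 1 by have [] := sqt_bounds n.
have yb n : mbnd (y n) (sqt n).
  elim: n => [|n IH]; first exact: mbnd0.
  have -> : sqt n.+1 = cn (rc 2^-1 : R[i]) * (1 + sqt n * sqt n).
    by rewrite c2 mulrC -expr2.
  by apply: mbndZ; apply: mbndD => //; exact: mbndM.
(* With [d = y n.+1 - y n], the next increment is half of [y n.+1 ** d + d ** y n]; the increments
   of [sqt] obey the same recursion. *)
have yd n : mbnd (y n.+1 - y n) (sqt n.+1 - sqt n).
  elim: n => [|n IH].
    rewrite !subr0 /= sm0r addr0.
    have -> : (1 + 0 ^+ 2) / 2 = cn (rc 2^-1 : R[i]) * 1 by rewrite c2 expr0n /=; lra.
    exact: mbndZ.
  have -> : y n.+2 - y n.+1 =
      rc 2^-1 *: (y n.+1 ** (y n.+1 - y n) + (y n.+1 - y n) ** y n).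
    rewrite [in LHS]/= -/(y n.+1) -scalerBr; congr (_ *: _).
    by rewrite smBr smBl addrA subrK opprD addrACA subrr add0r.
  have -> : sqt n.+2 - sqt n.+1 = cn (rc 2^-1 : R[i]) *
      (sqt n.+1 * (sqt n.+1 - sqt n) + (sqt n.+1 - sqt n) * sqt n).
    by rewrite c2 [sqt n.+2]/= -/(sqt n.+1) [in X in _ - X]/=; field.
  have d0 := sqt_mono n.
  by apply: mbndZ; apply: mbndD; apply: mbndM; rewrite ?subr_ge0.
have ydk n k : mbnd (y (n + k)%N - y n) (sqt (n + k)%N - sqt n).
  elim: k => [|k IH]; first by rewrite addn0 !subrr; exact: mbnd0.
  rewrite addnS -[y _ - _](subrKA (y (n + k)%N)) -[sqt _ - _](subrKA (sqt (n + k)%N)).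
  exact: mbndD.
have Lx x : exists l, forall e : R, 0 < e -> exists N, forall n, (N <= n)%N ->
    nrm (y n x - l) <= e.
  apply: nrm_complete => e e0.
  have e20 : 0 < e / 2 by rewrite divr_gt0.
  have [d d0 hd] := small_factor (nrm_ge0 x) e20.
  have [N hN] := sqt_small d0; exists N => a b Na Nb.
  have key c : (N <= c)%N -> nrm (y c x - y N x) <= e / 2.
    move=> Nc; rewrite -mE_sub -(subnKC Nc); apply: le_trans (ydk _ _ _) _.
    apply: le_trans hd; rewrite mulrC; apply: ler_wpM2l; first exact: nrm_ge0.
    by apply: le_trans (hN N (leqnn N)); rewrite lerD2r t1.
  apply: le_trans (nrm_tri _ (y N x) _) _; rewrite [leRHS]splitr lerD ?key //.
  by rewrite nrmC key.
have [L hL] := choice Lx.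
have Lb n x : nrm (y n x - L x) <= (1 - sqt n) * nrm x.
  apply/ler_addgt0Pr => e e0; have [N hN] := hL x e e0.
  apply: le_trans (nrm_tri _ (y (n + N)%N x) _) _.
  apply: lerD; last by apply: hN; exact: leq_addl.
  rewrite nrmC -mE_sub; apply: le_trans (ydk _ _ _) _.
  by apply: ler_wpM2r; rewrite ?nrm_ge0 // lerD2r t1.
have small (V : normedModType R[i]) (v : V) (c : R) :
    0 <= c -> (forall n, nrm v <= c * (1 - sqt n)) -> v = 0.
  move=> c0 h; apply: nrm_small => e e0.
  have [d d0 hd] := small_factor c0 e0; have [N hN] := sqt_small d0.
  apply: le_trans (h N) _; apply: le_trans hd; apply: ler_wpM2l => //; exact: hN.
(* The pointwise limit is a multiplier whose right action is [x -> star (L (star x))], because every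
   [y n] is selfadjoint. *)
have [g hg] : exists g : multiplier X, forall x, g x = L x.
  have gP x z : x ** L z = star (L (star x)) ** z.
    apply/eqP; rewrite -subr_eq0; apply/eqP.
    apply: (small _ _ (nrm x * nrm z + nrm x * nrm z)) => [|n].
      by rewrite addr_ge0 // mulr_ge0 // nrm_ge0.
    have -> : x ** L z - star (L (star x)) ** z =
        x ** (L z - y n z) - star (L (star x) - y n (star x)) ** z.
      rewrite smBr starB smBl; set w := x ** y n z.
      by rewrite (_ : star (y n (star x)) ** z = w) 1?opprB ?addrA ?subrK //
        mstar_dot starK ys.
    apply: le_trans (nrmB _ _) _; rewrite mulrDl; apply: lerD.
      apply: le_trans (nrmM _ _) _; rewrite -mulrA; apply: ler_wpM2l; rewrite ?nrm_ge0 //.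
      by rewrite nrmC mulrC.
    apply: le_trans (nrmM _ _) _; rewrite nrm_star mulrAC.
    apply: ler_wpM2r; rewrite ?nrm_ge0 // nrmC mulrC -(nrm_star x); exact: Lb.
  by exists (Multiplier gP).
have gb n : mbnd (g - y n) (1 - sqt n) by move=> x; rewrite mE_sub hg nrmC.
have g1 : mbnd g 1.
  move=> x; rewrite hg; have := Lb 0%N x.
  by rewrite (_ : y 0%N x = 0) // sub0r nrmN [sqt 0]/= subr0.
exists g; split=> //.
- apply: cs_closed => // e e0; have [N hN] := sqt_small e0.
  by exists (y N) => //; apply: mbnd_le (gb N); exact: hN.
- apply: meq => x; apply/eqP; rewrite -subr_eq0; apply/eqP.
  apply: (small _ _ (nrm x + nrm x)) => [|n]; first by rewrite addr_ge0 // nrm_ge0.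
  have -> : star g x - g x = star (g - y n) x - (g - y n) x.
    by rewrite starB ys !mE_sub opprB addrA subrK.
  have s0 : 0 <= 1 - sqt n by rewrite subr_ge0.
  by apply: le_trans (nrmB _ _) _; rewrite mulrDl; apply: lerD; rewrite mulrC;
    [exact: mbnd_star|exact: gb].
- apply: meq => x; apply/eqP; rewrite -subr_eq0; apply/eqP.
  apply: (small _ _ (4 * nrm x)) => [|n]; first by rewrite mulr_ge0 // nrm_ge0.
  have hy : y n.+1 + y n.+1 = s + y n ** y n.
    by rewrite /= -/(y n) -scalerDl half2 scale1r.
  have -> : (g + g - g ** g) x - s x = (g - y n.+1) x + (g - y n.+1) x
      + (y n ** (y n - g) + (y n - g) ** g) x.
    rewrite -!mE_add -mE_sub; congr (fun m : multiplier X => m x).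
    have -> : y n ** (y n - g) + (y n - g) ** g = y n ** y n - g ** g.
      by rewrite smBr smBl addrA subrK.
    have -> : g - y n.+1 + (g - y n.+1) = g + g - (s + y n ** y n).
      by rewrite addrACA -opprD hy.
    by rewrite opprD [g + g + (_ - _)]addrA subrKA addrAC.
  have s0 : 0 <= 1 - sqt n by rewrite subr_ge0.
  have h1 := gb n.+1 x.
  have h2 : nrm ((y n ** (y n - g)) x) <= (1 - sqt n) * nrm x.
    rewrite mE_mul; apply: le_trans (yb _ _) _; rewrite -[leRHS]mul1r.
    apply: ler_pM; rewrite ?nrm_ge0 //.
    by rewrite -opprB mE_opp nrmN; exact: gb.
  have h3 : nrm (((y n - g) ** g) x) <= (1 - sqt n) * nrm x.
    rewrite mE_mul -opprB mE_opp nrmN; apply: le_trans (gb _ _) _.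
    by apply: ler_wpM2l => //; rewrite -[leRHS]mul1r; exact: g1.
  have h4 := nrmD ((g - y n.+1) x + (g - y n.+1) x) ((y n ** (y n - g) + (y n - g) ** g) x).
  have h5 := nrmD ((g - y n.+1) x) ((g - y n.+1) x).
  have h6 := nrmD ((y n ** (y n - g)) x) (((y n - g) ** g) x).
  have := sqt_mono n; have := nrm_ge0 x.
  rewrite -mE_add in h6; nra.
- move=> u us.
  have uy n : u ** y n = y n ** u.
    elim: n => [|n IH] /=; first by rewrite sm0l sm0r.
    by rewrite smulZr smulZl smulDr smulDl us smulA IH -smulA IH smulA.
  have [c c0 hc] := mbound u.
  apply: meq => x; apply/eqP; rewrite -subr_eq0; apply/eqP.
  apply: (small _ _ (2 * (c * nrm x))) => [|n].
    by rewrite !mulr_ge0 // nrm_ge0.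
  have -> : (u ** g) x - (g ** u) x = u ((g - y n) x) - (g - y n) (u x).
    rewrite !mE_sub (linB (m_lin u)) -[u (y n x)]/((u ** y n) x) uy.
    by rewrite opprB addrA subrK.
  have s0 : 0 <= 1 - sqt n by rewrite subr_ge0.
  apply: le_trans (nrmB _ _) _.
  have -> : 2 * (c * nrm x) * (1 - sqt n) =
    c * ((1 - sqt n) * nrm x) + (1 - sqt n) * (c * nrm x) by ring.
  apply: lerD.
    by apply: le_trans (hc _) _; apply: ler_wpM2l => //; exact: gb.
  by apply: le_trans (gb _ _) _; apply: ler_wpM2l.
Qed.

End SquareRoot.

Section UnitaryTrick.
Context {R : realType} {Y : cstarType R}.
Implicit Types (m h g w : multiplier Y).

Let I : R[i] := Complex 0 1.

Let conjI : Num.conj I = - I.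
Proof. by rewrite conjE /I -[- _]/(Complex (- 0) (- 1)) oppr0. Qed.

Let II : I * I = -1.
Proof. by rewrite -expr2 -/('i%C) sqr_i. Qed.

Let cnI : cn I = 1.
Proof.
have : cn I * cn I = 1 by rewrite -cnM II cnN cn1.
have := cn_ge0 I; nra.
Qed.

Lemma isom_bnd w x : star w ** w = mone -> nrm (w x) = nrm x.
Proof.
move=> hw; apply/eqP; rewrite -(@eqrXn2 _ 2) ?nrm_ge0 // -!nrm_starM.
by rewrite mstar_dot -mE_mul hw.
Qed.

Lemma mbnd_starM m c : 0 <= c -> mbnd (star m ** m) (c ^+ 2) -> mbnd m c.
Proof.
move=> c0 hm x; rewrite -(@ler_pXn2r _ 2) ?nnegrE ?mulr_ge0 ?nrm_ge0 //.
rewrite -nrm_starM mstar_dot -mE_mul; apply: le_trans (nrmM _ _) _.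
rewrite nrm_star exprMn mulrC [in leRHS]expr2 mulrA.
by apply: ler_wpM2r; rewrite ?nrm_ge0 //; exact: hm.
Qed.

(** With [k = 1 - g] the hypothesis says [h^2 + k^2 = 1], so [w = h + i k] is unitary, a cosine and
    a sine. Then [h] is the real part of [w], and [2 h k] the imaginary part of [w^2]; both have
    norm at most 1. This replaces functional calculus. *)
Lemma unitary_trick h g : star h = h -> star g = g -> h ** g = g ** h ->
  g + g - g ** g = h ** h ->
  mbnd h 1 /\ mbnd ((h - h ** g) + (h - h ** g)) 1.
Proof.
move=> sh sg hg e.
have [k kE] : exists k : multiplier Y, k = mone - g by eexists.
pose w := h + I *: k.
have hk : h ** k = h - h ** g by rewrite kE smBr mul_mone.
have kh : k ** h = h ** k by rewrite kE smBl smBr mone_mul mul_mone hg.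
have kk : h ** h + k ** k = mone.
  by rewrite -e kE smBl !smBr !mone_mul mul_mone; zmod.
have sk : star k = k by rewrite kE starB star_mone sg.
have sw : star w = h - I *: k by rewrite starD starZ sh sk conjI scaleNr.
have ww : star w ** w = mone.
  rewrite sw smBl !smulDr !smulZl !smulZr scalerA II scaleN1r kh opprD opprK.
  by rewrite -kk; zmod.
have ww' : w ** star w = mone.
  rewrite sw smulDl !smBr !smulZl !smulZr scalerA II scaleN1r kh opprK.
  by rewrite -kk; zmod.
have two (v : Y) : nrm (rc 2 *: v) = 2 * nrm v by rewrite nrmZ cn_rc ger0_norm.
have dbl (v : Y) : v + v = rc 2 *: v.
  by rewrite (_ : 2 = 1 + 1) // rcD scalerDl (_ : rc 1 = 1) // scale1r.
have nw x : nrm (w x) = nrm x by exact: isom_bnd.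
have nsw x : nrm (star w x) = nrm x by apply: isom_bnd; rewrite starK.
split=> x.
  rewrite mul1r -(@ler_pM2l _ 2) // -two -dbl.
  have -> : h x + h x = w x + star w x.
    by rewrite sw mE_sub !mE_add addrACA subrr addr0.
  by apply: le_trans (nrmD _ _) _; rewrite nw nsw; lra.
rewrite mul1r -hk -(@ler_pM2l _ 2) // -two -dbl.
set z := mleft (_ + _) x; rewrite -[nrm (z + z)]mul1r -cnI -nrmZ.
have -> : I *: (z + z) = w (w x) - star w (star w x).
  rewrite -!mE_mul -mE_sub -mE_add -mE_scale; congr (fun m : multiplier Y => m x).
  rewrite sw /w !(smBl, smulDl, smBr, smulDr, smulZl, smulZr, smNl, smNr) !scalerDr ?scalerN !scalerA !II !scaleN1r !kh.
  zmod.
by apply: le_trans (nrmB _ _) _; rewrite !nw !nsw cnI; lra.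
Qed.
End UnitaryTrick.

(** * Homomorphisms and representations of a C*-algebra embedded in [M(X)] *)

Section EmbeddedAlgebra.
Context {R : realType} {X : cstarType R} {Z : starAlgType R}.
Variables (iota : Z -> multiplier X) (S : set Z).
Hypothesis hiota : star_hom iota.
Hypothesis iota_inj : injective iota.
Hypothesis hS : cstar_subalgebra (iota @` S).
Implicit Types z g h : Z.

Lemma eS z : (iota @` S) (iota z) -> S z.
Proof. by move=> [z' Sz' /iota_inj <-]. Qed.
Lemma eI z : S z -> (iota @` S) (iota z).
Proof. by exists z. Qed.
Lemma eS_lin (a : R[i]) z z' : S z -> S z' -> S (a *: z + z').
Proof.
by move=> h h'; apply: eS; rewrite (sh_lin hiota); apply: cs_lin => //; exact: eI.
Qed.
Lemma eS0 : S 0. Proof. by apply: eS; rewrite (sh0 hiota); exact: cs0. Qed.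
Lemma eSZ (a : R[i]) z : S z -> S (a *: z).
Proof. by move=> h; rewrite -[_ *: _]addr0; apply: eS_lin => //; exact: eS0. Qed.
Lemma eSD z z' : S z -> S z' -> S (z + z').
Proof. by move=> h h'; rewrite -[z]scale1r; exact: eS_lin. Qed.
Lemma eSB z z' : S z -> S z' -> S (z - z').
Proof. by move=> h h'; rewrite addrC -scaleN1r; exact: eS_lin. Qed.
Lemma eSM z z' : S z -> S z' -> S (z ** z').
Proof. by move=> h h'; apply: eS; rewrite (shM hiota); apply: csM => //; exact: eI. Qed.
Lemma eS_star z : S z -> S (star z).
Proof. by move=> h; apply: eS; rewrite (sh_star hiota); apply: cs_star => //; exact: eI. Qed.

Lemma emb_sqrt z : S z -> star z = z -> mbnd (iota z) 1 ->
  exists g, [/\ S g, star g = g, mbnd (iota g) 1, g + g - g ** g = z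
    & forall u, S u -> u ** z = z ** u -> u ** g = g ** u].
Proof.
move=> Sz sz zb.
have sz' : star (iota z) = iota z by rewrite -(sh_star hiota) sz.
have [g' [[g Sg <-] sg gb ge gc]] := msqrt hS (eI Sz) sz' zb.
exists g; split=> //.
- by apply: iota_inj; rewrite (sh_star hiota).
- by apply: iota_inj; rewrite (shB hiota) (shD hiota) (shM hiota).
- move=> u Su uz; apply: iota_inj; rewrite !(shM hiota); apply: gc.
  by rewrite -!(shM hiota) uz.
Qed.

Lemma emb_sq z c : 0 <= c -> star z = z -> mbnd (iota z) c -> mbnd (iota (z ** z)) (c ^+ 2).
Proof. by move=> c0 sz zb; rewrite (shM hiota) expr2; exact: mbndM. Qed.

(* [h^2 + (1 - g)^2 = 1] *)
Lemma emb_cos h : S h -> star h = h -> mbnd (iota h) 1 ->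
  exists g, [/\ S g, star g = g, mbnd (iota g) 1, g + g - g ** g = h ** h
    & h ** g = g ** h].
Proof.
move=> Sh sh hb.
have shh : star (h ** h) = h ** h by rewrite starM sh.
have hhb : mbnd (iota (h ** h)) 1 by rewrite -[1](expr1n _ 2); exact: emb_sq.
have [g [Sg sg gb ge gc]] := emb_sqrt (eSM Sh Sh) shh hhb.
by exists g; split=> //; apply: gc => //; rewrite smulA.
Qed.

Lemma emb_starM z c : 0 <= c -> mbnd (iota z) c -> mbnd (iota (star z ** z)) (c ^+ 2).
Proof.
move=> c0 zb; rewrite (shM hiota) expr2; apply: mbndM => //.
by rewrite (sh_star hiota); exact: mbnd_star.
Qed.

Lemma scale_bnd z c : 0 < c -> mbnd (iota z) c -> mbnd (iota (rc c^-1 *: z)) 1.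
Proof.
move=> c0 zb; rewrite (shZ hiota) (_ : 1 = cn (rc c^-1 : R[i]) * c); first exact: mbndZ.
by rewrite cn_rc gtr0_norm ?invr_gt0 // mulVf // gt_eqF.
Qed.

(** The identities are restricted to [S] because [i] is a total function that is meaningful on [D1]
    only. The embedding [iota] is [minj] for closed subalgebras of [X] and the identity for
    subalgebras of [M(X)]. *)
Definition hom_on (A : starAlgType R) (f : Z -> A) :=
  [/\ forall (a : R[i]) z z', S z -> S z' -> f (a *: z + z') = a *: f z + f z',
      forall z z', S z -> S z' -> f (z ** z') = f z ** f z'
    & forall z, S z -> f (star z) = star (f z)].

Section HomOn.
Context {A : starAlgType R} {f : Z -> A}.
Hypothesis hf : hom_on f.
Lemma hoM z z' : S z -> S z' -> f (z ** z') = f z ** f z'.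
Proof. by case: hf => _ + _; apply. Qed.
Lemma hoS z : S z -> f (star z) = star (f z). Proof. by case: hf => _ _; apply. Qed.
Lemma hoD z z' : S z -> S z' -> f (z + z') = f z + f z'.
Proof. by case: hf => h _ _ a b; have := h 1 _ _ a b; rewrite !scale1r. Qed.
Lemma ho0 : f 0 = 0.
Proof. by apply: (addrI (f 0)); rewrite -hoD ?addr0 //; exact: eS0. Qed.
Lemma hoZ (a : R[i]) z : S z -> f (a *: z) = a *: f z.
Proof. by case: hf => h _ _ Sz; have := h a z 0 Sz eS0; rewrite !addr0 ho0 addr0. Qed.
Lemma hoB z z' : S z -> S z' -> f (z - z') = f z - f z'.
Proof. by case: hf => h _ _ a b; rewrite addrC -scaleN1r h // scaleN1r addrC. Qed.
End HomOn.

(** After scaling, [h = star z ** z] has norm at most 1 and satisfies [h^2 + (1 - g)^2 = 1] for some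
    [g] in [S]. The relation is algebraic, so it holds for [f h] and [f g], and [unitary_trick]
    bounds [f h]. The slack [e] permits the scaling when [c = 0]. *)
Lemma mhom_contr (Y : cstarType R) (f : Z -> multiplier Y) z c :
  hom_on f -> S z -> 0 <= c -> mbnd (iota z) c -> mbnd (f z) c.
Proof.
move=> hf Sz c0 zb.
suff key e : 0 < e -> mbnd (f z) (c + e).
  move=> x; apply/ler_addgt0Pr => e e0.
  have [d d0 hd] := small_factor (nrm_ge0 x) e0.
  by apply: le_trans (key d d0 x) _; rewrite mulrDl lerD2l mulrC.
move=> e0; have ce : 0 < c + e by rewrite ltr_wpDl.
pose z' := rc (c + e)^-1 *: z.
have Sz' : S z' by exact: eSZ.
have zb' : mbnd (iota z') 1.
  by apply: scale_bnd => //; apply: mbnd_le zb; rewrite lerDl ltW.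
have -> : f z = rc (c + e) *: f z'.
  by rewrite (hoZ hf) // scalerA -rcM divff ?gt_eqF // (_ : rc 1 = 1) // scale1r.
suff b1 : mbnd (f z') 1.
  by have := @mbndZ _ _ (rc (c + e)) _ _ b1; rewrite cn_rc gtr0_norm // mulr1.
pose h := star z' ** z'.
have Sh : S h by apply: eSM => //; exact: eS_star.
have sh : star h = h by rewrite /h starM starK.
have hb : mbnd (iota h) 1 by rewrite -[1](expr1n _ 2); exact: emb_starM.
have [g [Sg sg _ ge hg]] := emb_cos Sh sh hb.
apply: mbnd_starM => //; rewrite expr1n.
rewrite -(hoS hf) // -(hoM hf) //; last exact: eS_star.
have [] // := @unitary_trick _ _ (f h) (f g).
- by rewrite -(hoS hf) ?sh.
- by rewrite -(hoS hf) ?sg.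
- by rewrite -!(hoM hf) // hg.
- by rewrite -!(hoM hf) // -ge -(hoD hf) // -(hoB hf) //; [exact: eSD|exact: eSM].
Qed.

(** Linearity and boundedness of the operators [pi z] follow from these identities: [ro_lin] and
    [rep_contr]. *)
Definition rep_on (H : hilbertType R) (pi : Z -> H -> H) :=
  [/\ forall (a : R[i]) z z' v, S z -> S z' -> pi (a *: z + z') v = a *: pi z v + pi z' v,
      forall z z' v, S z -> S z' -> pi (z ** z') v = pi z (pi z' v)
    & forall z v w, S z -> dot (pi z v) w = dot v (pi (star z) w)].

Section RepOn.
Context (H : hilbertType R) (pi : Z -> H -> H).
Hypothesis hpi : rep_on pi.
Implicit Types v w : H.
Lemma roM z z' v : S z -> S z' -> pi (z ** z') v = pi z (pi z' v).
Proof. by case: hpi => _ + _; apply. Qed.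
Lemma ro_dot z v w : S z -> dot (pi z v) w = dot v (pi (star z) w).
Proof. by case: hpi => _ _; apply. Qed.
Lemma ro_dot' z v w : S z -> dot v (pi z w) = dot (pi (star z) v) w.
Proof. by move=> Sz; rewrite ro_dot ?starK //; exact: eS_star. Qed.
Lemma ro0 v : pi 0 v = 0.
Proof.
case: hpi => h _ _; have := h 1 0 0 v eS0 eS0; rewrite !scale1r addr0 => e.
by apply: (addrI (pi 0 v)); rewrite -e addr0.
Qed.
Lemma roZ (a : R[i]) z v : S z -> pi (a *: z) v = a *: pi z v.
Proof. by case: hpi => h _ _ Sz; have := h a z 0 v Sz eS0; rewrite !addr0 ro0 addr0. Qed.
Lemma roD z z' v : S z -> S z' -> pi (z + z') v = pi z v + pi z' v.
Proof. by case: hpi => h _ _ a b; have := h 1 _ _ v a b; rewrite !scale1r. Qed.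
Lemma roB z z' v : S z -> S z' -> pi (z - z') v = pi z v - pi z' v.
Proof. by case: hpi => h _ _ a b; rewrite addrC -scaleN1r h // scaleN1r addrC. Qed.
Lemma ro_lin z : S z -> linear (pi z).
Proof.
move=> Sz a v w; apply: dot_eqP => u.
by rewrite dotDr dotZr !ro_dot' // dotDr dotZr.
Qed.

(** In the representation, [h^2 + (1 - g)^2 = 1] becomes Pythagoras: the squared norms of [pi h v]
    and [v - pi g v] add up to that of [v]. *)
Lemma rep_contr z c v : S z -> 0 <= c -> mbnd (iota z) c -> nrm (pi z v) <= c * nrm v.
Proof.
move=> Sz c0 zb.
apply/ler_addgt0Pr => e e0; have [d d0 hd] := small_factor (nrm_ge0 v) e0.
apply: le_trans (_ : (c + d) * nrm v <= _); last by rewrite mulrDl lerD2l mulrC.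
have ce : 0 < c + d by rewrite ltr_wpDl.
pose z' := rc (c + d)^-1 *: z.
have Sz' : S z' by exact: eSZ.
have zb' : mbnd (iota z') 1.
  by apply: scale_bnd => //; apply: mbnd_le zb; rewrite lerDl ltW.
have -> : pi z v = rc (c + d) *: pi z' v.
  by rewrite roZ // scalerA -rcM divff ?gt_eqF // (_ : rc 1 = 1) // scale1r.
rewrite nrmZ cn_rc gtr0_norm // ler_pM2l //.
pose h := star z' ** z'.
have Sh : S h by apply: eSM => //; exact: eS_star.
have sh : star h = h by rewrite /h starM starK.
have hb : mbnd (iota h) 1 by rewrite -[1](expr1n _ 2); exact: emb_starM.
have [g [Sg sg _ ge hg]] := emb_cos Sh sh hb.
have key : nrm (pi h v) ^+ 2 + nrm (v - pi g v) ^+ 2 = nrm v ^+ 2.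
  apply: rc_inj; rewrite rcD -!dotxx !(dotBl, dotBr) !ro_dot // sh sg.
  rewrite -!roM // -ge roB ?roD //; [|exact: eSD|exact: eSM].
  rewrite dotBr dotDr; ring.
have hv : nrm (pi h v) <= nrm v.
  rewrite -(@ler_pXn2r _ 2) ?nnegrE ?nrm_ge0 // -key lerDl; exact: sqr_ge0.
rewrite -(@ler_pXn2r _ 2) ?nnegrE ?nrm_ge0 //.
have -> : nrm (pi z' v) ^+ 2 = cn (dot v (pi h v)).
  have Sz's := eS_star Sz'.
  by rewrite /h roM // -ro_dot // dotxx cn_rc ger0_norm ?sqr_ge0.
apply: le_trans (cauchy_schwarz _ _) _; rewrite expr2.
by apply: ler_wpM2l; rewrite ?nrm_ge0.
Qed.

Lemma scale_hnrm z (c : R) v : S z -> 0 < c ->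
  nrm (pi (rc c *: z) v) = c * nrm (pi z v).
Proof. by move=> Sz c0; rewrite roZ // nrmZ cn_rc gtr0_norm. Qed.

Lemma mbnd_sq_le (h : Z) c : 0 <= c -> star h = h ->
  mbnd (iota (h ** h)) (c ^+ 2) -> mbnd (iota h) c.
Proof.
move=> c0 sh hb; apply: mbnd_starM => //.
by rewrite -(sh_star hiota) sh -(shM hiota).
Qed.

Hypothesis pi_inj : forall z, S z -> (forall v, pi z v = 0) -> z = 0.

(* Both [1 - h^2] and [1 - g] are positive square roots of [(1 - h^2)^2] in the *)
(* representation, hence [g = h^2].                                             *)
Lemma rep_gap h : S h -> star h = h -> mbnd (iota (h ** h)) 2 ->
  (forall v, nrm (pi h v) <= nrm v) -> mbnd (iota (h ** h)) 1.
Proof.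
move=> Sh sh hb hpih.
pose r : R := Num.sqrt 2^-1.
have r2 : r * r = 2^-1 by rewrite -expr2 sqr_sqrtr // invr_ge0.
pose h1 := rc r *: h.
have Sh1 : S h1 by exact: eSZ.
have sh1 : star h1 = h1 by rewrite starZr sh.
have hh1 : h1 ** h1 = rc 2^-1 *: (h ** h).
  by rewrite smulZl smulZr scalerA -rcM r2.
have h1b : mbnd (iota h1) 1.
  apply: mbnd_sq_le => //; rewrite expr1n hh1 (shZ hiota).
  have := @mbndZ _ _ (rc 2^-1) _ _ hb.
  have e2 : cn (rc 2^-1 : R[i]) * 2 = 1 by rewrite cn_rc ger0_norm ?invr_ge0 //; lra.
  by rewrite e2.
have [g1 [Sg1 sg1 _ ge1 hg1]] := emb_cos Sh1 sh1 h1b.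
(* Doubling the angle: [z = 2 h1 (1 - g1)], so [z^2 = 4 h1^2 (1 - h1^2) = 2 a - a^2] with
   [a = h^2 = 2 h1^2], and [unitary_trick] bounds [z] by 1. The bound 2 on [h^2] is what makes
   [h1 = h / sqrt 2] a contraction. *)
pose z := (h1 - h1 ** g1) + (h1 - h1 ** g1).
have Sz : S z by apply: eSD; apply: eSB => //; exact: eSM.
have sz : star z = z by rewrite starD starB starM sh1 sg1 -hg1.
have zb : mbnd (iota z) 1.
  rewrite (shD hiota) (shB hiota) (shM hiota).
  have [] // := @unitary_trick _ _ (iota h1) (iota g1).
  - by rewrite -(sh_star hiota) sh1.
  - by rewrite -(sh_star hiota) sg1.
  - by rewrite -!(shM hiota) hg1.
  - by rewrite -!(shM hiota) -(shD hiota) -(shB hiota) ge1.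
have [a aE] : exists a, a = h ** h by eexists.
have Sa : S a by rewrite aE; exact: eSM.
have sa : star a = a by rewrite aE starM sh.
have zz : z ** z = a + a - a ** a.
  have ghx x : g1 ** (h1 ** x) = h1 ** (g1 ** x) by rewrite !smulA hg1.
  have -> : a = h1 ** h1 + h1 ** h1.
    by rewrite aE hh1 -scalerDl half2 scale1r.
  have kk : (h1 - h1 ** g1) ** (h1 - h1 ** g1) = h1 ** h1 - (h1 ** h1) ** (h1 ** h1).
    transitivity (h1 ** h1 - (h1 ** h1) ** (g1 + g1 - g1 ** g1)); last by rewrite ge1.
    rewrite !(smBl, smBr, smulDl, smulDr) -!smulA -?hg1 !ghx -?hg1.
    zmod.
  have [u uE] : exists u, u = h1 - h1 ** g1 by eexists.
  by rewrite /z -uE !(smulDl, smulDr) uE kk; zmod.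
have szz : star (z ** z) = z ** z by rewrite starM sz.
have zzb : mbnd (iota (z ** z)) 1 by rewrite -[1](expr1n _ 2); apply: emb_sq.
(* Now [(1 - g)^2 = (1 - a)^2] where [g] has norm at most 1; it remains to prove [g = a], using that
   [a] is a contraction in the representation. *)
have [g [Sg sg gb ge gc]] := emb_sqrt (eSM Sz Sz) szz zzb.
have ga : a ** g = g ** a by apply: gc => //; rewrite zz smBr smBl smulDl smulDr smulA.
pose b := g - a.
have Sb : S b by exact: eSB.
have sb : star b = b by rewrite starB sg sa.
have b0 : g ** b + a ** b = b + b.
  have -> : g ** b + a ** b = g ** g - a ** a by rewrite /b !smBr ga; zmod.
  have -> : g ** g = g + g - (a + a - a ** a) by rewrite -zz -ge; zmod.
  by rewrite /b; zmod.
pose T := pi b.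
have lT : linear T by exact: ro_lin.
have Tdot v w : dot (T v) w = dot v (T w) by rewrite /T ro_dot // sb.
(* For [x = T v] the forms of [g] and [a] at [x] add up to twice the squared norm of [x] and neither
   exceeds it. They are equal, so the form of [T = g - a] vanishes at [x]. *)
have Re_T3 v : complex.Re (dot (T v) (T (T v))) = 0.
  set x := T v.
  have pa : complex.Re (dot x (pi a x)) <= nrm x ^+ 2.
    apply: le_trans (Re_le_cn _) _; rewrite aE roM // -{1}sh -ro_dot // dotxx.
    by rewrite cn_rc ger0_norm ?sqr_ge0 // ler_pXn2r ?nnegrE ?nrm_ge0.
  have pg : complex.Re (dot x (pi g x)) <= nrm x ^+ 2.
    apply: le_trans (Re_le_cn _) _; apply: le_trans (cauchy_schwarz _ _) _.
    rewrite expr2; apply: ler_wpM2l; rewrite ?nrm_ge0 //.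
    by rewrite -[leRHS]mul1r; apply: rep_contr.
  have e : complex.Re (dot x (pi g x)) + complex.Re (dot x (pi a x)) = nrm x ^+ 2 + nrm x ^+ 2.
    rewrite -!raddfD -dotDr -!roM // -roD; [|exact: eSM|exact: eSM].
    by rewrite b0 roD // -/T dotDr raddfD /= -/x dotxx.
  have -> : dot x (T x) = dot x (pi g x) - dot x (pi a x).
    by rewrite /T roB // dotBr.
  by rewrite raddfB /=; lra.
(* Polarization: evaluated at [v + T v], the vanishing form leaves twice the squared norm of
   [T (T v)]. *)
have T2 v : T (T v) = 0.
  have h3 : complex.Re (dot (T (v + T v)) (T (T (v + T v)))) = 0 by exact: Re_T3.
  move: h3; rewrite !(linD lT) dotDl !dotDr !raddfD /= !Re_T3 !add0r.
  rewrite -(Tdot (T v) (T (T v))) !dotxx /= => e.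
  apply/nrm_eq0/eqP; rewrite -sqrf_eq0; apply/eqP; move: e; lra.
have b00 : b = 0.
  apply: pi_inj => // v; apply/nrm_eq0/eqP; rewrite -sqrf_eq0; apply/eqP/rc_inj.
  by rewrite -dotxx -/T Tdot T2 dot0r.
by rewrite -aE -(_ : g = a) //; apply/eqP; rewrite -subr_eq0; apply/eqP.
Qed.

(** An a priori bound [M] is improved repeatedly. Scaling [h] to norm at most [7/5], whose square is
    below 2, puts it within reach of [rep_gap]; this replaces [M] by the maximum of 1 and
    [5/7 M]. *)
Lemma rep_isom_herm h : S h -> star h = h ->
  (forall v, nrm (pi h v) <= nrm v) -> mbnd (iota h) 1.
Proof.
move=> Sh sh hpih; have [M M0 hM] := mbound (iota h).
suff key n : mbnd (iota h) (Num.max 1 (M * (5 / 7) ^+ n)).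
  have bern n : 1 + n%:R * (2 / 5) <= (7 / 5 : R) ^+ n.
    elim: n => [|n IH]; first by rewrite expr0 mul0r addr0.
    by have := ler0n R n; rewrite exprS -[n.+1]addn1 natrD; nra.
  pose n := (Num.truncn (3 * M)).+1.
  have hn : M * (5 / 7) ^+ n <= 1.
    rewrite -[5 / 7]invrK exprVn ler_pdivrMr ?mul1r ?exprn_gt0 ?invr_gt0 ?divr_gt0 //.
    rewrite (_ : (5 / 7)^-1 = 7 / 5); last by field.
    by apply: le_trans (bern n); move: (truncnS_gt (3 * M)); rewrite -/n; lra.
  by apply: mbnd_le (key n); rewrite ge_max lexx hn.
elim: n => [|n IH].
  by rewrite expr0 mulr1; apply: mbnd_le hM; rewrite le_max lexx orbT.
set M' := Num.max _ _ in IH.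
have M1 : 1 <= M' by rewrite le_max lexx.
pose l := Num.min 1 (7 / 5 / M').
have l0 : 0 < l by rewrite lt_min ltr01 !divr_gt0 //; apply: lt_le_trans M1.
have l1 : l <= 1 by rewrite ge_min lexx.
have lM : l * M' <= 7 / 5.
  by rewrite -ler_pdivlMr ?ge_min ?lexx ?orbT //; apply: lt_le_trans M1.
have Slh : S (rc l *: h) by exact: eSZ.
have slh : star (rc l *: h) = rc l *: h by rewrite starZr sh.
have lb : mbnd (iota (rc l *: h)) (7 / 5).
  rewrite (shZ hiota); apply: mbnd_le (mbndZ _ IH).
  by rewrite cn_rc gtr0_norm.
have lb1 : mbnd (iota (rc l *: h)) 1.
  apply: mbnd_sq_le => //; rewrite expr1n; apply: rep_gap => //.
    by apply: mbnd_le (emb_sq _ slh lb); [rewrite expr2; lra|lra].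
  move=> v; rewrite scale_hnrm //; have := hpih v; have := nrm_ge0 (pi h v); nra.
have -> : iota h = rc l^-1 *: iota (rc l *: h).
  by rewrite (shZ hiota) scalerA -rcM mulVf ?gt_eqF // (_ : rc 1 = 1) // scale1r.
apply: mbnd_le (mbndZ _ lb1); rewrite cn_rc gtr0_norm ?invr_gt0 // mulr1.
have : l = 1 \/ l = 7 / 5 / M' by rewrite /l; case: ltP; [left|right].
case=> ->; first by rewrite invr1 le_max lexx.
have -> : (7 / 5 / M')^-1 = 5 / 7 * M'.
  by field; rewrite gt_eqF // (lt_le_trans ltr01 M1).
rewrite /M' le_max; have [h1|h1] := leP 1 (M * (5 / 7) ^+ n).
  by rewrite exprS mulrCA lexx orbT.
by rewrite mulr1; apply/orP; left; lra.
Qed.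

(** A faithful representation is isometric: by the C*-identity it suffices to treat the selfadjoint
    [star z ** z], scaled by slightly more than [c^2]. *)
Lemma rep_isom z (c : R) : S z -> 0 <= c ->
  (forall v, nrm (pi z v) <= c * nrm v) -> mbnd (iota z) c.
Proof.
move=> Sz c0 hc.
have Szs := eS_star Sz.
have hs v : nrm (pi (star z) v) <= c * nrm v.
  apply: nrm_dot_le => [|w]; first by rewrite mulr_ge0 // nrm_ge0.
  rewrite -ro_dot //; apply: le_trans (cauchy_schwarz _ _) _.
  by rewrite mulrAC; apply: ler_wpM2r; rewrite ?nrm_ge0.
apply: mbnd_starM => // x.
apply/ler_addgt0Pr => e e0; have [d d0 hd] := small_factor (nrm_ge0 x) e0.
apply: le_trans (_ : (c ^+ 2 + d) * nrm x <= _); last by rewrite mulrDl lerD2l mulrC.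
have cd : 0 < c ^+ 2 + d by rewrite ltr_wpDl // sqr_ge0.
rewrite -(sh_star hiota) -(shM hiota).
pose h := star z ** z.
have Sh : S h by exact: eSM.
have sh : star h = h by rewrite /h starM starK.
have hb : mbnd (iota (rc (c ^+ 2 + d)^-1 *: h)) 1.
  apply: rep_isom_herm; [exact: eSZ|by rewrite starZr sh|] => v.
  rewrite scale_hnrm ?invr_gt0 // ler_pdivrMl //.
  rewrite roM //; apply: le_trans (hs _) _.
  apply: le_trans (ler_wpM2l c0 (hc v)) _.
  rewrite mulrA -expr2; apply: ler_wpM2r; rewrite ?nrm_ge0 //.
  by rewrite lerDl ltW.
have -> : iota (star z ** z) = rc (c ^+ 2 + d) *: iota (rc (c ^+ 2 + d)^-1 *: h).
  by rewrite (shZ hiota) scalerA -rcM mulfV ?gt_eqF // (_ : rc 1 = 1) // scale1r.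
by have := mbndZ (rc (c ^+ 2 + d)) hb x; rewrite cn_rc gtr0_norm // mulr1.
Qed.

End RepOn.
End EmbeddedAlgebra.

(** * Extension of representations to multipliers *)

Section ClosedStarSubalgebra.
Context {R : realType} {X : cstarType R}.
Implicit Types (S : set X) (x y : X).

Definition closed_star_subalgebra S :=
  [/\ S 0, forall (a : R[i]) x y, S x -> S y -> S (a *: x + y),
      forall x y, S x -> S y -> S (x ** y), forall x, S x -> S (star x)
    & forall x, (forall e : R, 0 < e -> exists2 y, S y & nrm (x - y) <= e) -> S x].

(** Elements of [S] that approximate a multiplier form a Cauchy sequence, as [minj] is isometric,
    and their limit in [X] induces the multiplier. *)
Lemma minj_mclosed S :
  (forall x, (forall e : R, 0 < e -> exists2 y, S y & nrm (x - y) <= e) -> S x) ->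
  mclosed (@minj R X @` S).
Proof.
have hm := @minj_star_hom R X.
move=> Sc m hmS.
have hs k : exists y, S y /\ mbnd (m - minj y) k.+1%:R^-1.
  have k0 : (0 : R) < k.+1%:R^-1 by rewrite invr_gt0.
  have [|_ [y Sy <-] hy] := hmS (rc k.+1%:R^-1); first by rewrite rc_lt.
  by exists y; split=> // x; rewrite mE_sub -rc_le rcM !nrmE; exact: hy.
have [s hs'] := choice hs.
have sb i j : nrm (s i - s j) <= i.+1%:R^-1 + j.+1%:R^-1.
  apply/minj_bnd; first by rewrite addr_ge0 // invr_ge0.
  rewrite (shB hm) => x.
  have -> : (minj (s i) - minj (s j)) x = (m - minj (s j)) x - (m - minj (s i)) x.
    by rewrite !mE_sub; zmod.
  apply: le_trans (nrmB _ _) _; rewrite mulrDl addrC.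
  by apply: lerD; [exact: (hs' i).2|exact: (hs' j).2].
have [|x hx] := nrm_complete (u := s).
  move=> e e0; have e20 : 0 < e / 2 by rewrite divr_gt0.
  have [N hN] := small_inv e20; exists N => i j Ni Nj.
  by apply: le_trans (sb i j) _; rewrite [leRHS]splitr lerD // hN.
exists x.
  apply: Sc => e e0; have [N hN] := hx e e0; exists (s N); first exact: (hs' N).1.
  by rewrite nrmC; apply: hN.
apply/esym/meq => z; apply: nrm_eq => e e0.
have e20 : 0 < e / 2 by rewrite divr_gt0.
have [d d0 hd] := small_factor (nrm_ge0 z) e20.
have [N hN] := small_inv d0; have [N' hN'] := hx d d0.
pose k := maxn N N'.
have -> : m z - minj x z = (m - minj (s k)) z + (s k - x) ** z.
  by rewrite mE_sub smulBl /=; zmod.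
apply: le_trans (nrmD _ _) _; rewrite [leRHS]splitr; apply: lerD.
  apply: le_trans ((hs' k).2 z) _; apply: le_trans hd; rewrite mulrC.
  by apply: ler_wpM2l; rewrite ?nrm_ge0 // hN // leq_maxl.
apply: le_trans (nrmM _ _) _; apply: le_trans hd; rewrite mulrC.
by apply: ler_wpM2l; rewrite ?nrm_ge0 // hN' // leq_maxr.
Qed.

Lemma minj_cstar_subalgebra S :
  closed_star_subalgebra S -> cstar_subalgebra (@minj R X @` S).
Proof.
have hm := @minj_star_hom R X.
move=> [S0 Sl SM Ss Sc]; split; [split| |].
- by exists 0 => //; rewrite (sh0 hm).
- by move=> a _ _ [x Sx <-] [y Sy <-]; exists (a *: x + y); [exact: Sl|rewrite (sh_lin hm)].
- exact: minj_mclosed.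
- by move=> _ _ [x Sx <-] [y Sy <-]; exists (x ** y); [exact: SM|rewrite (shM hm)].
- by move=> _ [x Sx <-]; exists (star x); [exact: Ss|rewrite (sh_star hm)].
Qed.

Lemma setT_cstar_subalgebra : cstar_subalgebra [set: multiplier X].
Proof. by split. Qed.

Lemma setT_closed_star : closed_star_subalgebra setT.
Proof. by split. Qed.

Lemma rep_rep_on S (H : hilbertType R) (pi : X -> H -> H) : rep pi -> rep_on S pi.
Proof. by move=> [_ pl pM ps _]; split=> *; [exact: pl|exact: pM|exact: ps]. Qed.

Section Rep.
Context (H : hilbertType R) (pi : X -> H -> H).
Hypothesis hpi : rep pi.
Let hm := @minj_star_hom R X.
Let hT := minj_cstar_subalgebra setT_closed_star.

Lemma rep_nrm x v : nrm (pi x v) <= nrm x * nrm v.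
Proof.
apply: (rep_contr hm (@minj_inj _ _) hT (rep_rep_on _ hpi)) => //; first exact: nrm_ge0.
by apply/minj_bnd; rewrite ?nrm_ge0.
Qed.

Lemma repD x y v : pi (x + y) v = pi x v + pi y v.
Proof. by case: hpi => _ h _ _ _; have := h 1 x y v; rewrite !scale1r. Qed.
Lemma rep0 v : pi 0 v = 0.
Proof. by apply: (addrI (pi 0 v)); rewrite -repD !addr0. Qed.
Lemma repZ (a : R[i]) x v : pi (a *: x) v = a *: pi x v.
Proof. by case: hpi => _ h _ _ _; have := h a x 0 v; rewrite !addr0 rep0 addr0. Qed.
Lemma repM x y v : pi (x ** y) v = pi x (pi y v).
Proof. by case: hpi. Qed.
Lemma rep_dot x v w : dot (pi x v) w = dot v (pi (star x) w).
Proof. by case: hpi. Qed.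
Lemma rep_dotr x v w : dot v (pi x w) = dot (pi (star x) v) w.
Proof. by rewrite rep_dot starK. Qed.
Lemma repB x y v : pi (x - y) v = pi x v - pi y v.
Proof. by rewrite repD -[- y]scaleN1r repZ scaleN1r. Qed.
Lemma rep_dense : closure (range (psum pi)) = setT.
Proof. by case: hpi. Qed.
Lemma rep_bopr x : bounded_op (pi x).
Proof. by case: hpi. Qed.
Lemma rep_bopl v : bounded_op (fun x => pi x v).
Proof.
apply: (bopI (C := nrm v)); [|exact: nrm_ge0|by move=> x; rewrite mulrC; exact: rep_nrm].
by move=> a x y; rewrite repD repZ.
Qed.
Lemma rep_sum (I : Type) (s : seq I) (F : I -> X) v :
  pi (\sum_(i <- s) F i) v = \sum_(i <- s) pi (F i) v.
Proof. by rewrite (lin_sum (bop_lin (rep_bopl v))). Qed.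

Lemma rep_inj_nrm x (c : R) : injective pi -> 0 <= c ->
  (forall v, nrm (pi x v) <= c * nrm v) -> nrm x <= c.
Proof.
move=> inj c0 hc; apply/minj_bnd => //.
apply: (rep_isom hm (@minj_inj _ _) hT (rep_rep_on _ hpi)) => // z _ hz.
by apply: inj; apply/funext => v; rewrite hz rep0.
Qed.

End Rep.

Lemma star_hom_mbnd (Y : cstarType R) (f : X -> multiplier Y) x :
  star_hom f -> mbnd (f x) (nrm x).
Proof.
move=> hf; have hT := minj_cstar_subalgebra setT_closed_star.
apply: (mhom_contr (@minj_star_hom R X) (@minj_inj _ _) hT (f := f)) => //.
- by split=> *; rewrite ?(sh_lin hf) ?(shM hf) ?(sh_star hf).
- exact: nrm_ge0.
- by apply/minj_bnd; rewrite ?nrm_ge0.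
Qed.

Lemma star_hom_nrm (Y : cstarType R) (f : X -> Y) x : star_hom f -> nrm (f x) <= nrm x.
Proof.
move=> hf; apply/minj_bnd; first exact: nrm_ge0.
exact: (star_hom_mbnd x (sh_comp hf (@minj_star_hom R Y))).
Qed.

End ClosedStarSubalgebra.

(** * Norm estimates from Gram kernels *)

Section Gram.
Context {R : realType}.

(** If two Gram kernels differ by a third one, the squared norms of corresponding sums differ by the
    square of a norm. *)
Lemma gram_le (H H' H'' : hilbertType R) (J : Type) (F : J -> H) (F' : J -> H')
    (F'' : J -> H'') :
  (forall i j, dot (F' i) (F' j) + dot (F'' i) (F'' j) = dot (F i) (F j)) ->
  forall s : seq J, nrm (\sum_(i <- s) F' i) <= nrm (\sum_(i <- s) F i).
Proof.
move=> h s; rewrite -(@ler_pXn2r _ 2) ?nnegrE ?nrm_ge0 //.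
rewrite -subr_ge0 -rc_le rcB -!dotxx.
have -> : dot (\sum_(i <- s) F i) (\sum_(i <- s) F i) -
    dot (\sum_(i <- s) F' i) (\sum_(i <- s) F' i) =
    dot (\sum_(i <- s) F'' i) (\sum_(i <- s) F'' i).
  rewrite !dot_suml -sumrB; apply: eq_bigr => p _.
  rewrite !dot_sumr -sumrB; apply: eq_bigr => q _.
  by rewrite -h addrAC subrr add0r.
by rewrite dotxx rc_le sqr_ge0.
Qed.

(** When inner products of the vectors [F x b] depend on [star x ** y] only, multipliers act
    boundedly. For a contraction [n] and [g = 1 - sqrt (1 - star n ** n)], the kernels of [F (n x)]
    and [F (x - g x)] add up to that of [F x], and [gram_le] applies. All extensions to multipliers
    below are instances. *)
Lemma gram_multiplier (X : cstarType R) (H : hilbertType R) (B : Type)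
    (F : X -> B -> H) (G : B -> B -> X -> R[i]) (m : multiplier X) (c : R) :
  (forall (a : R[i]) x b, F (a *: x) b = a *: F x b) ->
  (forall b b' x y, G b b' (x + y) = G b b' x + G b b' y) ->
  (forall x y b b', dot (F x b) (F y b') = G b b' (star x ** y)) ->
  0 <= c -> mbnd m c ->
  forall s, nrm (psum (fun x b => F (m x) b) s) <= c * nrm (psum F s).
Proof.
move=> FZ GD FG c0 hm s.
apply/ler_addgt0Pr => e e0; have [d d0 hd] := small_factor (nrm_ge0 (psum F s)) e0.
apply: le_trans (_ : (c + d) * nrm (psum F s) <= _); last by rewrite mulrDl lerD2l mulrC.
have ce : 0 < c + d by rewrite ltr_wpDl.
have [n nE] : exists n, n = rc (c + d)^-1 *: m by eexists.
have nb : mbnd n 1.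
  have := mbndZ (rc (c + d)^-1) hm; rewrite -nE cn_rc gtr0_norm ?invr_gt0 // => h.
  by apply: mbnd_le h; rewrite mulrC ler_pdivrMr // mul1r lerDl ltW.
have sh : star (star n ** n) = star n ** n by rewrite starM starK.
have hb : mbnd (star n ** n) 1.
  by rewrite -[1]mulr1; apply: mbndM => //; exact: mbnd_star.
have [g [_ sg _ ge _]] := msqrt (setT_cstar_subalgebra (X := X)) I sh hb.
have -> : psum (fun x b => F (m x) b) s = rc (c + d) *: psum (fun x b => F (n x) b) s.
  rewrite /psum scaler_sumr; apply: eq_bigr => p _.
  by rewrite nE mE_scale FZ scalerA -rcM mulfV ?gt_eqF // (_ : rc 1 = 1) // scale1r.
rewrite nrmZ cn_rc gtr0_norm // ler_pM2l //.
apply: (gram_le (F := fun p => F p.1 p.2) (F' := fun p => F (n p.1) p.2)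
  (F'' := fun p => F (p.1 - g p.1) p.2)) => -[x b] [y b'] /=.
rewrite !FG -GD; congr (G _ _ _).
rewrite mstar_dot starB smBl !smBr !mstar_dot sg -!mE_mul -ge.
by rewrite mE_sub mE_add smBr smulDr; zmod.
Qed.

Context (t : tensor_models R).

(** A model of the minimal tensor product carries faithful representations of its factors, so the
    given models supply one for every [X]. *)
Lemma faithful_rep (X : cstarType R) :
  exists (H : hilbertType R) (pi : X -> H -> H), rep pi /\ injective pi.
Proof.
have [H [K [T [pi [rho [tau [[h h'] _ _ _]]]]]]] := mt_spatial (cstar_model t X X).
by exists H, pi.
Qed.

(** The version with a [T]-valued inner product: a faithful representation of [T] evaluated at each
    vector reduces it to the scalar case. *)
Lemma gram_multiplier_cstar (X T : cstarType R) (B : Type)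
    (F : X -> B -> T) (G : B -> B -> X -> T) (m : multiplier X) (c : R) :
  (forall (a : R[i]) x b, F (a *: x) b = a *: F x b) ->
  (forall b b' x y, G b b' (x + y) = G b b' x + G b b' y) ->
  (forall x y b b', star (F x b) ** F y b' = G b b' (star x ** y)) ->
  0 <= c -> mbnd m c ->
  forall s, nrm (psum (fun x b => F (m x) b) s) <= c * nrm (psum F s).
Proof.
move=> FZ GD FG c0 hm s.
have [H [pi [hpi ipi]]] := faithful_rep T.
apply: (rep_inj_nrm hpi) => // [|v]; first by rewrite mulr_ge0 // nrm_ge0.
rewrite -mulrA; apply: le_trans (ler_wpM2l c0 (rep_nrm hpi _ v)).
rewrite /psum !(rep_sum hpi).
apply: (@gram_multiplier _ _ _ (fun x b => pi (F x b) v)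
  (fun b b' x => dot v (pi (G b b' x) v))) => //.
- by move=> a x b; rewrite FZ (repZ hpi).
- by move=> b b' x y; rewrite GD (repD hpi) dotDr.
- by move=> x y b b'; rewrite (rep_dot hpi) -(repM hpi) FG.
Qed.

End Gram.

Section RepExt.
Context {R : realType} {X : cstarType R} {H : hilbertType R} (pi : X -> H -> H).
Hypothesis hpi : rep pi.
Implicit Types (m n : multiplier X) (v w : H).

Lemma rx_ex m c : 0 <= c -> mbnd m c -> exists T : H -> H,
  [/\ linear T, forall v, nrm (T v) <= c * nrm v & forall x v, T (pi x v) = pi (m x) v].
Proof.
move=> c0 hm; apply: (blt2 (f := pi) (g := fun x v => pi (m x) v)) => //.
- by move=> a x v; rewrite (repZ hpi).
- by move=> a x v; rewrite mleftZ (repZ hpi).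
- exact: rep_dense.
- apply: (gram_multiplier (G := fun v w x => dot v (pi x w))) => //.
  + by move=> a x v; rewrite (repZ hpi).
  + by move=> b b' x y; rewrite (repD hpi) dotDr.
  + by move=> x y v w; rewrite (rep_dot hpi) -(repM hpi).
Qed.

Lemma rx_spec m : bounded_op (rep_ext pi m) /\
  forall x v, rep_ext pi m (pi x v) = pi (m x) v.
Proof.
rewrite /rep_ext; case: xgetP => [T _ //|].
have [c c0 hm] := mbound m; have [T [lT bT hT]] := rx_ex c0 hm.
by move=> /(_ T) []; split=> //; exact: (bopI (C := c)).
Qed.

Lemma rx_bop m : bounded_op (rep_ext pi m). Proof. by case: (rx_spec m). Qed.
Lemma rxE m x v : rep_ext pi m (pi x v) = pi (m x) v. Proof. by case: (rx_spec m). Qed.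
Lemma rx_lin m : linear (rep_ext pi m). Proof. exact: bop_lin (rx_bop m). Qed.

Lemma rx_uniq m T : bounded_op T -> (forall x v, T (pi x v) = pi (m x) v) ->
  T = rep_ext pi m.
Proof.
by move=> bT hT; apply: bop_ext (rep_dense hpi) _ => // [|x v]; rewrite ?rxE //; exact: rx_bop.
Qed.

Lemma rx_bnd m c v : 0 <= c -> mbnd m c -> nrm (rep_ext pi m v) <= c * nrm v.
Proof.
move=> c0 hm; have [T [lT bT hT]] := rx_ex c0 hm.
by rewrite -(rx_uniq (bopI lT c0 bT) hT).
Qed.

Lemma rx_lc (a : R[i]) m n v : rep_ext pi (a *: m + n) v = a *: rep_ext pi m v + rep_ext pi n v.
Proof.
rewrite -(@rx_uniq _ (fun v => a *: rep_ext pi m v + rep_ext pi n v)) //.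
  by apply: bop_lc; exact: rx_bop.
by move=> x w; rewrite !rxE mE_add mE_scale (repD hpi) (repZ hpi).
Qed.
Lemma rxD m n v : rep_ext pi (m + n) v = rep_ext pi m v + rep_ext pi n v.
Proof. by have := rx_lc 1 m n v; rewrite !scale1r. Qed.
Lemma rxB m n v : rep_ext pi (m - n) v = rep_ext pi m v - rep_ext pi n v.
Proof. by have := rx_lc (-1) n m v; rewrite !scaleN1r addrC => ->; rewrite addrC. Qed.
Lemma rx0 v : rep_ext pi 0 v = 0.
Proof. by apply: (addrI (rep_ext pi 0 v)); rewrite -rxD !addr0. Qed.
Lemma rx_sum (I : Type) (s : seq I) (F : I -> multiplier X) v :
  rep_ext pi (\sum_(i <- s) F i) v = \sum_(i <- s) rep_ext pi (F i) v.
Proof.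
elim: s => [|i s IH]; first by rewrite !big_nil rx0.
by rewrite !big_cons rxD IH.
Qed.

Lemma rxM m n v : rep_ext pi (m ** n) v = rep_ext pi m (rep_ext pi n v).
Proof.
rewrite -(@rx_uniq _ (rep_ext pi m \o rep_ext pi n)) //; first exact: bop_comp (rx_bop _) (rx_bop _).
by move=> x w; rewrite /= !rxE.
Qed.

Lemma rx_minj x : rep_ext pi (minj x) = pi x.
Proof.
by rewrite -(@rx_uniq _ (pi x)) //; [exact: rep_bopr|move=> y v; rewrite -(repM hpi)].
Qed.

Lemma rx_one v : rep_ext pi mone v = v.
Proof. by rewrite -(@rx_uniq mone id) //; exact: bop_id. Qed.

Lemma rx_dot m v w : dot (rep_ext pi m v) w = dot v (rep_ext pi (star m) w).
Proof.
have e1 w' : (fun v => dot w' (rep_ext pi m v)) = (fun v => dot (rep_ext pi (star m) w') v).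
  apply: (@bop_ext _ H R[i]^o _ _ pi); [|exact: dot_bop|exact: rep_dense|].
    exact: (bop_comp (dot_bop w') (rx_bop m)).
  move=> x v'.
  have e2 : (fun w' => dot (rep_ext pi m (pi x v')) w') =
            (fun w' => dot (pi x v') (rep_ext pi (star m) w')).
    apply: (@bop_ext _ H R[i]^o _ _ pi); [exact: dot_bop| |exact: rep_dense|].
      exact: (bop_comp (dot_bop _) (rx_bop (star m))).
    move=> y u; rewrite !rxE !(rep_dot hpi) -!(repM hpi).
    by rewrite -mstar_dot.
  by rewrite dotC (congr1 (@^~ w') e2) -dotC.
by rewrite dotC (congr1 (@^~ v) (e1 w)) -dotC.
Qed.

Lemma rx_isom m (c : R) : injective pi -> 0 <= c ->
  (forall v, nrm (rep_ext pi m v) <= c * nrm v) -> mbnd m c.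
Proof.
move=> inj c0 hc x; apply: (rep_inj_nrm hpi) => // [|v]; first by rewrite mulr_ge0 // nrm_ge0.
rewrite -rxE -mulrA; apply: le_trans (hc _) _; apply: ler_wpM2l => //; exact: rep_nrm.
Qed.

Lemma rx_inj m n : injective pi -> (forall v, rep_ext pi m v = rep_ext pi n v) -> m = n.
Proof.
move=> inj h; apply: meq => x; apply: inj; apply/funext => v.
by rewrite -!rxE h.
Qed.

(** The multiplier algebra is the idealizer of the image of a faithful representation. The
    conditions on [T] and its adjoint [T'] provide the left and the right action. *)
Lemma idealizer (T T' : H -> H) : injective pi ->
  bounded_op T -> (forall v w, dot (T v) w = dot v (T' w)) ->
  (forall x, exists y, forall v, T (pi x v) = pi y v) ->
  (forall x, exists y, forall v, T' (pi x v) = pi y v) ->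
  exists m, rep_ext pi m = T.
Proof.
move=> inj bT dT /choice[l hl] /choice[r hr].
have mP x y : x ** l y = star (r (star x)) ** y.
  apply: inj; apply/funext => v; apply: dot_eqP => w.
  rewrite !(repM hpi) -hl -[dot w (pi (star _) _)](rep_dot hpi) -hr.
  rewrite -[in LHS](starK x) -(rep_dot hpi) dotC dT -dotC.
  by [].
exists (Multiplier mP); apply/esym/(rx_uniq bT) => x v; exact: hl.
Qed.

End RepExt.

(** * Tensor products *)

Section ClosedSubspace.
Context {R : realType}.

(** Closed and additive, without scalars: with [dense_ind] this is the induction principle for total
    sets, and predicates on [V] can be used in it without a proof of homogeneity. *)
Definition closed_sub {V : normedModType R[i]} (P : V -> Prop) :=
  [/\ P 0, forall u v, P u -> P v -> P (u + v)
    & forall u, (forall e : R, 0 < e -> exists2 v, P v & nrm (u - v) <= e) -> P u].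

Lemma closed_sub_sum (V : normedModType R[i]) (P : V -> Prop) (I : Type) (s : seq I)
  (F : I -> V) : closed_sub P -> (forall i, P (F i)) -> P (\sum_(i <- s) F i).
Proof. by move=> [P0 PD _] h; elim/big_ind : _ => //. Qed.

Lemma dense_ind (V : normedModType R[i]) (A B : Type) (f : A -> B -> V) (P : V -> Prop) :
  closure (range (psum f)) = setT -> closed_sub P -> (forall a b, P (f a b)) ->
  forall x, P x.
Proof.
move=> dn hP h x; case: (hP) => _ _; apply => e e0.
have [_ [s _ <-] hs] := closureT_dense dn x e0; exists (psum f s) => //.
exact: closed_sub_sum.
Qed.

Lemma closed_sub_comp (V W : normedModType R[i]) (P : W -> Prop) (L : V -> W) :
  bounded_op L -> closed_sub P -> closed_sub (fun v => P (L v)).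
Proof.
move=> /bounded_opP[lL [C C0 hC]] [P0 PD Pc]; split=> [|u v hu hv|u h].
- by rewrite (lin0 lL).
- by rewrite (linD lL); exact: PD.
- apply: Pc => e e0; have [d d0 hd] := small_factor C0 e0.
  have [v Pv hv] := h d d0; exists (L v) => //.
  rewrite -(linB lL); apply: le_trans (hC _) _; apply: le_trans hd.
  exact: ler_wpM2l.
Qed.

Lemma closed_sub_and (V : normedModType R[i]) (J : Type) (P : J -> V -> Prop) :
  (forall i, closed_sub (P i)) -> closed_sub (fun v => forall i, P i v).
Proof.
move=> h; split=> [i|u v hu hv i|u hu i]; have [P0 PD Pc] := h i => //; first exact: PD.
by apply: Pc => e e0; have [v Pv hv] := hu e e0; exists v.
Qed.

Lemma closed_sub_eq (V W : normedModType R[i]) (f g : V -> W) :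
  bounded_op f -> bounded_op g -> closed_sub (fun v => f v = g v).
Proof.
move=> bf bg; have bh := bop_lc (-1) bf bg.
have e v : (f v = g v) <-> -1 *: f v + g v = 0.
  rewrite scaleN1r addrC; split=> [->|/eqP]; first exact: subrr.
  by rewrite subr_eq0 => /eqP.
have h0 : closed_sub (fun w : W => w = 0).
  split=> // [u v -> ->|u hu]; first by rewrite addr0.
  by apply: nrm_small => d d0; have [v -> hv] := hu d d0; rewrite subr0 in hv.
have [P0 PD Pc] := closed_sub_comp bh h0.
split=> [|u v /e hu /e hv|u hu]; apply/e => //; first exact: PD.
by apply: Pc => d d0; have [v /e Pv hv] := hu d d0; exists v.
Qed.

Lemma closure_psum_closed (V : normedModType R[i]) (A B : Type) (f : A -> B -> V) :
  closed_sub (closure (range (psum f))).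
Proof.
split=> [|u v hu hv|u hu]; apply/nrm_closureP => e e0.
- by exists 0; rewrite ?subrr ?nrm0 ?ltW //; exists [::] => //; rewrite /psum big_nil.
- have e20 : 0 < e / 2 by rewrite divr_gt0.
  have [_ [s _ <-] hs] := (nrm_closureP _ _).1 hu _ e20.
  have [_ [s' _ <-] hs'] := (nrm_closureP _ _).1 hv _ e20.
  exists (psum f (s ++ s')); first by exists (s ++ s').
  rewrite /psum big_cat /= opprD addrACA; apply: le_trans (nrmD _ _) _.
  by rewrite [leRHS]splitr lerD.
- have e20 : 0 < e / 2 by rewrite divr_gt0.
  have [v hv huv] := hu _ e20.
  have [y Sy hy] := (nrm_closureP _ _).1 hv _ e20; exists y => //.
  by apply: le_trans (nrm_tri _ v _) _; rewrite [leRHS]splitr lerD.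
Qed.

Lemma closure_psum_in (V : normedModType R[i]) (A B : Type) (f : A -> B -> V) a b :
  closure (range (psum f)) (f a b).
Proof. by apply: subset_closure; exists [:: (a, b)] => //; rewrite /psum big_seq1. Qed.

(** The closed additive span. It is a linear subspace as soon as [S] is stable under scalars
    ([cspanZ]), as holds for the generators used later. *)
Definition cspan {V : normedModType R[i]} (S : set V) (x : V) :=
  forall e : R, 0 < e -> exists s : seq V, (forall y, List.In y s -> S y) /\
    nrm (x - \sum_(y <- s) y) <= e.

Lemma cspan_closed (V : normedModType R[i]) (S : set V) : closed_sub (cspan S).
Proof.
split=> [e e0|u v hu hv e e0|u hu e e0].
- by exists [::]; split=> //; rewrite big_nil subrr nrm0 ltW.
- have e20 : 0 < e / 2 by rewrite divr_gt0.
  have [s [hs hs']] := hu _ e20; have [r [hr hr']] := hv _ e20.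
  exists (s ++ r); split=> [y /(@List.in_app_or _ s r)[]|]; [exact: hs|exact: hr|].
  rewrite big_cat /= opprD addrACA; apply: le_trans (nrmD _ _) _.
  by rewrite [leRHS]splitr lerD.
- have e20 : 0 < e / 2 by rewrite divr_gt0.
  have [v hv huv] := hu _ e20; have [s [hs hs']] := hv _ e20.
  exists s; split=> //; apply: le_trans (nrm_tri _ v _) _.
  by rewrite [leRHS]splitr lerD.
Qed.

Lemma cspan_in (V : normedModType R[i]) (S : set V) x : S x -> cspan S x.
Proof.
move=> Sx e e0; exists [:: x]; split=> [y [<-|[]] //|].
by rewrite big_seq1 subrr nrm0 ltW.
Qed.

Lemma cspan_ind (V : normedModType R[i]) (S : set V) (P : V -> Prop) :
  closed_sub P -> (forall y, S y -> P y) -> forall x, cspan S x -> P x.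
Proof.
move=> hP h x hx; case: (hP) => P0 PD; apply => e e0.
have [s [hs hs']] := hx e e0; exists (\sum_(y <- s) y) => //.
elim: s hs {hs'} => [|y s IH] hs; first by rewrite big_nil.
rewrite big_cons; apply: PD; first by apply/h/hs; left.
by apply: IH => z hz; apply: hs; right.
Qed.

Lemma cspanZ (V : normedModType R[i]) (S : set V) (a : R[i]) x :
  (forall y, S y -> S (a *: y)) -> cspan S x -> cspan S (a *: x).
Proof.
move=> hS hx.
have bZ : bounded_op (fun y : V => a *: y).
  apply: (bopI (C := cn a)); [|exact: cn_ge0|by move=> y; rewrite nrmZ].
  by move=> b y z; rewrite scalerDr !scalerA mulrC.
apply: (cspan_ind (closed_sub_comp bZ (cspan_closed S)) _ hx) => y Sy.
exact/cspan_in/hS.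
Qed.

Lemma conj_bop (X : cstarType R) (f : X -> R[i]) :
  bounded_op (f : X -> R[i]^o) -> bounded_op (fun z => Num.conj (f (star z)) : R[i]^o).
Proof.
move=> /bounded_opP[lf [C C0 hC]]; apply: (bopI (C := C)) => // [a x y|x].
  rewrite starD starZ (linD lf) (linZ lf) rmorphD /= rmorphM /= -/(Num.conj _).
  by rewrite [X in X * _ + _]conjCK.
change (cn (Num.conj (f (star x))) <= C * nrm x).
by rewrite cn_conj -(nrm_star x); exact: hC.
Qed.

(** Bounded maps that are adjoint to each other on a total set are adjoint everywhere, hence the
    left actions of a multiplier and of its star. *)
Lemma mkmult (V : cstarType R) (A B : Type) (f : A -> B -> V) (L L' : V -> V) :
  closure (range (psum f)) = setT -> bounded_op L -> bounded_op L' ->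
  (forall a b a' b', star (L (f a b)) ** f a' b' = star (f a b) ** L' (f a' b')) ->
  exists k : multiplier V, (forall z, k z = L z) /\ (forall z, star k z = L' z).
Proof.
move=> dn bL bL' h.
have h1 z a b : star (f a b) ** L z = star (L' (f a b)) ** z.
  move: z; apply: (dense_ind dn); last first.
    by move=> a' b'; rewrite -[LHS]starK starM starK h starM starK.
  by apply: closed_sub_eq; [exact: (bop_comp (sm_bop_r _) bL)|exact: sm_bop_r].
have h2 z u : star (L z) ** u = star z ** L' u.
  move: u; apply: (dense_ind dn); last first.
    by move=> a b; rewrite -[LHS]starK starM starK h1 starM starK.
  by apply: closed_sub_eq; [exact: sm_bop_r|exact: (bop_comp (sm_bop_r _) bL')].
have mP x y : x ** L y = star (L' (star x)) ** y.
  by rewrite -[LHS]starK starM h2 starM starK.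
exists (Multiplier mP); split=> z //=; by rewrite !starK.
Qed.

End ClosedSubspace.

Section MinTensor.
Context {R : realType} {t : tensor_models R} {X Y : cstarType R} (M : min_tensor X Y).
Implicit Types (x : X) (y : Y) (z : M).
Local Notation pr := (mt_pair M).

Lemma mt_dense : closure (range (psum pr)) = setT.
Proof. exact: mt_total. Qed.

Lemma mt_eq z z' : (forall (H K : hilbertType R) (T : hilbert_tensor H K)
   (pi : X -> H -> H) (rho : Y -> K -> K) (tau : M -> T -> T),
   rep pi -> rep rho -> rep tau ->
   (forall x y v w, tau (pr x y) (hpair T v w) = hpair T (pi x v) (rho y w)) ->
   forall v w, tau z (hpair T v w) = tau z' (hpair T v w)) -> z = z'.
Proof.
have [H [K [T [pi [rho [tau [[h1 _] [h2 _] [h3 inj] e]]]]]]] := mt_spatial M.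
move=> h; apply: inj; apply: hbop_ext => [||v w]; [exact: rep_bopr|exact: rep_bopr|].
exact: (h _ _ _ pi rho).
Qed.

Lemma mtDl x x' y : pr (x + x') y = pr x y + pr x' y.
Proof.
by apply: mt_eq => H K T pi rho tau hp hr ht e v w;
  rewrite (repD ht) !e (repD hp) hpairDl.
Qed.
Lemma mtDr x y y' : pr x (y + y') = pr x y + pr x y'.
Proof.
by apply: mt_eq => H K T pi rho tau hp hr ht e v w;
  rewrite (repD ht) !e (repD hr) hpairDr.
Qed.
Lemma mtZl (a : R[i]) x y : pr (a *: x) y = a *: pr x y.
Proof.
by apply: mt_eq => H K T pi rho tau hp hr ht e v w;
  rewrite (repZ ht) !e (repZ hp) hpairZl.
Qed.
Lemma mtZr (a : R[i]) x y : pr x (a *: y) = a *: pr x y.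
Proof.
by apply: mt_eq => H K T pi rho tau hp hr ht e v w;
  rewrite (repZ ht) !e (repZ hr) hpairZr.
Qed.
Lemma mtM x x' y y' : pr x y ** pr x' y' = pr (x ** x') (y ** y').
Proof.
by apply: mt_eq => H K T pi rho tau hp hr ht e v w;
  rewrite (repM ht) !e (repM hp) (repM hr).
Qed.
Lemma mt_star x y : star (pr x y) = pr (star x) (star y).
Proof.
apply: mt_eq => H K T pi rho tau hp hr ht e v w; apply: hsep => v' w'.
by rewrite -(rep_dot ht) !e !hpair_dot (rep_dot hp) (rep_dot hr).
Qed.

Lemma mt_legl_bound (m : multiplier X) (c : R) : 0 <= c -> mbnd m c ->
  forall s, nrm (psum (fun x y => pr (m x) y) s) <= c * nrm (psum pr s).
Proof.
move=> c0 hm; apply: (gram_multiplier_cstar t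
  (G := fun y y' x => pr x (star y ** y'))) => //.
- by move=> a x y; rewrite mtZl.
- by move=> y y' x x'; rewrite mtDl.
- by move=> x x' y y'; rewrite mt_star mtM.
Qed.

Lemma mt_legr_bound (m : multiplier Y) (c : R) : 0 <= c -> mbnd m c ->
  forall s, nrm (psum (fun x y => pr x (m y)) s) <= c * nrm (psum pr s).
Proof.
move=> c0 hm s.
have h := @gram_multiplier_cstar _ t Y M X (fun y x => pr x y)
  (fun x x' y => pr (star x ** x') y) m c.
have := h _ _ _ c0 hm [seq (p.2, p.1) | p <- s].
rewrite /psum !big_map /=; apply.
- by move=> a y x; rewrite mtZr.
- by move=> x x' y y'; rewrite mtDr.
- by move=> y y' x x'; rewrite mt_star mtM.
Qed.

Lemma mt_ten_ex (m : multiplier X) (n : multiplier Y) : exists k : multiplier M,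
  forall x y, k (pr x y) = pr (m x) (n y).
Proof.
have key (m' : multiplier X) (n' : multiplier Y) : exists L : M -> M,
    bounded_op L /\ forall x y, L (pr x y) = pr (m' x) (n' y).
  have [c c0 hc] := mbound m'; have [d d0 hd] := mbound n'.
  have [||||s|L [lL bL hL]] := @blt2 _ _ _ _ _ pr (fun x y => pr (m' x) (n' y)) (c * d).
  - by move=> a x y; rewrite mtZl.
  - by move=> a x y; rewrite mleftZ mtZl.
  - exact: mt_dense.
  - exact: mulr_ge0.
  - have := mt_legl_bound c0 hc [seq (p.1, n' p.2) | p <- s].
    rewrite /psum !big_map /= => h; apply: le_trans h _.
    by rewrite -mulrA; apply: ler_wpM2l => //; exact: mt_legr_bound.
  - by exists L; split=> //; apply: (bopI (C := c * d)); rewrite ?mulr_ge0.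
have [L [bL hL]] := key m n; have [L' [bL' hL']] := key (star m) (star n).
have [|k [hk _]] := mkmult mt_dense bL bL'.
  by move=> x y x' y'; rewrite hL hL' !mt_star !mtM !mstar_dot.
by exists k => x y; rewrite hk hL.
Qed.

Lemma mt_nrm x y : nrm (pr x y) <= nrm x * nrm y.
Proof.
apply: nrm_mul_le => [|z]; first by rewrite mulr_ge0 // nrm_ge0.
apply/ler_addgt0Pr => e e0.
have C0 : 0 <= nrm (pr x y) + nrm x * nrm y by rewrite addr_ge0 ?mulr_ge0 ?nrm_ge0.
have [d d0 hd] := small_factor C0 e0.
have [_ [s _ <-] hs] := closureT_dense mt_dense z d0.
rewrite -[z](subrK (psum pr s)) smulDr; apply: le_trans (nrmD _ _) _.
have h1 : nrm (pr x y ** psum pr s) <= nrm x * nrm y * nrm (psum pr s).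
  have -> : pr x y ** psum pr s =
      psum (fun x' y' => pr (minj x x') y') [seq (p.1, minj y p.2) | p <- s].
    by rewrite /psum big_map sm_sumr; apply: eq_bigr => p _; rewrite mtM.
  apply: le_trans (mt_legl_bound (nrm_ge0 x) _ _) _.
    by apply/minj_bnd; rewrite ?nrm_ge0.
  rewrite -mulrA; apply: ler_wpM2l; rewrite ?nrm_ge0 //.
  rewrite /psum big_map /=; apply: (mt_legr_bound (m := minj y) (nrm_ge0 y)).
  by apply/minj_bnd; rewrite ?nrm_ge0.
have h2 : nrm (psum pr s) <= nrm z + d.
  rewrite -[psum pr s](subrK z) addrC; apply: le_trans (nrmD _ _) _.
  by rewrite lerD2l nrmC.
have h3 := nrmM (pr x y) (z - psum pr s).
have n1 := nrm_ge0 (pr x y).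
have n2 : 0 <= nrm x * nrm y by rewrite mulr_ge0 // nrm_ge0.
rewrite subrK; move: h1 h2 h3 hs hd C0 n1 n2.
set a := nrm x * nrm y; set b := nrm (pr x y); nra.
Qed.

Lemma mt_bopl y : bounded_op (fun x => pr x y).
Proof.
apply: (bopI (C := nrm y)); [|exact: nrm_ge0|by move=> x; rewrite mulrC mt_nrm].
by move=> a x x'; rewrite mtDl mtZl.
Qed.
Lemma mt_bopr x : bounded_op (fun y => pr x y).
Proof.
apply: (bopI (C := nrm x)); [|exact: nrm_ge0|by move=> y; rewrite mt_nrm].
by move=> a y y'; rewrite mtDr mtZr.
Qed.

(** A coefficient of the slice at [u, v] is [om y0], where [y0] slices the other leg by the
    coefficient functional of [pi] at [u, v]. The coefficients of [y0] are coefficients of the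
    represented tensor, which bounds [y0]; no positivity of [om] enters. *)
Lemma mt_slice_ex (om : Y -> R[i]) (c : R) :
  linear (om : Y -> R[i]^o) -> 0 <= c -> (forall y, cn (om y) <= c * nrm y) ->
  exists S : M -> X, [/\ linear S, forall z, nrm (S z) <= c * nrm z
    & forall x y, S (pr x y) = om y *: x].
Proof.
move=> lo c0 hc.
have [H [K [T [pi [rho [tau [[hp ip] [hr ir] [ht it] e]]]]]]] := mt_spatial M.
apply: (@blt2 _ _ _ _ _ pr (fun x y => om y *: x)) => //.
- by move=> a x y; rewrite mtZl.
- by move=> a x y; rewrite !scalerA mulrC.
- exact: mt_dense.
move=> s; apply: (rep_inj_nrm hp) => // [|v]; first by rewrite mulr_ge0 // nrm_ge0.
apply: nrm_dot_le => [|u]; first by rewrite !mulr_ge0 // nrm_ge0.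
pose y0 := \sum_(p <- s) dot u (pi p.1 v) *: p.2.
have -> : dot u (pi (psum (fun x y => om y *: x) s) v) = om y0.
  rewrite (lin_sum lo) /psum (rep_sum hp) dot_sumr; apply: eq_bigr => p _.
  by rewrite (repZ hp) dotZr (linZ lo) mulrC.
apply: le_trans (hc _) _; rewrite -!mulrA; apply: ler_wpM2l => //.
apply: (rep_inj_nrm hr) => // [|w]; first by rewrite !mulr_ge0 // nrm_ge0.
apply: nrm_dot_le => [|w']; first by rewrite !mulr_ge0 // nrm_ge0.
have -> : dot w' (rho y0 w) = dot (hpair T u w') (tau (psum pr s) (hpair T v w)).
  rewrite /y0 (rep_sum hr) /psum (rep_sum ht) !dot_sumr; apply: eq_bigr => p _.
  by rewrite (repZ hr) dotZr e hpair_dot.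
apply: le_trans (cauchy_schwarz _ _) _; rewrite hpair_nrm.
have := rep_nrm ht (psum pr s) (hpair T v w); rewrite hpair_nrm => h.
apply: le_trans (ler_wpM2l _ h) _; first by rewrite mulr_ge0 // nrm_ge0.
by rewrite le_eqVlt; apply/orP; left; apply/eqP; ring.
Qed.

End MinTensor.

(** * Tensor products of representations *)

Section RepTen.
Context {R : realType} {t : tensor_models R} {X Y : cstarType R} (M : min_tensor X Y).
Context {H K : hilbertType R} (T : hilbert_tensor H K).
Context (pi : X -> H -> H) (rho : Y -> K -> K).
Hypotheses (hp : rep pi) (hr : rep rho).
Local Notation pr := (mt_pair M).
Local Notation "v ⊠ w" := (hpair T v w) (at level 30).

Lemma bop_scale (V W : normedModType R[i]) (a : R[i]) (f : V -> W) :
  bounded_op f -> bounded_op (fun x => a *: f x).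
Proof.
move=> /bounded_opP[lf [C C0 hC]].
apply: (bopI (C := cn a * C)); rewrite ?mulr_ge0 ?cn_ge0 //.
  by move=> b x y; rewrite lf scalerDr !scalerA mulrC.
by move=> x; rewrite nrmZ -mulrA; apply: ler_wpM2l; rewrite ?cn_ge0.
Qed.

Lemma csqrt (Z : cstarType R) (h : Z) : star h = h -> nrm h <= 1 ->
  exists g, star g = g /\ g + g - g ** g = h.
Proof.
move=> sh h1.
have [|g [_ sg _ ge _]] := emb_sqrt (@minj_star_hom R Z) (@minj_inj _ _)
    (minj_cstar_subalgebra (setT_closed_star (X := Z))) I sh.
  by apply/minj_bnd.
by exists g.
Qed.

(** The squared norm of the left-hand vector is the coefficient at [v] of the slice of [star z ** z]
    by [y -> dot w (rho y w)], so bounded slices suffice even when [pi] and [rho] are not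
    faithful. *)
Lemma rt_bound v w s : nrm (psum (fun x y => pi x v ⊠ rho y w) s) <=
  nrm v * nrm w * nrm (psum pr s).
Proof.
pose om (y : Y) := dot w (rho y w).
have lo : linear (om : Y -> R[i]^o).
  by move=> a y y'; rewrite /om (repD hr) (repZ hr) dotDr dotZr.
have ho y : cn (om y) <= nrm w ^+ 2 * nrm y.
  apply: le_trans (cauchy_schwarz _ _) _; rewrite expr2 -mulrA; apply: ler_wpM2l.
    exact: nrm_ge0.
  by rewrite mulrC; exact: rep_nrm.
have [S [lS bS hS]] := mt_slice_ex M lo (sqr_ge0 _) ho.
set z := psum pr s; set u := psum _ s.
have e : rc (nrm u ^+ 2) = dot v (pi (S (star z ** z)) v).
  rewrite -dotxx /z /u /psum star_sum sm_suml (lin_sum lS) (rep_sum hp).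
  rewrite dot_suml dot_sumr; apply: eq_bigr => p _.
  rewrite sm_sumr (lin_sum lS) (rep_sum hp) !dot_sumr; apply: eq_bigr => q _.
  rewrite mt_star mtM hS (repZ hp) dotZr hpair_dot (rep_dot hp) (rep_dot hr).
  by rewrite -(repM hp) -(repM hr) mulrC.
rewrite -(@ler_pXn2r _ 2) ?nnegrE ?mulr_ge0 ?nrm_ge0 //.
have -> : nrm u ^+ 2 = cn (dot v (pi (S (star z ** z)) v)).
  by rewrite -e cn_rc ger0_norm ?sqr_ge0.
apply: le_trans (cauchy_schwarz _ _) _.
have h1 := rep_nrm hp (S (star z ** z)) v.
have h2 := bS (star z ** z); rewrite nrm_starM in h2.
apply: le_trans (ler_wpM2l (nrm_ge0 _) h1) _.
apply: le_trans (ler_wpM2l (nrm_ge0 _) (ler_wpM2r (nrm_ge0 _) h2)) _.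
by rewrite le_eqVlt; apply/orP; left; apply/eqP; ring.
Qed.

Lemma rep_ten_ex : exists tau : M -> T -> T, rep tau /\
  forall x y v w, tau (pr x y) (v ⊠ w) = pi x v ⊠ rho y w.
Proof.
(* [S p] is the orbit map of the vector [p.1 ⊠ p.2]; these maps exist before the representation
   [tau] and determine it. *)
have Sex (p : H * K) : exists S : M -> T,
    bounded_op S /\ forall x y, S (pr x y) = pi x p.1 ⊠ rho y p.2.
  have [||||s|S [lS bS hS]] := @blt2 _ _ _ _ _ pr
      (fun x y => pi x p.1 ⊠ rho y p.2) (nrm p.1 * nrm p.2).
  - by move=> a x y; rewrite mtZl.
  - by move=> a x y; rewrite (repZ hp) hpairZl.
  - exact: mt_dense.
  - by rewrite mulr_ge0 // nrm_ge0.
  - exact: rt_bound.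
  - by exists S; split=> //; apply: bopI bS; rewrite // mulr_ge0 // nrm_ge0.
have [S /all_and2[bS hS]] := choice Sex.
have lS p := bop_lin (bS p).
have S_dot p p' z z' : dot (S p z) (S p' z') = dot (p.1 ⊠ p.2) (S p' (star z ** z')).
  have b1 u : bounded_op (fun z' => dot u (S p' z') : R[i]^o).
    exact: (bop_comp (dot_bop u) (bS p')).
  have h0 x y z1 : dot (pi x p.1 ⊠ rho y p.2) (S p' z1) =
      dot (p.1 ⊠ p.2) (S p' (star (pr x y) ** z1)).
    move: z1; apply: (dense_ind (mt_dense M)); last first.
      move=> x' y'; rewrite mt_star mtM !hS !hpair_dot (repM hp) (repM hr).
      by rewrite -(rep_dot hp) -(rep_dot hr).
    apply: (@closed_sub_eq _ M R[i]^o); first exact: b1.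
    exact: (bop_comp (b1 _) (sm_bop_r _)).
  have h1 z1 : dot (S p' z') (S p z1) = Num.conj (dot (p.1 ⊠ p.2) (S p' (star z1 ** z'))).
    move: z1; apply: (dense_ind (mt_dense M)); last first.
      by move=> x y; rewrite -h0 hS -dotC.
    apply: (@closed_sub_eq _ M R[i]^o).
      exact: (bop_comp (dot_bop _) (bS p)).
    have := conj_bop (f := fun z => dot (p.1 ⊠ p.2) (S p' (z ** z'))).
    apply; exact: (bop_comp (b1 _) (sm_bop_l _)).
  by rewrite dotC h1 conjCK.
have S_adj p p' z : dot (S p z) (p'.1 ⊠ p'.2) = dot (p.1 ⊠ p.2) (S p' (star z)).
  have h1 : dot (p'.1 ⊠ p'.2) (S p z) = Num.conj (dot (p.1 ⊠ p.2) (S p' (star z))).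
    move: z; apply: (dense_ind (mt_dense M)); last first.
      move=> x y; rewrite mt_star !hS !hpair_dot -(rep_dot hp) -(rep_dot hr).
      by rewrite rmorphM /= -!dotC.
    apply: (@closed_sub_eq _ M R[i]^o); first exact: (bop_comp (dot_bop _) (bS p)).
    have := conj_bop (f := fun z => dot (p.1 ⊠ p.2) (S p' z)).
    apply; exact: (bop_comp (dot_bop _) (bS p')).
  by rewrite dotC h1 conjCK.
have SZ a v w z : S (a *: v, w) z = a *: S (v, w) z.
  move: z; apply: (dense_ind (mt_dense M)); last first.
    by move=> x y; rewrite !hS /= (linZ (bop_lin (rep_bopr hp x))) hpairZl.
  by apply: closed_sub_eq; [exact: bS|exact: bop_scale].
(* For [z'] of norm 1 and [g] with [g + g - g ** g = star z' ** z'], the Gram kernels of [S p z']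
   and of [p - S p g] add up to that of the vectors [p]. *)
have Sb z s : nrm (psum (fun v w => S (v, w) z) s) <= nrm z * nrm (psum (hpair T) s).
  have [z0|z0] := eqVneq (nrm z) 0.
    rewrite (nrm_eq0 z0) nrm0 mul0r /psum big1 ?nrm0 // => p _.
    by rewrite (lin0 (lS _)).
  have nz : 0 < nrm z by rewrite lt_def z0 nrm_ge0.
  have [z' z'E] : exists z', z' = rc (nrm z)^-1 *: z by eexists.
  have nz' : nrm z' = 1 by rewrite z'E nrmZ cn_rc gtr0_norm ?invr_gt0 // mulVf.
  have [||g [sg ge]] := csqrt (h := star z' ** z').
  - by rewrite starM starK.
  - by rewrite nrm_starM nz' expr1n.
  have -> : psum (fun v w => S (v, w) z) s = rc (nrm z) *: psum (fun v w => S (v, w) z') s.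
    rewrite /psum scaler_sumr; apply: eq_bigr => p _.
    by rewrite z'E (linZ (lS _)) scalerA -rcM mulfV // (_ : rc 1 = 1) // scale1r.
  rewrite nrmZ cn_rc gtr0_norm // ler_pM2l //.
  apply: (gram_le (F := fun p => p.1 ⊠ p.2) (F' := fun p => S (p.1, p.2) z')
    (F'' := fun p => p.1 ⊠ p.2 - S (p.1, p.2) g)) => p q.
  rewrite S_dot !(dotBl, dotBr) S_dot (S_adj (p.1, p.2) (q.1, q.2)) /= sg -ge.
  by rewrite (linB (lS _)) (linD (lS _)) dotBr dotDr; ring.
have tauex z : exists U : T -> T, [/\ linear U, forall u, nrm (U u) <= nrm z * nrm u
    & forall v w, U (v ⊠ w) = S (v, w) z].
  apply: (blt2 (f := hpair T) (g := fun v w => S (v, w) z));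
    [by move=> a v w; rewrite hpairZl| |exact: hdense|exact: nrm_ge0|exact: Sb].
  by move=> a v w; exact: SZ.
have [tau /all_and3[ltau btau htau]] := choice tauex.
have bt z : bounded_op (tau z) by exact: bopI (ltau z) (nrm_ge0 z) (btau z).
have tdot z u u' : dot (tau z u) u' = dot u (tau (star z) u').
  have h1 v w u1 : dot (tau z (v ⊠ w)) u1 = dot (v ⊠ w) (tau (star z) u1).
    move: u1; apply: (dense_ind (hdense T)); last first.
      by move=> v' w'; rewrite !htau (S_adj (v, w) (v', w')).
    apply: (@closed_sub_eq _ T R[i]^o); first exact: dot_bop.
    exact: (bop_comp (dot_bop _) (bt _)).
  have h2 : dot u' (tau z u) = dot (tau (star z) u') u.
    move: u; apply: (dense_ind (hdense T)); last first.
      by move=> v w; rewrite dotC h1 -dotC.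
    apply: (@closed_sub_eq _ T R[i]^o); last exact: dot_bop.
    exact: (bop_comp (dot_bop _) (bt _)).
  by rewrite dotC h2 -dotC.
have tauE x y v w : tau (pr x y) (v ⊠ w) = pi x v ⊠ rho y w by rewrite htau hS.
exists tau; split=> //; split=> //.
- move=> a z z' u; move: u; apply: (dense_ind (hdense T)); last first.
    by move=> v w; rewrite !htau (linD (lS _)) (linZ (lS _)).
  by apply: closed_sub_eq; [exact: bt|exact: bop_lc].
- move=> z z' u; apply: hsep => v w.
  rewrite -[z in RHS]starK -tdot !htau.
  move: u; apply: (dense_ind (hdense T)); last first.
    by move=> v' w'; rewrite !htau S_dot starK.
  apply: (@closed_sub_eq _ T R[i]^o); first exact: (bop_comp (dot_bop _) (bt _)).
  exact: (bop_comp (dot_bop _) (bt _)).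
- pose P (u : T) := closure (range (psum tau)) u.
  have hP : closed_sub P by exact: closure_psum_closed.
  apply/seteqP; split=> // u _; move: u; apply: (dense_ind (hdense T)) => // v w.
  move: v; apply: (dense_ind (rep_dense hp)).
    exact: closed_sub_comp (hpair_bopl T w) hP.
  move=> x v; move: w; apply: (dense_ind (rep_dense hr)).
    exact: closed_sub_comp (hpair_bopr T _) hP.
  by move=> y w; rewrite -tauE; exact: closure_psum_in.
Qed.
End RepTen.

Section SwapTensor.
Context {R : realType}.

Lemma dense_swap (V : normedModType R[i]) (A B : Type) (f : A -> B -> V) :
  closure (range (psum f)) = setT -> closure (range (psum (fun b a => f a b))) = setT.
Proof.
move=> dn; apply/seteqP; split=> // x _; move: x.
apply: (dense_ind dn); first exact: closure_psum_closed.
by move=> a b; exact: (@closure_psum_in _ _ B A (fun b a => f a b) b a).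
Qed.

(** Exchanging the legs while keeping the carrier transports results on second-leg slices to the
    first leg. *)
Definition swap_hilbert (H K : hilbertType R) (T : hilbert_tensor H K) :
    hilbert_tensor K H.
Proof.
refine (@HilbertTensor R K H T (fun y x => hpair T x y) _ (dense_swap (hdense T))).
by move=> y y' x x'; rewrite hpair_dot mulrC.
Defined.

Definition swap_cstar (X Y : cstarType R) (M : min_tensor X Y) : min_tensor Y X.
Proof.
refine (@MinTensor R Y X M (fun y x => mt_pair M x y) (dense_swap (mt_dense M)) _).
have [H [K [T [pi [rho [tau [h1 h2 h3 e]]]]]]] := mt_spatial M.
by exists K, H, (swap_hilbert T), rho, pi, tau; split=> // y x w v; exact: e.
Defined.

End SwapTensor.

Section Calculus.
Context {R : realType} {t : tensor_models R}.

Lemma vten_dense (H K : hilbertType R) : closure (range (psum (@vten R t H K))) = setT.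
Proof. exact: hdense. Qed.

Lemma aten_dense (X Y : cstarType R) : closure (range (psum (@aten R t X Y))) = setT.
Proof. exact: mt_dense. Qed.

Lemma vten_ext (H K : hilbertType R) (W : normedModType R[i]) (S S' : hten t H K -> W) :
  bounded_op S -> bounded_op S' -> (forall x y, S (vten x y) = S' (vten x y)) -> S = S'.
Proof. by move=> b b'; exact: bop_ext (@vten_dense H K). Qed.

Lemma vten_dot (H K : hilbertType R) (x x' : H) (y y' : K) :
  dot (vten (t := t) x y) (vten x' y') = dot x x' * dot y y'.
Proof. exact: hpair_dot. Qed.

Lemma vten_sep (H K : hilbertType R) (u v : hten t H K) :
  (forall x y, dot (vten x y) u = dot (vten x y) v) -> u = v.
Proof. exact: hsep. Qed.

Lemma vten_nrm (H K : hilbertType R) (x : H) (y : K) :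
  nrm (vten (t := t) x y) = nrm x * nrm y.
Proof. exact: hpair_nrm. Qed.

Lemma atenM (X Y : cstarType R) (x x' : X) (y y' : Y) :
  aten (t := t) x y ** aten x' y' = aten (x ** x') (y ** y').
Proof. exact: mtM. Qed.

Lemma aten_star (X Y : cstarType R) (x : X) (y : Y) :
  star (aten (t := t) x y) = aten (star x) (star y).
Proof. exact: mt_star. Qed.

Lemma op_tenP (H K H' K' : hilbertType R) (S : H -> H') (T : K -> K')
    (U : hten t H K -> hten t H' K') :
  bounded_op U -> (forall x y, U (vten x y) = vten (S x) (T y)) -> op_ten S T = U.
Proof.
move=> bU hU; rewrite /op_ten; case: xgetP => [U' _ [bU' hU']|/(_ U)]; last by case.
by apply: vten_ext => // x y; rewrite hU' hU.
Qed.

Lemma hflip_spec (H K : hilbertType R) : bounded_op (hflip (t := t) (H := H) (K := K)) /\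
  forall x y, hflip (t := t) (vten x y) = vten (H := K) (K := H) y x.
Proof.
rewrite /hflip; case: xgetP => [U _ //|].
have [||||s|U [lU bU hU]] := @blt2 _ _ _ _ _ (hpair (hilbert_model t H K))
    (fun x y => hpair (hilbert_model t K H) y x) 1.
- by move=> a x y; rewrite hpairZl.
- by move=> a x y; rewrite hpairZr.
- exact: hdense.
- by [].
- rewrite mul1r /psum.
  apply: (gram_le (F := fun p => hpair (hilbert_model t H K) p.1 p.2)
    (F' := fun p => hpair (hilbert_model t K H) p.2 p.1) (F'' := fun=> 0 : H)) => p q.
  by rewrite dot0l addr0 !hpair_dot mulrC.
- by move=> /(_ U) []; split=> //; apply: bopI bU.
Qed.

Lemma hflip_bop (H K : hilbertType R) : bounded_op (hflip (t := t) (H := H) (K := K)).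
Proof. by case: (hflip_spec H K). Qed.
Lemma hflipE (H K : hilbertType R) (x : H) (y : K) : hflip (t := t) (vten x y) = vten y x.
Proof. by case: (hflip_spec H K). Qed.
Lemma hflipK (H K : hilbertType R) (u : hten t H K) : hflip (hflip u) = u.
Proof.
move: u; apply: (dense_ind (@vten_dense _ _)) => [|x y].
  by apply: closed_sub_eq; [exact: (bop_comp (hflip_bop _ _) (hflip_bop _ _))|exact: bop_id].
by rewrite !hflipE.
Qed.
Lemma hflip_dot (H K : hilbertType R) (u v : hten t H K) :
  dot (hflip u) (hflip v) = dot u v.
Proof.
have bf := hflip_bop H K.
have h x y : dot (hflip u) (vten y x) = dot u (vten (t := t) x y).
  rewrite dotC [RHS]dotC; congr Num.conj; move: u.
  apply: (dense_ind (@vten_dense _ _)) => [|x' y'].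
    by apply: (@closed_sub_eq _ (hten t H K) R[i]^o);
      [exact: (bop_comp (dot_bop _) bf)|exact: dot_bop].
  by rewrite hflipE !vten_dot mulrC.
move: v; apply: (dense_ind (@vten_dense _ _)) => [|x y]; last by rewrite hflipE h.
by apply: (@closed_sub_eq _ (hten t H K) R[i]^o);
  [exact: (bop_comp (dot_bop _) bf)|exact: dot_bop].
Qed.

Lemma hflip_nrm (H K : hilbertType R) (u : hten t H K) : nrm (hflip u) = nrm u.
Proof.
apply/eqP; rewrite -(@eqrXn2 _ 2) ?nrm_ge0 //; apply/eqP/rc_inj.
by rewrite -!dotxx hflip_dot.
Qed.

Section RepTenCalc.
Context {X Y : cstarType R} {H K : hilbertType R}.
Context (pi : X -> H -> H) (rho : Y -> K -> K).
Hypotheses (hp : rep pi) (hr : rep rho).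

Lemma rt_spec : rep (rep_ten (t := t) pi rho) /\ forall x y v w,
  rep_ten pi rho (aten (t := t) x y) (vten v w) = vten (pi x v) (rho y w).
Proof.
have [tau [ht he]] := rep_ten_ex (cstar_model t X Y) (hilbert_model t H K) hp hr.
have h : rep tau /\ forall x y, tau (aten x y) = op_ten (pi x) (rho y).
  split=> // x y; apply/esym/op_tenP; [exact: rep_bopr|exact: he].
rewrite /rep_ten; case: xgetP => [tau' _ [ht' he']|/(_ tau) //].
by split=> // x y v w; rewrite he' -h.2; exact: he.
Qed.

Lemma rt_rep : rep (rep_ten (t := t) pi rho). Proof. by case: rt_spec. Qed.
Lemma rtE x y v w : rep_ten (t := t) pi rho (aten x y) (vten v w) = vten (pi x v) (rho y w).
Proof. by case: rt_spec => _; apply. Qed.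

Lemma rt_uniq (tau : cten t X Y -> hten t H K -> hten t H K) : rep tau ->
  (forall x y v w, tau (aten x y) (vten v w) = vten (pi x v) (rho y w)) ->
  tau = rep_ten pi rho.
Proof.
move=> ht he; apply/funext => z; apply: vten_ext => [||v w].
- exact: rep_bopr.
- exact: rep_bopr rt_rep _.
- move: z; apply: (dense_ind (@aten_dense _ _)) => [|x y]; last by rewrite he rtE.
  apply: closed_sub_eq; [exact: rep_bopl ht _|exact: rep_bopl rt_rep _].
Qed.

End RepTenCalc.

Section SliceZero.
Context {X Y : cstarType R}.
Variable om : Y -> R[i].
Hypothesis hom : bounded_functional om.

Lemma slice0_spec : bounded_op (slice0 (t := t) (X := X) om) /\
  forall (x : X) (y : Y), slice0 om (aten (t := t) x y) = om y *: x.
Proof.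
rewrite /slice0; case: xgetP => [S _ //|].
have [lo [c c0 hc]] := (bounded_opP (om : Y -> R[i]^o)).1 hom.
have [S [lS bS hS]] := mt_slice_ex (cstar_model t X Y) lo c0 hc.
by move=> /(_ S) []; split=> //; exact: bopI bS.
Qed.

Lemma slice0_bop : bounded_op (slice0 (t := t) (X := X) om).
Proof. by case: slice0_spec. Qed.
Lemma slice0E (x : X) y : slice0 om (aten (t := t) x y) = om y *: x.
Proof. by case: slice0_spec. Qed.

End SliceZero.

Lemma bfun_comp (Y : cstarType R) (om : Y -> R[i]) (f : Y -> Y) :
  bounded_functional om -> bounded_op f -> bounded_functional (fun y => om (f y)).
Proof. by move=> ho bf; exact: (bop_comp (f := f) ho bf). Qed.

Lemma vec_bfun (Y : cstarType R) (K : hilbertType R) (rho : Y -> K -> K) (v w : K) :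
  rep rho -> bounded_functional (fun y => dot v (rho y w)).
Proof. by move=> hr; exact: (bop_comp (dot_bop v) (rep_bopl hr w)). Qed.

Lemma slice0_rep (X Y : cstarType R) (H K : hilbertType R) (pi : X -> H -> H)
    (rho : Y -> K -> K) (v w : K) (xi eta : H) (z : cten t X Y) : rep pi -> rep rho ->
  dot xi (pi (slice0 (fun y => dot v (rho y w)) z) eta) =
  dot (vten xi v) (rep_ten pi rho z (vten eta w)).
Proof.
move=> hp hr; have ho := vec_bfun v w hr.
move: z; apply: (dense_ind (@aten_dense _ _)) => [|x y].
  apply: (@closed_sub_eq _ (cten t X Y) R[i]^o).
    exact: (bop_comp (bop_comp (dot_bop xi) (rep_bopl hp eta)) (slice0_bop (X := X) ho)).
  exact: (bop_comp (dot_bop _) (rep_bopl (rt_rep hp hr) _)).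
by rewrite slice0E // (repZ hp) dotZr rtE // vten_dot mulrC.
Qed.

(** If [z] is in the kernel, its slices by vector functionals of [rho] vanish as [pi] is faithful;
    then the first-leg slice [U z] by a vector functional of [pi0] vanishes as [rho] is faithful;
    then so do the coefficients in the defining spatial representation. *)
Lemma rt_inj (X Y : cstarType R) (H K : hilbertType R) (pi : X -> H -> H)
    (rho : Y -> K -> K) : rep pi -> rep rho -> injective pi -> injective rho ->
  injective (rep_ten (t := t) pi rho).
Proof.
move=> hp hr ip ir.
suff h z : rep_ten (t := t) pi rho z = (fun=> 0) -> z = 0.
  move=> z z' e; apply/eqP; rewrite -subr_eq0; apply/eqP/h/funext => u.
  have := repD (rt_rep hp hr) z' (z - z') u; rewrite addrC subrK e.
  by move/eqP; rewrite -subr_eq0 opprD addrA subrr sub0r oppr_eq0 => /eqP.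
move=> hz; apply: (mt_eq (M := cstar_model t X Y)) => H0 K0 T0 pi0 rho0 tau0 h1 h2 h3 e v w.
apply: hsep => v' w'; rewrite (rep0 h3) dot0r.
have s0 om : slice0 (fun y => dot om.1 (rho y om.2)) z = 0.
  apply: ip; apply/funext => xi; rewrite (rep0 hp); apply: dot_eqP => eta.
  by rewrite (slice0_rep _ _ _ _ _ hp hr) hz !dot0r.
have ph := vec_bfun v' v h1.
have [lp [c c0 hc]] := (bounded_opP _).1 ph.
have [U [lU bU hU]] := mt_slice_ex (swap_cstar (cstar_model t X Y)) lp c0 hc.
have bU' : bounded_op (U : cten t X Y -> Y) by exact: bopI bU.
have {}hU x y : U (aten x y) = dot v' (pi0 x v) *: y by exact: hU.
have Uz : U z = 0.
  apply: ir; apply/funext => k; rewrite (rep0 hr); apply: dot_eqP => k'; rewrite dot0r.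
  have hk := vec_bfun k' k hr.
  have : dot v' (pi0 (slice0 (fun y => dot k' (rho y k)) z) v) = dot k' (rho (U z) k).
    move: z {hz s0}; apply: (dense_ind (@aten_dense _ _)) => [|x y]; last first.
      by rewrite slice0E // (repZ h1) dotZr hU (repZ hr) dotZr mulrC.
    apply: (@closed_sub_eq _ (cten t X Y) R[i]^o).
      exact: (bop_comp (bop_comp (dot_bop v') (rep_bopl h1 v)) (slice0_bop (X := X) hk)).
    exact: (bop_comp (bop_comp (dot_bop k') (rep_bopl hr k)) bU').
  by move=> <-; rewrite (s0 (k', k)) (rep0 h1) dot0r.
have : dot w' (rho0 (U z) w) = dot (hpair T0 v' w') (tau0 z (hpair T0 v w)).
  move: z {hz s0 Uz}; apply: (dense_ind (@aten_dense _ _)) => [|x y]; last first.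
    by rewrite hU (repZ h2) dotZr [aten x y]/(mt_pair _ x y) e hpair_dot.
  apply: (@closed_sub_eq _ (cten t X Y) R[i]^o).
    exact: (bop_comp (bop_comp (dot_bop w') (rep_bopl h2 w)) bU').
  exact: (bop_comp (dot_bop _) (rep_bopl h3 _)).
by move=> <-; rewrite Uz (rep0 h2) dot0r.
Qed.

End Calculus.

(** * Morphisms *)

Section MorBasics.
Context {R : realType} {t : tensor_models R}.

Section Mten.
Context {X Y : cstarType R}.
Implicit Types (m : multiplier X) (n : multiplier Y).

Lemma mtenE m n x y : mten (t := t) m n (aten x y) = aten (m x) (n y).
Proof.
have [k hk] := mt_ten_ex (t := t) (cstar_model t X Y) m n.
exact: (xgetPex 0 (ex_intro [set k : multiplier (cten t X Y) |
  forall x y, k (aten x y) = aten (m x) (n y)] k hk)).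
Qed.

Lemma mult_ext (k k' : multiplier (cten t X Y)) :
  (forall x y, k (aten x y) = k' (aten x y)) -> k = k'.
Proof.
move=> h; apply: meq => z; move: z; apply: (dense_ind (@aten_dense _ t X Y)) => //.
by apply: closed_sub_eq; exact: m_bop.
Qed.

Lemma mtenM m n m' n' : mten (t := t) m n ** mten m' n' = mten (m ** m') (n ** n').
Proof. by apply: mult_ext => x y; rewrite mE_mul !mtenE. Qed.

Lemma mten_star m n : star (mten (t := t) m n) = mten (star m) (star n).
Proof.
apply: mult_ext => x y; rewrite mtenE.
have h z : z ** star (mten m n) (aten (t := t) x y) = z ** aten (star m x) (star n y).
  move: z; apply: (dense_ind (@aten_dense _ t X Y)).
    by apply: closed_sub_eq; exact: sm_bop_l.
  move=> x' y'; rewrite -[aten x' y']starK -mstar_dot aten_star mtenE !aten_star !atenM.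
  by rewrite !mstar_dot !starK.
exact: smul_injr.
Qed.

End Mten.

Lemma csM_minj (Y : cstarType R) : closed_subspace (range (@minj R Y)).
Proof. by have [] := minj_cstar_subalgebra (setT_closed_star (X := Y)). Qed.

Lemma closed_span_sub (Y : cstarType R) (S C : set (multiplier Y)) :
  closed_subspace C -> S `<=` C -> closed_span S `<=` C.
Proof. by move=> hC hS m hm; apply: hm. Qed.

Lemma closed_span_in (Y : cstarType R) (S : set (multiplier Y)) : S `<=` closed_span S.
Proof. by move=> m Sm C [_]; apply. Qed.

Lemma closed_subspace_span (Y : cstarType R) (S : set (multiplier Y)) :
  closed_subspace (closed_span S).
Proof.
split=> [C [[]] //|a m n hm hn C hC|m hm C hC].
  have [[_ Cl _] _] := hC; apply: Cl; [exact: hm|exact: hn].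
have [[_ _ Cc] _] := hC; apply: Cc => e e0.
by have [n hn hn'] := hm e e0; exists n => //; exact: hn.
Qed.

Lemma minj_closed_subspace (Y : cstarType R) (P : Y -> Prop) :
  closed_sub P -> (forall (a : R[i]) x, P x -> P (a *: x)) ->
  closed_subspace (@minj R Y @` P).
Proof.
move=> [P0 PD Pc] PZ; have hm := @minj_star_hom R Y; split.
- by exists 0 => //; exact: (sh0 hm).
- move=> a _ _ [x Px <-] [y Py <-]; exists (a *: x + y); last exact: (sh_lin hm).
  by apply: PD => //; exact: PZ.
- exact: minj_mclosed.
Qed.

Lemma closure_psumZ (V : normedModType R[i]) (A : lmodType R[i]) (B : Type)
    (f : A -> B -> V) (a : R[i]) x :
  (forall (a : R[i]) x b, f (a *: x) b = a *: f x b) ->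
  closure (range (psum f)) x -> closure (range (psum f)) (a *: x).
Proof.
move=> fZ /nrm_closureP h; apply/nrm_closureP => e e0.
have [d d0 hd] := small_factor (cn_ge0 a) e0.
have [_ [s _ <-] hs] := h d d0; exists (a *: psum f s).
  have [k [hk _]] := psum_lc fZ fZ a s [::]; exists k => //.
  by rewrite hk [psum f [::]]big_nil addr0.
rewrite -scalerBr nrmZ; apply: le_trans hd; apply: ler_wpM2l => //; exact: cn_ge0.
Qed.

Section Mor.
Context {X Y : cstarType R} (f : X -> multiplier Y).

Lemma mor_dense : mor f -> closure (range (psum (fun x y => f x y))) = setT.
Proof.
move=> [hf hd]; pose P := closure (range (psum (fun x y => f x y))).
have fZ (a : R[i]) x y : f (a *: x) y = a *: f x y by rewrite (shZ hf).
apply/seteqP; split=> // y _.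
have : range (@minj R Y) (minj y) by exists y.
rewrite -hd => /closed_span_sub; move=> /(_ (@minj R Y @` P)) [].
- apply: minj_closed_subspace; first exact: closure_psum_closed.
  by move=> a z; exact: closure_psumZ.
- move=> _ [[_ _] [[x _ <-] [z _ <-]] <-] /=; exists (f x z); last by rewrite mul_minj.
  exact: closure_psum_in (fun x y => f x y) _ _.
- by move=> z Pz /minj_inj <-.
Qed.

Lemma morI : star_hom f -> closure (range (psum (fun x y => f x y))) = setT -> mor f.
Proof.
move=> hf dn; split=> //; apply/seteqP; split.
  apply: closed_span_sub; first exact: csM_minj.
  by move=> _ [[_ _] [[x _ <-] [z _ <-]] <-] /=; exists (f x z); rewrite ?mul_minj.
move=> _ [y _ <-]; move: y; apply: (dense_ind dn); last first.
  move=> x y; apply: closed_span_in; exists (f x, minj y); last by rewrite /= mul_minj.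
  by split=> /=; [exists x|exists y].
have [C0 Cl Cc] := closed_subspace_span [set p.1 ** p.2 | p in range f `*` range (@minj R Y)].
have hm := @minj_star_hom R Y.
split=> [|u v hu hv|u hu]; rewrite /closed_product.
- by rewrite (sh0 hm).
- by rewrite (shD hm) -[minj u]scale1r; exact: Cl.
- apply: Cc => _ /rc_pos[e e0 ->]; have [v hv huv] := hu e e0; exists (minj v) => // z.
  rewrite -mE_sub -(shB hm) -!nrmE -rcM rc_le.
  by apply: le_trans (nrmM _ _) _; apply: ler_wpM2r; rewrite ?nrm_ge0.
Qed.

Lemma mor_bopl (y : Y) : star_hom f -> bounded_op (fun x => f x y).
Proof.
move=> hf; apply: (bopI (C := nrm y)); [|exact: nrm_ge0|].
  by move=> a x x'; rewrite (sh_lin hf).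
by move=> x; rewrite mulrC; exact: star_hom_mbnd.
Qed.

Hypothesis hf : mor f.
Let hs : star_hom f. Proof. by case: hf. Qed.

(** An instance of [gram_multiplier_cstar], since [star (f x y) ** f x' y'] equals
    [star y ** f (star x ** x') y']. *)
Lemma ext_ex (m : multiplier X) : exists n : multiplier Y,
  (forall x y, n (f x y) = f (m x) y) /\ (forall x y, star n (f x y) = f (star m x) y).
Proof.
have key (m' : multiplier X) : exists L : Y -> Y,
    bounded_op L /\ forall x y, L (f x y) = f (m' x) y.
  have [c c0 hc] := mbound m'.
  have [||||s|L [lL bL hL]] := @blt2 _ _ _ _ _ (fun x y => f x y) (fun x y => f (m' x) y) c.
  - by move=> a x y; rewrite (shZ hs).
  - by move=> a x y; rewrite mleftZ (shZ hs).
  - exact: mor_dense.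
  - by [].
  - apply: (gram_multiplier_cstar t (F := fun x y => f x y)
      (G := fun y y' x => star y ** f x y')) => //.
    + by move=> a x y; rewrite (shZ hs).
    + by move=> y y' x x'; rewrite (shD hs) mE_add smulDr.
    + by move=> x x' y y'; rewrite mstar_dot -(sh_star hs) -mE_mul -(shM hs).
  - by exists L; split=> //; exact: bopI bL.
have [L [bL hL]] := key m; have [L' [bL' hL']] := key (star m).
have [|k [hk hk']] := mkmult (mor_dense hf) bL bL'.
  move=> x y x' y'; rewrite hL hL' !mstar_dot -!(sh_star hs) -!mE_mul -!(shM hs).
  by rewrite mstar_dot.
by exists k; split=> x y; rewrite ?hk ?hk' ?hL ?hL'.
Qed.

Lemma ext_spec (m : multiplier X) x : ext f m ** f x = f (m x).
Proof.
have [n [hn _]] := ext_ex m.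
apply: (xgetPex 0 (ex_intro [set n : multiplier Y |
  forall x, n ** f x = f (m x)] n _)) => x'.
by apply: meq => y; rewrite mE_mul hn.
Qed.

Lemma extE (m : multiplier X) x y : ext f m (f x y) = f (m x) y.
Proof. by rewrite -mE_mul ext_spec. Qed.

Lemma mor_ext (n n' : multiplier Y) : (forall x y, n (f x y) = n' (f x y)) -> n = n'.
Proof.
move=> h; apply: meq => z; move: z; apply: (dense_ind (mor_dense hf)) => //.
by apply: closed_sub_eq; exact: m_bop.
Qed.

Lemma ext_uniq (m : multiplier X) (n : multiplier Y) : (forall x y, n (f x y) = f (m x) y) -> ext f m = n.
Proof. by move=> h; apply: mor_ext => x y; rewrite extE h. Qed.

Lemma ext_star_hom : star_hom (ext f).
Proof.
split=> [a m n|m n|m].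
- apply: ext_uniq => x y; rewrite mE_add mE_scale !extE mE_add mE_scale.
  by rewrite (sh_lin hs) mE_add mE_scale.
- by apply: ext_uniq => x y; rewrite mE_mul !extE.
- have [n [hn hn']] := ext_ex m.
  by rewrite (ext_uniq hn); apply: ext_uniq.
Qed.

Lemma ext_minj x : ext f (minj x) = f x.
Proof. by apply: ext_uniq => x' y /=; rewrite (shM hs). Qed.

Lemma ext_one : ext f mone = mone.
Proof. exact: ext_uniq. Qed.

End Mor.

End MorBasics.

(** * Approximate units and nondegeneracy *)

Section ApproximateUnit.
Context {R : realType} (t : tensor_models R) {X : cstarType R}.

(* [1 - u = (1 - c s)^n] with [s = x x^* + y y^*] and a small [c > 0] *)
Lemma approx_unit (x y : X) (e : R) : 0 < e ->
  exists u, nrm (u ** x - x) <= e /\ nrm (u ** y - y) <= e.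
Proof.
move=> e0; have [H [pi [hp ip]]] := faithful_rep t X.
pose s := x ** star x + y ** star y.
pose c := (nrm s + 1)^-1.
have c0 : 0 < c by rewrite invr_gt0 ltr_wpDl // nrm_ge0.
have [s' s'E] : exists s', s' = rc c *: s by eexists.
have ss' : star s' = s' by rewrite s'E starZr starD !starM !starK.
have ns' : nrm s' <= 1.
  rewrite s'E nrmZ cn_rc gtr0_norm // mulrC /c ler_pdivrMr ?mul1r ?lerDl //.
  by rewrite ltr_wpDl // nrm_ge0.
pose re (v w : H) := complex.Re (dot v w).
have re_sq v : re v v = nrm v ^+ 2 by rewrite /re dotxx.
have reB v w w' : re v (w - w') = re v w - re v w' by rewrite /re dotBr raddfB.
have reBl v w w' : re (w - w') v = re w v - re w' v by rewrite /re dotBl raddfB.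
have s'x v : 0 <= re v (pi s' v) /\ c * nrm (pi (star x) v) ^+ 2 <= re v (pi s' v)
    /\ c * nrm (pi (star y) v) ^+ 2 <= re v (pi s' v).
  have -> : re v (pi s' v) = c * (nrm (pi (star x) v) ^+ 2 + nrm (pi (star y) v) ^+ 2).
    rewrite /re s'E (repZ hp) dotZr (repD hp) dotDr !(repM hp).
    by rewrite !(rep_dotr hp _ v) !dotxx -rcD -rcM.
  have := sqr_ge0 (nrm (pi (star x) v)); have := sqr_ge0 (nrm (pi (star y) v)).
  by set a := _ ^+ 2; set b := _ ^+ 2 => a0 b0; split; [|split]; nra.
have [T TE] : exists T, forall v, T v = v - pi s' v by exists (fun v => v - pi s' v).
have Tdot v w : re (T v) w = re v (T w).
  by rewrite !TE reBl reB /re (rep_dot hp) ss'.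
have T0 v : 0 <= re v (T v).
  rewrite TE reB re_sq subr_ge0; apply: le_trans (Re_le_cn _) _.
  apply: le_trans (cauchy_schwarz _ _) _; rewrite expr2; apply: ler_wpM2l; rewrite ?nrm_ge0 //.
  apply: le_trans (rep_nrm hp _ _) _; rewrite -[leRHS]mul1r; apply: ler_wpM2r => //.
  exact: nrm_ge0.
have TB v w : T (v - w) = T v - T w.
  by rewrite !TE (linB (bop_lin (rep_bopr hp s'))); zmod.
(* With [0 <= T <= 1], the quantities [F n v] are decreasing and their sum telescopes, so [n F n v]
   is at most the squared norm of [v]. This is the decay of [(1 - T) T^(2 n)] obtained without
   spectral theory. *)
pose a n v := iter n T v.
pose F n v := re (a n v) (a n v) - re (a n v) (a n.+1 v).
have Fdec n v : F n.+1 v + F n.+1 v <= re (a n v) (a n v) - re (a n.+1 v) (a n.+1 v)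
    /\ F n.+1 v <= F n v.
  rewrite /F /=; set b := a n v.
  have := sqr_ge0 (nrm (b - T b)); rewrite -re_sq reB !reBl.
  have := T0 (b - T b); rewrite TB reB !reBl.
  by rewrite -!(Tdot b) => h1 h2; split; lra.
have Fre n v : F n v = re (a n v) (pi s' (a n v)).
  by rewrite /F (_ : a n.+1 v = T (a n v)) // TE reB; ring.
have F0 n v : 0 <= F n v by rewrite Fre; have [] := s'x (a n v).
have Fn n v : n%:R * F n v <= nrm v ^+ 2 - re (a n v) (a n v).
  elim: n => [|n IH]; first by rewrite mul0r /= re_sq subrr.
  have [h1 h2] := Fdec n v; have h3 := F0 n.+1 v.
  have n0 : (0 : R) <= n%:R by [].
  have h4 : n%:R * F n.+1 v <= n%:R * F n v by exact: ler_wpM2l.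
  rewrite -natr1 mulrDl mul1r; move: IH h1 h3 h4; lra.
have ce : 0 < c * e ^+ 2 by rewrite mulr_gt0 // exprn_gt0.
have [N hN] := small_inv ce.
(* The recursion is [1 - u_{k+1} = (1 - s') (1 - u_k)], written inside the possibly nonunital
   [X]. *)
pose u := iter N.+1 (fun u => u + s' - s' ** u) 0.
have hu v : v - pi u v = a N.+1 v.
  rewrite /u /a; elim: N.+1 => [|k IH] /=; first by rewrite (rep0 hp) subr0.
  by rewrite -IH TE (repB hp) (repD hp) (repM hp) (linB (bop_lin (rep_bopr hp s'))); zmod.
exists (star u).
have key z : (forall v, c * nrm (pi (star z) v) ^+ 2 <= re v (pi s' v)) ->
    nrm (star u ** z - z) <= e.
  move=> hz; rewrite -nrm_star starB starM starK nrmC.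
  apply: (rep_inj_nrm hp) => // [|v]; first exact: ltW.
  have -> : pi (star z - star z ** u) v = pi (star z) (a N.+1 v).
    by rewrite -hu (linB (bop_lin (rep_bopr hp _))) -(repM hp) (repB hp).
  rewrite -(@ler_pXn2r _ 2) ?nnegrE ?mulr_ge0 ?nrm_ge0 ?(ltW e0) //.
  rewrite -(@ler_pM2l _ c) //; apply: le_trans (hz _) _.
  have -> : re (a N.+1 v) (pi s' (a N.+1 v)) = F N.+1 v.
    by rewrite Fre.
  have h1 := Fn N.+1 v; have h2 := hN N (leqnn N); have h3 := F0 N.+1 v.
  have h4 : N.+1%:R * F N.+1 v <= nrm v ^+ 2.
    by apply: le_trans h1 _; rewrite re_sq lerBlDr lerDl sqr_ge0.
  have N0 : (0 : R) < N.+1%:R by [].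
  apply: le_trans (_ : N.+1%:R^-1 * nrm v ^+ 2 <= _).
    by rewrite -(@ler_pM2l _ N.+1%:R) // mulrA mulfV ?gt_eqF // mul1r.
  by rewrite exprMn [c * _]mulrA; apply: ler_wpM2r; rewrite ?sqr_ge0 // (le_trans _ h2).
by split; apply: key => v; have [_ []] := s'x v.
Qed.

Lemma minj_mor : mor (@minj R X).
Proof.
apply: morI; first exact: minj_star_hom.
apply/seteqP; split=> // x _; apply/nrm_closureP => e e0.
have [u [hu _]] := approx_unit x x e0; exists (u ** x); last by rewrite nrmC.
by exists [:: (u, x)] => //; rewrite /psum big_seq1.
Qed.

Lemma surj_mor (Y : cstarType R) (j : Y -> X) : star_hom j ->
  (forall x, exists y, j y = x) -> mor (@minj R X \o j).
Proof.
move=> hj sj; apply: morI; first exact: (sh_comp hj (@minj_star_hom R X)).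
apply/seteqP; split=> // x _; apply/nrm_closureP => e e0.
have [u [hu _]] := approx_unit x x e0; have [y hy] := sj u.
exists (u ** x); last by rewrite nrmC.
by exists [:: (y, x)] => //; rewrite /psum big_seq1 /= hy.
Qed.

End ApproximateUnit.

Section MorComposition.
Context {R : realType} (t : tensor_models R).

Lemma mor_comp (X Y Z : cstarType R) (f : X -> multiplier Y) (g : Y -> multiplier Z) :
  mor f -> mor g -> mor (fun x => ext g (f x)).
Proof.
move=> hf hg; apply: morI.
  by apply: (sh_comp (f := f) (g := ext g)); [case: hf|exact: (ext_star_hom (t := t))].
set P := closure _; have hP : closed_sub P by exact: closure_psum_closed.
apply/seteqP; split=> // z _; move: z.
apply: (dense_ind (mor_dense hg)) => // y z; move: y.
apply: (dense_ind (mor_dense hf)) => [|x y].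
  by apply: closed_sub_comp hP; apply: mor_bopl; case: hg.
rewrite -(extE (t := t) hg); exact: (@closure_psum_in _ _ _ _ (fun x z => ext g (f x) z) x (g y z)).
Qed.

Lemma ext_comp (X Y Z : cstarType R) (f : X -> multiplier Y) (g : Y -> multiplier Z) m :
  mor f -> mor g -> ext g (ext f m) = ext (fun x => ext g (f x)) m.
Proof.
move=> hf hg; have hgf := mor_comp hf hg; have hg' := ext_star_hom (t := t) hg.
apply: esym; apply: (ext_uniq (t := t) hgf) => x z.
by rewrite -!mE_mul -!(shM hg') ext_spec.
Qed.

Lemma rep_mor (X Y : cstarType R) (H : hilbertType R) (f : X -> multiplier Y)
    (pi : Y -> H -> H) : mor f -> rep pi -> rep (fun x => rep_ext pi (f x)).
Proof.
move=> hf hp; have [hs _] := hf; split.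
- by move=> x; exact: rx_bop.
- by move=> a x y v; rewrite (sh_lin hs) rx_lc.
- by move=> x y v; rewrite (shM hs) rxM.
- by move=> x v w; rewrite rx_dot // (sh_star hs).
- change (closure (range (psum (fun x v => rep_ext pi (f x) v))) = setT).
  set P := closure _; have hP : closed_sub P by exact: closure_psum_closed.
  apply/seteqP; split=> // v _; move: v.
  apply: (dense_ind (rep_dense hp)) => // y v; move: y.
  apply: (dense_ind (mor_dense hf)) => [|x y].
    exact: (closed_sub_comp (rep_bopl hp v) hP).
  rewrite -rxE //; exact: (@closure_psum_in _ _ _ _ (fun x v => rep_ext pi (f x) v) x (pi y v)).
Qed.

Lemma rx_ext (X Y : cstarType R) (H : hilbertType R) (f : X -> multiplier Y)
    (pi : Y -> H -> H) m : mor f -> rep pi ->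
  rep_ext pi (ext f m) = rep_ext (fun x => rep_ext pi (f x)) m.
Proof.
move=> hf hp; apply: (rx_uniq (rep_mor hf hp)); first exact: rx_bop.
by move=> x v; rewrite -rxM // ext_spec.
Qed.

End MorComposition.

(** * Tensor products of morphisms *)

Section MorTen.
Context {R : realType} {t : tensor_models R}.

(** A faithful representation is isometric and so has closed range. This lets a relation
    [L v = pi x] be checked on a total set of [v]. *)
Lemma rep_range_closed (Z : cstarType R) (H : hilbertType R) (pi : Z -> H -> H)
    (V : normedModType R[i]) (L : V -> H -> H) (C : R) : rep pi -> injective pi ->
  0 <= C -> (forall u v w, L (u - v) w = L u w - L v w) ->
  (forall v w, nrm (L v w) <= C * nrm v * nrm w) ->
  closed_sub (fun v => exists x, forall w, L v w = pi x w).
Proof.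
move=> hp ip C0 LB Lb.
have L0 w : L 0 w = 0 by rewrite -(subrr 0) LB subrr.
have LN v w : L (- v) w = - L v w by rewrite -sub0r LB L0 sub0r.
have LD u v w : L (u + v) w = L u w + L v w by rewrite -[v]opprK LB LN !opprK.
split=> [|u v [x hx] [y hy]|u hu].
- by exists 0 => w; rewrite L0 (rep0 hp).
- by exists (x + y) => w; rewrite LD hx hy (repD hp).
have hs n : exists p : V * Z, (forall w, L p.1 w = pi p.2 w) /\ nrm (u - p.1) <= n.+1%:R^-1.
  have n0 : (0 : R) < n.+1%:R^-1 by rewrite invr_gt0.
  by have [v [x hx] hv] := hu _ n0; exists (v, x).
have [s /all_and2[hs1 hs2]] := choice hs.
have sb i j : nrm ((s i).2 - (s j).2) <= C * (i.+1%:R^-1 + j.+1%:R^-1).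
  have N0 k : (0 : R) <= k.+1%:R^-1 by rewrite invr_ge0.
  apply: (rep_inj_nrm hp) => // [|w]; first by rewrite mulr_ge0 // addr_ge0.
  rewrite (repB hp) -!hs1 -LB; apply: le_trans (Lb _ _) _.
  apply: ler_wpM2r; rewrite ?nrm_ge0 //; apply: ler_wpM2l => //.
  by apply: le_trans (nrm_tri _ u _) _; rewrite nrmC lerD ?hs2.
have [|x hx] := nrm_complete (u := fun n => (s n).2).
  move=> e e0; have [d d0 hd] := small_factor C0 e0.
  have d20 : 0 < d / 2 by rewrite divr_gt0.
  have [N hN] := small_inv d20; exists N => i j Ni Nj; apply: le_trans (sb i j) _.
  by apply: le_trans hd; apply: ler_wpM2l => //; rewrite [leRHS]splitr lerD // hN.
exists x => w; apply: nrm_eq => e e0.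
have K0 : 0 <= C * nrm w + nrm w by rewrite addr_ge0 ?mulr_ge0 ?nrm_ge0.
have [d d0 hd] := small_factor K0 e0.
have [N hN] := hx d d0; have [N' hN'] := small_inv d0; pose k := maxn N N'.
apply: le_trans (nrm_tri _ (L (s k).1 w) _) _.
apply: le_trans hd; rewrite mulrDl; apply: lerD.
  rewrite -LB; apply: le_trans (Lb _ _) _; rewrite mulrAC.
  apply: ler_wpM2l; first by rewrite mulr_ge0 // nrm_ge0.
  by apply: le_trans (hs2 k) _; apply: hN'; exact: leq_maxr.
rewrite hs1 -(repB hp); apply: le_trans (rep_nrm hp _ _) _; rewrite mulrC.
by apply: ler_wpM2l; rewrite ?nrm_ge0 //; apply: hN; exact: leq_maxl.
Qed.

Lemma rx_mten (X Y : cstarType R) (H K : hilbertType R) (pi : X -> H -> H)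
    (rho : Y -> K -> K) (m : multiplier X) (n : multiplier Y) v w :
  rep pi -> rep rho ->
  rep_ext (rep_ten pi rho) (mten (t := t) m n) (vten v w) =
  vten (rep_ext pi m v) (rep_ext rho n w).
Proof.
move=> hp hr; have ht := rt_rep (t := t) hp hr; move: v w.
have base x y v w : rep_ext (rep_ten pi rho) (mten (t := t) m n) (vten (pi x v) (rho y w)) =
  vten (rep_ext pi m (pi x v)) (rep_ext rho n (rho y w)).
  by rewrite -rtE // rxE // mtenE rtE // !rxE.
move=> v; apply: (dense_ind (rep_dense hr)) => [|y w].
  apply: closed_sub_eq; first exact: (bop_comp (rx_bop ht _) (hpair_bopr _ v)).
  exact: (bop_comp (hpair_bopr _ _) (rx_bop hr n)).
move: v; apply: (dense_ind (rep_dense hp)) => [|x v]; last exact: base.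
apply: closed_sub_eq; first exact: (bop_comp (rx_bop ht _) (hpair_bopl _ _)).
exact: (bop_comp (hpair_bopl _ _) (rx_bop hp m)).
Qed.

Section Existence.
Context {X Y X' Y' : cstarType R} (f : X -> multiplier X') (g : Y -> multiplier Y').
Hypotheses (hf : mor f) (hg : mor g).

(** Represent the target faithfully by [tau0] and let [tau] be the tensor product of the composed
    representations. On elementary tensors [tau z] maps the image of [tau0] into itself; this
    persists by [rep_range_closed], and [idealizer] turns [tau z] into a multiplier. *)
Lemma mor_ten_ex : exists F : cten t X Y -> multiplier (cten t X' Y'),
  mor F /\ forall x y, F (aten x y) = mten (f x) (g y).
Proof.
have [H [K [T [pi [rho [tau0 [[hp _] [hr _] [h0 i0] e0]]]]]]] := mt_spatial (cstar_model t X' Y').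
have [tau [ht he]] := rep_ten_ex (cstar_model t X Y) T (rep_mor hf hp) (rep_mor hg hr).
have base x y x' y' u : tau (aten x y) (tau0 (aten x' y') u) =
    tau0 (aten (f x x') (g y y')) u.
  move: u; apply: (dense_ind (hdense T)) => [|v w].
    apply: closed_sub_eq; last exact: rep_bopr.
    exact: (bop_comp (rep_bopr ht _) (rep_bopr h0 _)).
  by rewrite !e0 he !rxE.
have tauB z z' u : tau (z - z') u = tau z u - tau z' u by exact: repB.
have idl z t' : exists t'', forall u, tau z (tau0 t' u) = tau0 t'' u.
  move: z; apply: (dense_ind (@aten_dense _ t X Y)) => [|x y].
    apply: (rep_range_closed (L := fun z u => tau z (tau0 t' u)) (C := nrm t')) => //.
      exact: nrm_ge0.
    move=> z u; apply: le_trans (rep_nrm ht _ _) _; rewrite [_ * nrm z]mulrC -mulrA.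
    by apply: ler_wpM2l; rewrite ?nrm_ge0 //; exact: rep_nrm.
  move: t'; apply: (dense_ind (@aten_dense _ t X' Y')) => [|x' y']; last by eexists; exact: base.
  apply: (rep_range_closed (L := fun t' u => tau (aten x y) (tau0 t' u))
    (C := nrm (aten (t := t) x y))) => //; first exact: nrm_ge0.
    by move=> u v w; rewrite (repB h0) (linB (bop_lin (rep_bopr ht _))).
  move=> z u; apply: le_trans (rep_nrm ht _ _) _; rewrite -mulrA.
  by apply: ler_wpM2l; rewrite ?nrm_ge0 //; exact: rep_nrm.
have Fex z : exists m : multiplier (cten t X' Y'), rep_ext tau0 m = tau z.
  apply: (idealizer h0 (T' := tau (star z))) => //; first exact: rep_bopr.
  exact: rep_dot.
have [F hF] := choice Fex.
have Ftau z t' u : tau0 (F z t') u = tau z (tau0 t' u) by rewrite -rxE // hF.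
have hFs : star_hom F.
  split=> [a z z'|z z'|z]; apply: (rx_inj h0) => // u.
  - by rewrite rx_lc // !hF (repD ht) (repZ ht).
  - by rewrite rxM // !hF (repM ht).
  - by apply: dot_eqP => v; rewrite -(rx_dot h0) !hF (rep_dot ht).
have FE x y : F (aten x y) = mten (f x) (g y).
  apply: mult_ext => x' y'; apply: i0; apply/funext => u.
  by rewrite Ftau base mtenE.
exists F; split=> //; apply: morI => //.
set P := closure _; have hP : closed_sub P by exact: closure_psum_closed.
apply/seteqP; split=> // z _; move: z.
apply: (dense_ind (@aten_dense _ t X' Y')) => // x' y'; move: x'.
apply: (dense_ind (mor_dense hf)) => [|x x'].
  exact: (closed_sub_comp (mt_bopl (cstar_model t X' Y') y') hP).
move: y'; apply: (dense_ind (mor_dense hg)) => [|y y'].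
  exact: (closed_sub_comp (mt_bopr (cstar_model t X' Y') _) hP).
rewrite -mtenE -FE.
exact: (@closure_psum_in _ _ _ _ (fun z z' => F z z') (aten x y) (aten x' y')).
Qed.

Lemma mor_ten_spec : mor (mor_ten (t := t) f g) /\
  forall x y, mor_ten (t := t) f g (aten x y) = mten (f x) (g y).
Proof.
rewrite /mor_ten; case: xgetP => [F _ //|]; have [F hF] := mor_ten_ex.
by move=> /(_ F) [].
Qed.

Lemma mor_ten_mor : mor (mor_ten (t := t) f g). Proof. by case: mor_ten_spec. Qed.
Lemma mor_tenE x y : mor_ten f g (aten (t := t) x y) = mten (f x) (g y).
Proof. by case: mor_ten_spec. Qed.

Lemma mor_ten_uniq (F : cten t X Y -> multiplier (cten t X' Y')) : mor F ->
  (forall x y, F (aten x y) = mten (f x) (g y)) -> F = mor_ten f g.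
Proof.
move=> [hF _] FE; have [hm _] := mor_ten_mor.
apply/funext => z; apply: meq => u; move: z.
apply: (dense_ind (@aten_dense _ t X Y)) => [|x y]; last by rewrite FE mor_tenE.
by apply: closed_sub_eq; exact: mor_bopl.
Qed.

Lemma ext_mor_ten (m : multiplier X) (n : multiplier Y) :
  ext (mor_ten (t := t) f g) (mten m n) = mten (ext f m) (ext g n).
Proof.
apply: (ext_uniq (t := t) mor_ten_mor) => z u.
move: z; apply: (dense_ind (@aten_dense _ t X Y)) => [|x y].
  have [hm _] := mor_ten_mor.
  apply: closed_sub_eq; first exact: (bop_comp (m_bop _) (mor_bopl u hm)).
  exact: (bop_comp (mor_bopl u hm) (m_bop _)).
by rewrite -mE_mul mtenE !mor_tenE mtenM !(ext_spec (t := t)).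
Qed.

Lemma rt_mor_ten (H K : hilbertType R) (pi : X' -> H -> H) (rho : Y' -> K -> K) :
  rep pi -> rep rho ->
  (fun z => rep_ext (rep_ten (t := t) pi rho) (mor_ten f g z)) =
  rep_ten (fun x => rep_ext pi (f x)) (fun y => rep_ext rho (g y)).
Proof.
move=> hp hr; have ht := rt_rep (t := t) hp hr.
apply: rt_uniq; [exact: rep_mor|exact: rep_mor|exact: rep_mor mor_ten_mor _|].
by move=> x y v w; rewrite mor_tenE rx_mten.
Qed.

End Existence.

End MorTen.

(** * Slice maps *)

Section Slices.
Context {R : realType} {t : tensor_models R}.

Lemma mright_bop (X : cstarType R) (m : multiplier X) : bounded_op (mright m).
Proof.
have [c c0 hc] := mright_bound m; apply: (bopI (C := c)) => // a x y.
exact: mright_linear.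
Qed.

Lemma m_mright (X : cstarType R) (m k : multiplier X) z : m (mright k z) = mright k (m z).
Proof. by apply: smul_injl => u; rewrite -mleftM -!multiplierP mleftM. Qed.

Lemma mright_mten1 (X Y : cstarType R) (y : Y) (a : X) b :
  mright (mten (t := t) mone (minj y)) (aten a b) = aten a (b ** y).
Proof.
apply: smul_injl => u; rewrite -multiplierP; move: u.
apply: (dense_ind (@aten_dense _ t X Y)) => [|a' b']; last first.
  by rewrite mtenE !atenM /= smulA.
by apply: closed_sub_eq; [exact: (bop_comp (sm_bop_r _) (m_bop _))|exact: sm_bop_r].
Qed.

Lemma slice0_mright (X Y : cstarType R) (om : Y -> R[i]) (y : Y) (z : cten t X Y) :
  bounded_functional om ->
  slice0 om (mright (mten mone (minj y)) z) = slice0 (fun b => om (b ** y)) z.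
Proof.
move=> ho.
have ho' : bounded_functional (fun b => om (b ** y)).
  exact: (bfun_comp ho (sm_bop_l y)).
move: z; apply: (dense_ind (@aten_dense _ t X Y)) => [|a b].
  apply: closed_sub_eq; last exact: slice0_bop.
  exact: (bop_comp (slice0_bop ho) (mright_bop _)).
by rewrite mright_mten1 !slice0E.
Qed.

(** Shows that [slice] does not depend on the factorization of the functional. For [u] with [u y]
    near [y] and [u y'] near [y'], both sides are close to the slice of [m (x ⊗ u)] by the common
    functional. *)
Lemma slice0_factor (X Y : cstarType R) (om om' : Y -> R[i]) (y y' : Y)
    (m : multiplier (cten t X Y)) (x : X) :
  bounded_functional om -> bounded_functional om' ->
  (forall b, om (b ** y) = om' (b ** y')) ->
  slice0 om (m (aten x y)) = slice0 om' (m (aten x y')).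
Proof.
move=> ho ho' e.
have [A AE] : exists A, forall om1 z, A om1 z = slice0 om1 (m (aten x z)) by eexists.
have bA om1 : bounded_functional om1 -> bounded_op (A om1).
  move=> h1; have -> : A om1 = fun z => slice0 om1 (m (aten x z)) by apply/funext.
  apply: (bop_comp (slice0_bop (X := X) h1)).
  exact: (bop_comp (m_bop m) (mt_bopr (cstar_model t X Y) x)).
have /bounded_opP[lA [C C0 hC]] := bA _ ho; have /bounded_opP[lB [C' C0' hC']] := bA _ ho'.
have eu u : A om (u ** y) = A om' (u ** y').
  rewrite !AE -!mright_mten1 !m_mright !slice0_mright //.
  by congr (slice0 _ _); apply/funext.
rewrite -!AE; apply: nrm_eq => d d0.
have [d1 d10 hd] := small_factor (addr_ge0 C0 C0') d0.
have [u [hu hu']] := approx_unit t y y' d10.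
apply: le_trans hd; apply: le_trans (nrm_tri _ (A om (u ** y)) _) _.
rewrite [in X in _ + X]eu mulrDl -(linB lA) -(linB lB); apply: lerD.
  by apply: le_trans (hC _) _; apply: ler_wpM2l; rewrite // nrmC.
by apply: le_trans (hC' _) _; apply: ler_wpM2l.
Qed.

Section VectorSlice.
Context {X Y : cstarType R} {K : hilbertType R} (sig : Y -> K -> K).
Hypothesis hs : rep sig.
Variables (y1 y2 : Y) (v w : K) (m : multiplier (cten t X Y)).

(** A vector functional with both vectors in the image of [sig]: [y2] is the factor required by
    [slice], and [y1] plays the same part for the right action of the sliced multiplier. *)
Definition vfun (a : Y) := dot (sig y1 v) (sig a (sig y2 w)).

Lemma vslice_ex : exists n : multiplier X, forall x,
  n x = slice0 (fun a => dot (sig y1 v) (sig a w)) (m (aten x y2)).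
Proof.
pose om a := dot (sig y1 v) (sig a w); pose om' a := dot (sig y2 w) (sig a v).
have [H [pi [hp ip]]] := faithful_rep t X.
have ht := rt_rep (t := t) hp hs.
have nP x x' : x ** slice0 om (m (aten x' y2)) =
    star (slice0 om' (star m (aten (star x) y1))) ** x'.
  apply: ip; apply/funext => eta; apply: dot_eqP => xi.
  rewrite /om /om' !(repM hp) (rep_dotr hp) (slice0_rep _ _ _ _ _ hp hs).
  rewrite -(rtE hp hs) -(rxE ht).
  rewrite -[RHS](rep_dot hp) [RHS]dotC (slice0_rep _ _ _ _ _ hp hs) -dotC.
  by rewrite -(rxE ht (star m)) rx_dot // starK (rtE hp hs x').
by exists (Multiplier nP).
Qed.

Lemma slice_vfun x :
  slice vfun m x = slice0 (fun a => dot (sig y1 v) (sig a w)) (m (aten x y2)).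
Proof.
have [n hn] := vslice_ex.
have ho := vec_bfun (sig y1 v) w hs.
have P : exists n : multiplier X, [set n : multiplier X |
    exists (om' : Y -> R[i]) (y' : Y),
    [/\ bounded_functional om', forall y, vfun y = om' (y ** y')
      & forall x, n x = slice0 om' (m (aten x y'))]] n.
  exists n; exists (fun a => dot (sig y1 v) (sig a w)), y2; split=> // y.
  by rewrite /vfun (repM hs).
have [om' [y' [ho' e ->]]] := xgetPex 0 P.
apply: slice0_factor => // b; rewrite -e /vfun -(repM hs) //.
Qed.

Lemma slice_rep (H : hilbertType R) (pi : X -> H -> H) (xi eta : H) : rep pi ->
  dot xi (rep_ext pi (slice vfun m) eta) =
  dot (vten xi (sig y1 v)) (rep_ext (rep_ten pi sig) m (vten eta (sig y2 w))).
Proof.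
move=> hp; have ht := rt_rep (t := t) hp hs.
move: eta; apply: (dense_ind (rep_dense hp)) => [|x eta].
  apply: (@closed_sub_eq _ H R[i]^o).
    exact: (bop_comp (dot_bop xi) (rx_bop hp _)).
  exact: (bop_comp (bop_comp (dot_bop _) (rx_bop ht _)) (hpair_bopl _ _)).
by rewrite rxE // slice_vfun (slice0_rep _ _ _ _ _ hp hs) -rxE // rtE.
Qed.

End VectorSlice.
End Slices.

(** * The Heisenberg relation in an arbitrary representation *)

Section Heisenberg.
Context {R : realType} {t : tensor_models R} (G : lcqg t).
Local Notation A := (qA G).
Local Notation Ad := (qAd G).
Local Notation H := (qH G).
Local Notation sig := (@qsig R t G).
Local Notation sigd := (@qsigd R t G).

Let hsig : rep sig := qsig_rep G.
Let hsigd : rep sigd := qsigd_rep G.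

(* [V_{pi sig}], [(sigd ⊗ pi) Deltad a] and [1 ⊗ sigd a]. *)
Definition Wp (K : hilbertType R) (pi : Ad -> K -> K) : hten t K H -> hten t K H :=
  rep_ext (rep_ten pi sig) (qV G).
Definition Dp (K : hilbertType R) (pi : Ad -> K -> K) a : hten t H K -> hten t H K :=
  rep_ext (rep_ten sigd pi) (qDeltad G a).
Definition Rp (K : hilbertType R) (pi : Ad -> K -> K) a : hten t K H -> hten t K H :=
  rep_ext (rep_ten pi sigd) (mten mone (minj a)).

Definition family := forall K : hilbertType R, (Ad -> K -> K) -> K -> hten t K H.

(* Families of operators [K -> K ⊗ H], natural in the representation [pi] of    *)
(* [qAd] on [K], which are norm limits of finite sums of [pi x ⊗ h].            *)
Definition natural (Phi : family) := forall e : R, 0 < e ->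
  exists s : seq (Ad * H), forall (K : hilbertType R) (pi : Ad -> K -> K) xi, rep pi ->
    nrm (Phi K pi xi - psum (fun x h => vten (pi x xi) h) s) <= e * nrm xi.

(** Slicing the second leg by [h] turns a finite sum into [pi (c s)] for one element [c s]. The norm
    of [c s - c r] is computed in the faithful representation [sigd], where both families agree, and
    bounds the difference in every other representation. *)
Lemma natural_transfer (Phi Psi : family) : natural Phi -> natural Psi ->
  (forall xi, Phi H sigd xi = Psi H sigd xi) ->
  forall (K : hilbertType R) (pi : Ad -> K -> K) xi, rep pi -> Phi K pi xi = Psi K pi xi.
Proof.
move=> hPhi hPsi e0 K pi xi hp; apply: vten_sep => eta h.
apply/eqP; rewrite -subr_eq0 -dotBr; apply/eqP/cn_eq0/le_anti; rewrite cn_ge0 andbT.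
apply/ler_addgt0Pr => e ep; rewrite add0r.
have n0 := nrm_ge0 (vten (t := t) eta h).
have K0 : 0 <= 4 * (nrm eta * nrm h * nrm xi) by rewrite !mulr_ge0 // ?nrm_ge0.
have [d d0 hd] := small_factor K0 ep.
have [s hs] := hPhi d d0; have [r hr] := hPsi d d0.
pose E (L : hilbertType R) (rho : Ad -> L -> L) z (s : seq (Ad * H)) :=
  psum (fun x h => vten (t := t) (rho x z) h) s.
pose c s := \sum_(p <- s) dot h p.2 *: p.1 : Ad.
have dotE (L : hilbertType R) (rho : Ad -> L -> L) z u s' : rep rho ->
    dot (vten u h) (E L rho z s') = dot u (rho (c s') z).
  move=> hrho; rewrite /E /psum (rep_sum hrho) !dot_sumr; apply: eq_bigr => p _.
  by rewrite vten_dot (repZ hrho) dotZr mulrC.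
have cb : nrm (c s - c r) <= 2 * d * nrm h.
  apply: (rep_inj_nrm hsigd (qsigd_inj (l := G))) => [|z].
    by rewrite !mulr_ge0 // ?nrm_ge0 // ltW.
  apply: nrm_dot_le => [|u]; first by rewrite !mulr_ge0 // ?nrm_ge0 // ltW.
  rewrite (repB hsigd) dotBr -!dotE // -dotBr.
  apply: le_trans (cauchy_schwarz _ _) _; rewrite vten_nrm.
  have hE : nrm (E H sigd z s - E H sigd z r) <= 2 * d * nrm z.
    apply: le_trans (nrm_tri _ (Phi H sigd z) _) _; rewrite nrmC {2}e0.
    by apply: le_trans (lerD (hs _ _ z hsigd) (hr _ _ z hsigd)) _; rewrite -mulrDl; nra.
  apply: le_trans (ler_wpM2l _ hE) _; first by rewrite mulr_ge0 // nrm_ge0.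
  by rewrite le_eqVlt; apply/orP; left; apply/eqP; ring.
have -> : Phi K pi xi - Psi K pi xi = (Phi K pi xi - E K pi xi s)
    - (Psi K pi xi - E K pi xi r) + (E K pi xi s - E K pi xi r) by zmod.
rewrite dotDr dotBr; apply: le_trans (cnD _ _) _; rewrite [X in _ + cn X]dotBr !dotE //.
rewrite -[X in _ + cn X]dotBr -(repB hp).
have h1 : cn (dot (vten eta h) (Phi K pi xi - E K pi xi s)) <= nrm eta * nrm h * (d * nrm xi).
  apply: le_trans (cauchy_schwarz _ _) _; rewrite vten_nrm; apply: ler_wpM2l; last exact: hs.
  by rewrite mulr_ge0 // nrm_ge0.
have h2 : cn (dot (vten eta h) (Psi K pi xi - E K pi xi r)) <= nrm eta * nrm h * (d * nrm xi).
  apply: le_trans (cauchy_schwarz _ _) _; rewrite vten_nrm; apply: ler_wpM2l; last exact: hr.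
  by rewrite mulr_ge0 // nrm_ge0.
have h3 : cn (dot eta (pi (c s - c r) xi)) <= nrm eta * (2 * d * nrm h * nrm xi).
  apply: le_trans (cauchy_schwarz _ _) _; apply: ler_wpM2l; rewrite ?nrm_ge0 //.
  by apply: le_trans (rep_nrm hp _ _) _; apply: ler_wpM2r; rewrite ?nrm_ge0.
have h4 := cnD (dot (vten eta h) (Phi K pi xi - E K pi xi s))
  (- dot (vten eta h) (Psi K pi xi - E K pi xi r)); rewrite cnN in h4.
apply: le_trans hd; apply: le_trans (lerD (le_trans h4 (lerD h1 h2)) h3) _.
by rewrite le_eqVlt; apply/orP; left; apply/eqP; ring.
Qed.

Lemma natural_elem x h : natural (fun K pi xi => vten (pi x xi) h).
Proof.
move=> e e0; exists [:: (x, h)] => K pi xi _.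
by rewrite /psum big_seq1 subrr nrm0 mulr_ge0 ?nrm_ge0 // ltW.
Qed.

Lemma natural_eq (Phi Psi : family) : (forall (K : hilbertType R) (pi : Ad -> K -> K) xi,
  rep pi -> Phi K pi xi = Psi K pi xi) -> natural Phi -> natural Psi.
Proof.
by move=> h hPhi e e0; have [s hs] := hPhi e e0; exists s => K pi xi hp; rewrite -h // hs.
Qed.

Lemma natural_closed (V : normedModType R[i]) (L : V -> family) (C : R) : 0 <= C ->
  (forall u v (K : hilbertType R) (pi : Ad -> K -> K) xi, rep pi ->
     L (u + v) K pi xi = L u K pi xi + L v K pi xi) ->
  (forall u (K : hilbertType R) (pi : Ad -> K -> K) xi, rep pi ->
     nrm (L u K pi xi) <= C * nrm u * nrm xi) ->
  closed_sub (fun u => natural (L u)).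
Proof.
move=> C0 LD Lb.
have LB u v (K : hilbertType R) (pi : Ad -> K -> K) xi : rep pi ->
    L u K pi xi = L v K pi xi + L (u - v) K pi xi.
  by move=> hp; rewrite -LD // addrC subrK.
split=> [e e0|u v hu hv e e0|u hu e e0].
- exists [::] => K pi xi hp; rewrite /psum big_nil subr0; apply: le_trans (Lb _ _ _ _ hp) _.
  by rewrite nrm0 mulr0 mul0r mulr_ge0 ?nrm_ge0 // ltW.
- have e20 : 0 < e / 2 by rewrite divr_gt0.
  have [s hs] := hu _ e20; have [r hr] := hv _ e20; exists (s ++ r) => K pi xi hp.
  rewrite LD // /psum big_cat /= opprD addrACA; apply: le_trans (nrmD _ _) _.
  by rewrite [e]splitr mulrDl lerD // ?hs ?hr.
- have e20 : 0 < e / 2 by rewrite divr_gt0.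
  have [d d0 hd] := small_factor C0 e20.
  have [v hv huv] := hu d d0; have [s hs] := hv _ e20; exists s => K pi xi hp.
  rewrite (LB u v) // addrAC; apply: le_trans (nrmD _ _) _.
  rewrite [e]splitr mulrDl lerD ?hs //; apply: le_trans (Lb _ _ _ _ hp) _.
  by apply: ler_wpM2r; rewrite ?nrm_ge0 //; apply: le_trans hd; apply: ler_wpM2l.
Qed.

(** A uniformly bounded natural operator may be applied to a natural family: each term of an
    approximating finite sum stays natural by hypothesis. *)
Lemma natural_map (L : forall K : hilbertType R, (Ad -> K -> K) -> hten t K H -> hten t K H)
    (Phi : family) :
  (forall (K : hilbertType R) (pi : Ad -> K -> K), rep pi -> linear (L K pi)) ->
  (exists2 C : R, 0 <= C & forall (K : hilbertType R) (pi : Ad -> K -> K) u, rep pi ->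
     nrm (L K pi u) <= C * nrm u) ->
  (forall x h, natural (fun K pi xi => L K pi (vten (pi x xi) h))) ->
  natural Phi -> natural (fun K pi xi => L K pi (Phi K pi xi)).
Proof.
move=> lL [C C0 hC] hL hPhi e e0.
have e20 : 0 < e / 2 by rewrite divr_gt0.
have [d d0 hd] := small_factor C0 e20.
have [s hs] := hPhi d d0.
have : natural (fun K pi xi => \sum_(p <- s) L K pi (vten (pi p.1 xi) p.2)).
  elim: s {hs} => [|p s IH] c c0.
    exists [::] => K pi xi _; rewrite /psum !big_nil subrr nrm0.
    by rewrite mulr_ge0 ?nrm_ge0 // ltW.
  have c20 : 0 < c / 2 by rewrite divr_gt0.
  have [r hr] := hL p.1 p.2 _ c20; have [r' hr'] := IH _ c20.
  exists (r ++ r') => K pi xi hp.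
  rewrite big_cons /psum big_cat /= opprD addrACA; apply: le_trans (nrmD _ _) _.
  by rewrite [c]splitr mulrDl lerD ?hr ?hr'.
move=> /(_ _ e20)[r hr]; exists r => K pi xi hp.
apply: le_trans (nrm_tri _ (L K pi (psum (fun x h => vten (pi x xi) h) s)) _) _.
rewrite [e]splitr mulrDl; apply: lerD.
  rewrite -(linB (lL K pi hp)); apply: le_trans (hC _ _ _ hp) _.
  apply: le_trans (ler_wpM2l C0 (hs _ _ _ hp)) _; rewrite mulrA.
  by apply: ler_wpM2r; rewrite ?nrm_ge0.
by rewrite /psum (lin_sum (lL K pi hp)); exact: hr.
Qed.

Lemma V_isom : star (qV G) ** qV G = mone. Proof. by case: (qV_unitary G). Qed.
Lemma V_coisom : qV G ** star (qV G) = mone. Proof. by case: (qV_unitary G). Qed.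

Section Wp.
Context {K : hilbertType R} (pi : Ad -> K -> K).
Hypothesis hp : rep pi.

Definition Wps : hten t K H -> hten t K H := rep_ext (rep_ten pi sig) (star (qV G)).
Let ht := rt_rep (t := t) hp hsig.
Lemma Wp_bop : bounded_op (Wp pi). Proof. exact: rx_bop. Qed.
Lemma Wps_bop : bounded_op Wps. Proof. exact: rx_bop. Qed.
Lemma WpsK u : Wps (Wp pi u) = u.
Proof. by rewrite /Wps /Wp -rxM // V_isom rx_one. Qed.
Lemma WpK u : Wp pi (Wps u) = u.
Proof. by rewrite /Wps /Wp -rxM // V_coisom rx_one. Qed.
Lemma Wp_dot u v : dot (Wp pi u) v = dot u (Wps v).
Proof. by rewrite /Wps /Wp rx_dot. Qed.
Lemma Wp_nrm u : nrm (Wp pi u) = nrm u.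
Proof.
apply/eqP; rewrite -(@eqrXn2 _ 2) ?nrm_ge0 //; apply/eqP/rc_inj.
by rewrite -!dotxx Wp_dot WpsK.
Qed.
Lemma Rp_bop a : bounded_op (Rp pi a). Proof. exact: (rx_bop (rt_rep hp hsigd)). Qed.
Lemma RpE a xi h : Rp pi a (vten xi h) = vten xi (sigd a h).
Proof. by rewrite /Rp rx_mten // rx_one // rx_minj. Qed.
Lemma Rp_nrm a u : nrm (Rp pi a u) <= nrm a * nrm u.
Proof.
have h0 : star_hom (fun a => mten (t := t) (X := Ad) (Y := Ad) mone (minj a)).
  have hm := @minj_star_hom R Ad.
  split=> [c x y|x y|x].
  - apply: mult_ext => z z'; rewrite mE_add mE_scale !mtenE (sh_lin hm) mE_add mE_scale.
    by rewrite /aten mtDr mtZr.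
  - by rewrite mtenM (shM hm) mone_mul.
  - by rewrite mten_star star_mone (sh_star hm).
apply: (rx_bnd (rt_rep hp hsigd)); first exact: nrm_ge0.
exact: (star_hom_mbnd a h0).
Qed.
Lemma Dp_bop a : bounded_op (Dp pi a). Proof. exact: (rx_bop (rt_rep hsigd hp)). Qed.
End Wp.

Lemma Wp_sigd : Wp sigd = @qW R t G. Proof. exact: qVE. Qed.

Lemma Dp_sigd a u : Dp sigd a u = hflip (adj (@qW R t G) (Rp sigd a (@qW R t G (hflip u)))).
Proof.
have e : op_ten id (sigd a) = Rp sigd a.
  by apply: op_tenP; [exact: Rp_bop|move=> x y; rewrite RpE].
by rewrite /Dp qDeltadE /= e.
Qed.

Lemma natural_rtl z w : natural (fun K pi xi => rep_ten pi sig z (vten xi w)).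
Proof.
move: z; apply: (dense_ind (@aten_dense _ t Ad A)) => [|x y].
  apply: (natural_closed (C := nrm w)); first exact: nrm_ge0.
    by move=> u v K pi xi hp; rewrite (repD (rt_rep hp hsig)).
  move=> u K pi xi hp; apply: le_trans (rep_nrm (rt_rep hp hsig) _ _) _.
  by rewrite vten_nrm le_eqVlt; apply/orP; left; apply/eqP; ring.
apply: natural_eq (natural_elem x (sig y w)) => K pi xi hp.
by rewrite rtE.
Qed.

(** For [h = sig y w] the vector is the image of [xi ⊗ w] under [V (x ⊗ y)], an element of the
    tensor product itself and thus a limit of finite sums. *)
Lemma natural_Wp x h : natural (fun K pi xi => Wp pi (vten (pi x xi) h)).
Proof.
move: h; apply: (dense_ind (rep_dense hsig)) => [|y w].
  apply: (natural_closed (C := nrm x)); first exact: nrm_ge0.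
    by move=> u v K pi xi hp; rewrite /vten hpairDr (linD (bop_lin (Wp_bop hp))).
  move=> u K pi xi hp; rewrite Wp_nrm // vten_nrm mulrAC.
  by apply: ler_wpM2r; rewrite ?nrm_ge0 //; exact: rep_nrm.
apply: natural_eq (natural_rtl (qV G (aten x y)) w) => K pi xi hp.
by rewrite /Wp -rtE // rxE //; exact: rt_rep.
Qed.

Lemma natural_rtr z w : natural (fun K pi xi => hflip (rep_ten sigd pi z (vten w xi))).
Proof.
move: z; apply: (dense_ind (@aten_dense _ t Ad Ad)) => [|x y].
  apply: (natural_closed (C := nrm w)); first exact: nrm_ge0.
    move=> u v K pi xi hp; rewrite (repD (rt_rep hsigd hp)).
    exact: linD (bop_lin (hflip_bop _ _)) _ _.
  move=> u K pi xi hp; rewrite hflip_nrm.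
  apply: le_trans (rep_nrm (rt_rep hsigd hp) _ _) _.
  by rewrite vten_nrm le_eqVlt; apply/orP; left; apply/eqP; ring.
apply: natural_eq (natural_elem y (sigd x w)) => K pi xi hp.
by rewrite rtE // hflipE.
Qed.

Lemma natural_Dp a x h : natural (fun K pi xi => hflip (Dp pi a (vten h (pi x xi)))).
Proof.
have [c c0 hc] := mbound (qDeltad G a).
move: h; apply: (dense_ind (rep_dense hsigd)) => [|y w].
  apply: (natural_closed (C := c * nrm x)); first by rewrite mulr_ge0 // nrm_ge0.
    move=> u v K pi xi hp; rewrite /vten hpairDl (linD (bop_lin (Dp_bop hp a))).
    exact: linD (bop_lin (hflip_bop _ _)) _ _.
  move=> u K pi xi hp; rewrite hflip_nrm.
  apply: le_trans (rx_bnd (rt_rep hsigd hp) _ c0 hc) _; rewrite vten_nrm -!mulrA.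
  apply: ler_wpM2l => //; rewrite mulrCA; apply: ler_wpM2l; rewrite ?nrm_ge0 //.
  exact: rep_nrm.
apply: natural_eq (natural_rtr (qDeltad G a (aten y x)) w) => K pi xi hp.
by rewrite /Dp -rtE // rxE //; exact: rt_rep.
Qed.

(* [V_{pi sig}] implements the comultiplication: by the definition of [Deltad]  *)
(* for [pi = sigd], hence for all [pi] by naturality.                           *)
Lemma heisenberg (K : hilbertType R) (pi : Ad -> K -> K) a u : rep pi ->
  Wp pi (hflip (Dp pi a (hflip u))) = Rp pi a (Wp pi u).
Proof.
move=> hp; have bf := hflip_bop (t := t).
have key x h xi : Wp pi (hflip (Dp pi a (hflip (vten (pi x xi) h)))) =
    Rp pi a (Wp pi (vten (pi x xi) h)).
  rewrite hflipE.
  apply: (@natural_transfer (fun K pi xi => Wp pi (hflip (Dp pi a (vten h (pi x xi)))))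
    (fun K pi xi => Rp pi a (Wp pi (vten (pi x xi) h)))) => // [||z].
  - apply: (natural_map (L := fun K pi => Wp pi)); [by move=> L rho hr; exact: bop_lin (Wp_bop hr)| | |].
    + by exists 1 => // L rho v hr; rewrite Wp_nrm // mul1r.
    + exact: natural_Wp.
    + exact: natural_Dp.
  - apply: (natural_map (L := fun K pi => Rp pi a)); [by move=> L rho hr; exact: bop_lin (Rp_bop hr a)| | |].
    + by exists (nrm a); [exact: nrm_ge0|move=> L rho v hr; exact: Rp_nrm].
    + move=> y v; apply: natural_eq (natural_elem y (sigd a v)) => L rho eta hr.
      by rewrite RpE.
    + exact: natural_Wp.
  - rewrite Dp_sigd hflipK hflipE Wp_sigd.
    have [uW _] := qW_mu G; have [_ _ h1] := unitary_adj uW.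
    by rewrite h1.
have bL : bounded_op (fun u => Wp pi (hflip (Dp pi a (hflip u)))).
  exact: (bop_comp (Wp_bop hp) (bop_comp (bf _ _) (bop_comp (Dp_bop hp a) (bf _ _)))).
have bR : bounded_op (fun u => Rp pi a (Wp pi u)) := bop_comp (Rp_bop hp a) (Wp_bop hp).
move: u; apply: (dense_ind (@vten_dense _ t K H)) => [|eta h].
  exact: closed_sub_eq.
move: eta; apply: (dense_ind (rep_dense hp)) => [|x xi]; last exact: key.
by apply: closed_sub_eq; [exact: (bop_comp bL (hpair_bopl _ h))|exact: (bop_comp bR (hpair_bopl _ h))].
Qed.

End Heisenberg.

(** * Density of the slices of the bicharacter *)

Section NormalFunctionals.
Context {R : realType}.

Lemma nrm_lim (u : nat -> R[i]) (l : R[i]) :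
  (forall e : R, 0 < e -> exists N, forall n, (N <= n)%N -> cn (u n - l) <= e) ->
  lim ((u : nat -> R[i]^o) @ \oo) = l.
Proof.
move=> h; apply: cvg_lim; first exact: norm_hausdorff.
apply/cvgrPdist_lt => _ /rc_pos[e e0 ->].
have e20 : 0 < e / 2 by rewrite divr_gt0.
have [N hN] := h _ e20; exists N => // n /= Nn.
rewrite distrC -cnE rc_lt; apply: le_lt_trans (hN n Nn) _.
by rewrite ltr_pdivrMr // ltr_pMr // ltr1n.
Qed.

Lemma real_complete (u : nat -> R) :
  (forall e : R, 0 < e -> exists N, forall n m, (N <= n)%N -> (N <= m)%N ->
     `|u n - u m| <= e) ->
  exists l, forall e : R, 0 < e -> exists N, forall n, (N <= n)%N -> `|u n - l| <= e.
Proof.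
move=> cu; have : cauchy (u @ \oo).
  apply: cauchy_exP => e /= e0; have e20 : 0 < e / 2 by rewrite divr_gt0.
  have [N hN] := cu _ e20; exists (u N); exists N => // n /= Nn.
  rewrite -ball_normE /ball_ /=; apply: le_lt_trans (hN _ _ _ _) _ => //.
  by rewrite ltr_pdivrMr // ltr_pMr // ltr1n.
move=> /cauchy_cvg; rewrite cvg_ex => -[l hl]; exists l => e e0.
have /cvgrPdist_lt/(_ e e0)[N _ hN] := hl.
by exists N => n Nn; rewrite distrC ltW //; exact: hN.
Qed.

Lemma complex_complete (u : nat -> R[i]) :
  (forall e : R, 0 < e -> exists N, forall n m, (N <= n)%N -> (N <= m)%N ->
     cn (u n - u m) <= e) ->
  exists l, forall e : R, 0 < e -> exists N, forall n, (N <= n)%N -> cn (u n - l) <= e.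
Proof.
move=> cu.
have Rele (a : R[i]) : `|complex.Re a| <= cn a by rewrite -rc_le cnE normc_ge_Re.
have Imle (a : R[i]) : `|complex.Im a| <= cn a.
  case: a => x y; rewrite /cn normc_def /= -sqrtr_sqr ler_wsqrtr // lerDr sqr_ge0 //.
have [|x hx] := @real_complete (fun n => complex.Re (u n)).
  move=> e e0; have [N hN] := cu e e0; exists N => n m Nn Nm.
  by rewrite -raddfB; apply: le_trans (Rele _) _; exact: hN.
have [|y hy] := @real_complete (fun n => complex.Im (u n)).
  move=> e e0; have [N hN] := cu e e0; exists N => n m Nn Nm.
  by rewrite -raddfB; apply: le_trans (Imle _) _; exact: hN.
exists (Complex x y) => e e0; have e20 : 0 < e / 2 by rewrite divr_gt0.
have [N hN] := hx _ e20; have [N' hN'] := hy _ e20; exists (maxn N N') => n.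
rewrite geq_max => /andP[Nn Nn']; rewrite [e]splitr.
apply: le_trans (lerD (hN n Nn) (hN' n Nn')).
case: (u n) => p q; rewrite -[_ - _]/(Complex (p - x) (q - y)) [complex.Re _]/= [complex.Im _]/=.
move: (p - x) (q - y) => P Q.
rewrite /cn normc_def /= -(@ler_pXn2r _ 2) ?nnegrE ?sqrtr_ge0 ?addr_ge0 //.
rewrite sqr_sqrtr ?addr_ge0 ?sqr_ge0 // sqrrD !real_normK ?num_real // -subr_ge0.
rewrite [X in 0 <= X](_ : _ = `|P| * `|Q| *+ 2); last by ring.
by rewrite mulrn_wge0 // mulr_ge0.
Qed.

Lemma tail_small (a : nat -> R) (M : R) : (forall k, 0 <= a k) ->
  (forall n, \sum_(0 <= k < n) a k <= M) ->
  forall e, 0 < e -> exists N, forall n, (N <= n)%N -> \sum_(N <= k < n) a k <= e.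
Proof.
move=> a0 hM e e0; pose s n := \sum_(0 <= k < n) a k.
have hs : has_sup (range s).
  by split; [exists (s 0%N); exists 0%N|exists M => _ [n _ <-]; exact: hM].
have [_ [N _ <-] hN] := sup_adherent e0 hs; exists N => n Nn.
have : s n <= sup (range s) by apply: sup_upper_bound => //; exists n.
by rewrite /s (big_cat_nat (n := N)) //= -/(s N); lra.
Qed.

Context {H : hilbertType R}.

(** The index [N] depends on [mu] and [e] only, so one truncation approximates all coefficients of
    an operator at once, that is, in norm. *)
Lemma nf_sum_tail (mu : normal_functional H) (e : R) : 0 < e ->
  exists N, forall (f : H -> H -> R[i]) (C : R), 0 <= C ->
    (forall x y, cn (f x y) <= C * (nrm x * nrm y)) ->
    cn (nf_sum mu f - \sum_(0 <= k < N) f (nf_left mu k) (nf_right mu k)) <= e * C.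
Proof.
move=> e0; pose a k := nrm (nf_left mu k) ^+ 2 + nrm (nf_right mu k) ^+ 2.
have bnd (F : nat -> H) : (exists M : R[i], forall n, \sum_(k < n) `|F k| ^+ 2 <= M) ->
    exists M : R, forall n, \sum_(0 <= k < n) nrm (F k) ^+ 2 <= M.
  move=> [M hM]; exists (complex.Re M) => n; have := hM n.
  have -> : \sum_(k < n) `|F k| ^+ 2 = rc (\sum_(0 <= k < n) nrm (F k) ^+ 2).
    rewrite big_mkord (@big_morph _ _ (@rc R) 0 +%R 0 +%R (@rcD R) erefl); apply: eq_bigr => k _.
    by rewrite -nrmE expr2 -rcM.
  by rewrite lecE => /andP[].
have [M hM] := bnd _ (nf_leftP mu); have [M' hM'] := bnd _ (nf_rightP mu).
have tail : forall e, 0 < e -> exists N, forall n, (N <= n)%N -> \sum_(N <= k < n) a k <= e.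
  apply: (@tail_small a (M + M')) => [k|n]; first by rewrite addr_ge0 ?sqr_ge0.
  by rewrite big_split lerD.
have part (f : H -> H -> R[i]) (C : R) N n : 0 <= C ->
    (forall x y, cn (f x y) <= C * (nrm x * nrm y)) -> (N <= n)%N ->
    cn (\sum_(0 <= k < n) f (nf_left mu k) (nf_right mu k) -
        \sum_(0 <= k < N) f (nf_left mu k) (nf_right mu k)) <= C * \sum_(N <= k < n) a k.
  move=> C0 hf Nn; rewrite (big_cat_nat (n := N)) //= addrAC subrr add0r mulr_sumr.
  elim/big_rec2 : _ => [|k x y _ IH]; first by rewrite cn0.
  apply: le_trans (cnD _ _) _; apply: lerD => //; apply: le_trans (hf _ _) _.
  apply: ler_wpM2l => //; rewrite /a.
  have := sqr_ge0 (nrm (nf_left mu k) - nrm (nf_right mu k)).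
  have := sqr_ge0 (nrm (nf_left mu k)); have := sqr_ge0 (nrm (nf_right mu k)).
  by rewrite sqrrB; lra.
have [N hN] := tail e e0; exists N => f C C0 hf.
pose u n := \sum_(0 <= k < n) f (nf_left mu k) (nf_right mu k).
have [|l hl] := @complex_complete u.
  move=> d d0; have [d' d0' hd] := small_factor C0 d0.
  have d20 : 0 < d' / 2 by rewrite divr_gt0.
  have [N' hN'] := tail _ d20; exists N' => i j hi hj.
  rewrite -(subrKA (u N')); apply: le_trans (cnD _ _) _.
  rewrite -[cn (u N' - _)]cnN opprB; apply: le_trans hd.
  have hk k : (N' <= k)%N -> cn (u k - u N') <= C * (d' / 2).
    by move=> hk; apply: le_trans (part _ _ _ _ C0 hf hk) _; rewrite ler_wpM2l ?hN'.
  by apply: le_trans (lerD (hk _ hi) (hk _ hj)) _; lra.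
have -> : nf_sum mu f = l.
  rewrite /nf_sum; under eq_fun do rewrite -(big_mkord xpredT (fun k => f (nf_left mu k) (nf_right mu k))).
  exact: nrm_lim.
apply/ler_addgt0Pr => d d0; have [N' hN'] := hl d d0.
pose n := maxn N N'; rewrite -(subrKA (u n)); apply: le_trans (cnD _ _) _.
rewrite addrC; apply: lerD.
  apply: le_trans (part _ _ _ _ C0 hf (leq_maxl _ _)) _; rewrite mulrC.
  by apply: ler_wpM2r => //; apply: hN; exact: leq_maxl.
rewrite -cnN opprB; apply: hN'; exact: leq_maxr.
Qed.

Lemma vec_normal (v w : H) : exists mu : normal_functional H,
  forall T : H -> H, nf_app mu T = dot v (T w).
Proof.
pose F (x : H) k := if k is 0%N then x else 0.
have hF x : exists M : R[i], forall n, \sum_(k < n) `|F x k| ^+ 2 <= M.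
  exists (`|x| ^+ 2) => -[|n]; first by rewrite big_ord0 exprn_ge0.
  rewrite big_ord_recl /= big1 ?addr0 // => k _.
  by rewrite normr0 expr0n.
exists (NormalFunctional (hF v) (hF w)) => T.
rewrite /nf_app /nf_sum; apply: nrm_lim => e e0; exists 1%N => -[//|n] _.
rewrite big_ord_recl /= big1 ?addr0 ?subrr ?cn0 ?ltW // => k _.
by rewrite dot0l.
Qed.

End NormalFunctionals.

Section Density.
Context {R : realType} {t : tensor_models R} (G : lcqg t).
Local Notation A := (qA G).
Local Notation Ad := (qAd G).
Local Notation H := (qH G).
Local Notation sig := (@qsig R t G).
Local Notation sigd := (@qsigd R t G).
Local Notation W := (@qW R t G).

Let hsig : rep sig := qsig_rep G.
Let hsigd : rep sigd := qsigd_rep G.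
Let uW : unitary W. Proof. by case: (qW_mu G). Qed.

Lemma vfun_predual y1 y2 v w : @predual R t G (vfun sig y1 y2 v w).
Proof.
have [mu hmu] := vec_normal (sig y1 v) (sig y2 w).
by exists mu => a; rewrite hmu.
Qed.

Definition vcoef (l r : H) : H -> H -> R[i] :=
  fun xi eta => dot (vten (t := t) xi l) (W (vten eta r)).

(** Norm approximation, phrased for sesquilinear forms, of an operator by slices of [W] along
    vectors in the image of [sig]; these are the slices available in [A_*] with a factorization. *)
Definition approx_coef (ph : H -> H -> R[i]) := forall e : R, 0 < e ->
  exists s : seq ((A * H) * (A * H)), forall xi eta,
    cn (ph xi eta - \sum_(p <- s) vcoef (sig p.1.1 p.1.2) (sig p.2.1 p.2.2) xi eta)
      <= e * (nrm xi * nrm eta).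

Lemma approx_coef_closed (V : normedModType R[i]) (L : V -> H -> H -> R[i]) (C : R) :
  0 <= C -> (forall u v xi eta, L (u + v) xi eta = L u xi eta + L v xi eta) ->
  (forall u xi eta, cn (L u xi eta) <= C * nrm u * (nrm xi * nrm eta)) ->
  closed_sub (fun u => approx_coef (L u)).
Proof.
move=> C0 LD Lb.
have n0 (xi eta : H) : 0 <= nrm xi * nrm eta by rewrite mulr_ge0 // nrm_ge0.
split=> [e e0|u v hu hv e e0|u hu e e0].
- exists [::] => xi eta; rewrite big_nil subr0; apply: le_trans (Lb _ _ _) _.
  by rewrite nrm0 mulr0 mul0r mulr_ge0 // ltW.
- have e20 : 0 < e / 2 by rewrite divr_gt0.
  have [s hs] := hu _ e20; have [r hr] := hv _ e20; exists (s ++ r) => xi eta.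
  rewrite LD // big_cat /= opprD addrACA; apply: le_trans (cnD _ _) _.
  by rewrite [e]splitr mulrDl lerD // ?hs ?hr.
- have e20 : 0 < e / 2 by rewrite divr_gt0.
  have [d d0 hd] := small_factor C0 e20.
  have [v hv huv] := hu d d0; have [s hs] := hv _ e20; exists s => xi eta.
  rewrite -[u](subrK v) LD -addrA; apply: le_trans (cnD _ _) _.
  rewrite [e]splitr mulrDl lerD ?hs //; apply: le_trans (Lb _ _ _) _.
  by apply: ler_wpM2r => //; apply: le_trans hd; apply: ler_wpM2l.
Qed.

Lemma vcoef_bound l r xi eta : cn (vcoef l r xi eta) <= nrm l * nrm r * (nrm xi * nrm eta).
Proof.
apply: le_trans (cauchy_schwarz _ _) _; rewrite (unitary_nrm _ uW) !vten_nrm.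
by rewrite le_eqVlt; apply/orP; left; apply/eqP; ring.
Qed.

Lemma approx_vcoef l r : approx_coef (vcoef l r).
Proof.
have lW := bop_lin (unitary_bop uW).
move: l; apply: (dense_ind (rep_dense hsig)) => [|y1 v].
  apply: (approx_coef_closed (C := nrm r)) => [|u v xi eta|u xi eta].
  - exact: nrm_ge0.
  - by rewrite /vcoef /vten hpairDr dotDl.
  - by rewrite [nrm r * _]mulrC vcoef_bound.
move: r; apply: (dense_ind (rep_dense hsig)) => [|y2 w].
  apply: (approx_coef_closed (C := nrm (sig y1 v))) => [|u w xi eta|u xi eta].
  - exact: nrm_ge0.
  - by rewrite /vcoef /vten hpairDr (linD lW) dotDr.
  - exact: vcoef_bound.
move=> e e0; exists [:: ((y1, v), (y2, w))] => xi eta.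
by rewrite big_seq1 subrr cn0 mulr_ge0 ?(ltW e0) // mulr_ge0 ?nrm_ge0.
Qed.

Lemma approx_coef_sum (I : Type) (s : seq I) (ph : I -> H -> H -> R[i]) :
  (forall i, approx_coef (ph i)) -> approx_coef (fun xi eta => \sum_(i <- s) ph i xi eta).
Proof.
move=> h; elim: s => [|i s IH] e e0.
  exists [::] => xi eta; rewrite !big_nil subrr cn0 mulr_ge0 ?(ltW e0) //.
  by rewrite mulr_ge0 ?nrm_ge0.
have e20 : 0 < e / 2 by rewrite divr_gt0.
have [r hr] := h i _ e20; have [r' hr'] := IH _ e20; exists (r ++ r') => xi eta.
rewrite big_cons big_cat /= opprD addrACA; apply: le_trans (cnD _ _) _.
by rewrite [e]splitr mulrDl lerD ?hr ?hr'.
Qed.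

Lemma approx_coef_lim (ph : H -> H -> R[i]) : (forall e : R, 0 < e -> exists ph',
  approx_coef ph' /\ forall xi eta, cn (ph xi eta - ph' xi eta) <= e * (nrm xi * nrm eta)) ->
  approx_coef ph.
Proof.
move=> h e e0; have e20 : 0 < e / 2 by rewrite divr_gt0.
have [ph' [h1 h2]] := h _ e20; have [s hs] := h1 _ e20; exists s => xi eta.
rewrite -(subrKA (ph' xi eta)); apply: le_trans (cnD _ _) _.
by rewrite [e]splitr mulrDl lerD ?h2 ?hs.
Qed.

Lemma approx_rslice mu : approx_coef (fun xi eta => dot xi (rslice mu W eta)).
Proof.
(* Should the specification have no solution, [rslice] would be the zero operator, approximated by
   the empty sum. *)
rewrite /rslice; case: xgetP => [S _ [_ hS]|_]; last first.
  move=> e e0; exists [::] => xi eta; rewrite dot0r big_nil subrr cn0.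
  by rewrite mulr_ge0 ?(ltW e0) // mulr_ge0 ?nrm_ge0.
apply: approx_coef_lim => e e0; have [N hN] := nf_sum_tail mu e0.
exists (fun xi eta => \sum_(0 <= k < N) vcoef (nf_left mu k) (nf_right mu k) xi eta).
split; first by apply: approx_coef_sum => k; exact: approx_vcoef.
move=> xi eta; rewrite hS.
apply: (hN (fun l r => vcoef l r xi eta)) => [|x y]; first by rewrite mulr_ge0 // nrm_ge0.
by apply: le_trans (vcoef_bound _ _ _ _) _; rewrite mulrC.
Qed.

Lemma approx_sigd a : approx_coef (fun xi eta => dot xi (sigd a eta)).
Proof.
apply: approx_coef_lim => e e0.
have : range sigd (sigd a) by exists a.
rewrite qsigd_range => -[_ /(_ (rc e))]; rewrite rc_lt => /(_ e0)[_ [mu _ <-] hmu].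
exists (fun xi eta => dot xi (rslice mu W eta)); split; first exact: approx_rslice.
move=> xi eta; rewrite -dotBr; apply: le_trans (cauchy_schwarz _ _) _.
rewrite mulrCA; apply: ler_wpM2l; first exact: nrm_ge0.
by rewrite -rc_le rcM !nrmE; exact: hmu.
Qed.

(** The dual algebra is the closure of right slices of [W] by normal functionals. These are
    truncated to finitely many vectors, the vectors moved into the image of [sig], and the operator
    estimate brought back to multipliers by faithfulness of [sigd]. *)
Lemma slice_dense (a : Ad) (e : R) : 0 < e -> exists s : seq ((A * H) * (A * H)),
  mbnd (minj a - \sum_(p <- s) slice (vfun sig p.1.1 p.2.1 p.1.2 p.2.2) (qV G)) e.
Proof.
move=> e0; have [s hs] := approx_sigd a e0; exists s.
apply: (rx_isom hsigd (qsigd_inj (l := G))) => [|eta]; first exact: ltW.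
apply: nrm_dot_le => [|xi]; first by rewrite mulr_ge0 ?nrm_ge0 // ltW.
rewrite rxB // rx_minj // rx_sum // dotBr dot_sumr.
have -> : \sum_(p <- s) dot xi (rep_ext sigd (slice (vfun sig p.1.1 p.2.1 p.1.2 p.2.2) (qV G)) eta) =
    \sum_(p <- s) vcoef (sig p.1.1 p.1.2) (sig p.2.1 p.2.2) xi eta.
  by apply: eq_bigr => p _; rewrite (slice_rep hsig) // qVE.
by apply: le_trans (hs xi eta) _; rewrite -mulrA [nrm eta * _]mulrC.
Qed.

End Density.

(** * Graphs in the direct sum of two C*-algebras *)

Section ProductAlgebra.
Context {R : realType}.

Lemma prod_nrm (X Y : normedModType R[i]) (u : X * Y) :
  nrm u = Num.max (nrm u.1) (nrm u.2).
Proof.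
apply: rc_inj; rewrite nrmE ProdNormedZmodule.prod_normE -!nrmE /Order.max rc_lt.
by case: ifP.
Qed.

Lemma nrm_fst (X Y : normedModType R[i]) (u : X * Y) : nrm u.1 <= nrm u.
Proof. by rewrite prod_nrm le_max lexx. Qed.

Lemma nrm_snd (X Y : normedModType R[i]) (u : X * Y) : nrm u.2 <= nrm u.
Proof. by rewrite prod_nrm le_max lexx orbT. Qed.

Section Complete.
Context (X Y : completeNormedModType R[i]).

Lemma prod_complete (F : set_system ((X * Y)%type : normedModType R[i])) :
  ProperFilter F -> cauchy F -> cvg F.
Proof.
move=> FF cF.
have proj (Z : completeNormedModType R[i]) (p : X * Y -> Z) :
    (forall u v, nrm (p u - p v) <= nrm (u - v)) -> exists l : Z, p @ F --> l.
  move=> hp; suff /cauchy_cvg h : cauchy (p @ F) by exists (lim (p @ F)).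
  apply: cauchy_exP => _ /rc_pos[e e0 ->].
  have /cauchyP/(_ (rc e)) := cF; rewrite rc_lt => /(_ e0)[u hu].
  have hup : F [set v | ball (p u) (rc e) (p v)].
    apply: filterS hu => v; rewrite -!ball_normE /ball_ /= -!nrmE !rc_lt.
    exact: le_lt_trans.
  by exists (p u).
have [l hl] := proj X fst (fun u v => nrm_fst (u - v)).
have [r hr] := proj Y snd (fun u v => nrm_snd (u - v)).
have lF : F --> ((l, r) : ((X * Y)%type : normedModType R[i])).
  move=> P [[A B] /= [lA rB] AB].
  have FA : F [set u : X * Y | A u.1] := hl _ lA.
  have FB : F [set u : X * Y | B u.2] := hr _ rB.
  by apply: filterS (filterI FA FB) => -[a b] /= [Aa Bb]; apply: AB.
exact: cvgP lF.
Qed.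

HB.instance Definition _ := Uniform_isComplete.Build (X * Y)%type prod_complete.

End Complete.

Section Star.
Context (X Y : starAlgType R).

HB.instance Definition _ := isStarAlgebra.Build R (X * Y)%type
  (smul := fun u v => (u.1 ** v.1, u.2 ** v.2)) (star := fun u => (star u.1, star u.2))
  (fun u v w => congr2 pair (smulA u.1 v.1 w.1) (smulA u.2 v.2 w.2))
  (fun u v w => congr2 pair (smulDl u.1 v.1 w.1) (smulDl u.2 v.2 w.2))
  (fun u v w => congr2 pair (smulDr u.1 v.1 w.1) (smulDr u.2 v.2 w.2))
  (fun a u v => congr2 pair (smulZl a u.1 v.1) (smulZl a u.2 v.2))
  (fun a u v => congr2 pair (smulZr a u.1 v.1) (smulZr a u.2 v.2))
  (fun u v => congr2 pair (starD u.1 v.1) (starD u.2 v.2))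
  (fun a u => congr2 pair (starZ a u.1) (starZ a u.2))
  (fun u v => congr2 pair (starM u.1 v.1) (starM u.2 v.2))
  (fun u => etrans (congr2 pair (starK u.1) (starK u.2)) (esym (surjective_pairing u))).
End Star.
Section CStar.
Context (X Y : cstarType R).

Fact prod_norm_smul (u v : X * Y) : `|u ** v| <= `|u| * `|v|.
Proof.
rewrite -!nrmE -rcM rc_le prod_nrm ge_max.
by rewrite !(le_trans (nrmM _ _)) // ler_pM ?nrm_ge0 ?nrm_fst ?nrm_snd.
Qed.

Fact prod_norm_star (u : X * Y) : `|star u ** u| = `|u| ^+ 2.
Proof.
rewrite -!nrmE expr2 -rcM !prod_nrm /= !nrm_starM; congr rc.
case: (leP (nrm u.1) (nrm u.2)) => h.
  by rewrite max_r // ler_pM ?nrm_ge0.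
by rewrite max_l // ler_pM ?nrm_ge0 // ltW.
Qed.

HB.instance Definition _ := isCStar.Build R (X * Y)%type prod_norm_smul prod_norm_star.

End CStar.
End ProductAlgebra.

(** * G-products *)

Section OneProduct.
Context {R : realType} {t : tensor_models R} (G : lcqg t) (P : gproduct G).
Context (K : hilbertType R) (rho : P -> K -> K) (hrho : rep rho) (rhoI : injective rho).
Context (D : set (multiplier P)) (hD : landstad_algebra D).

Local Notation sig := (@qsig R t G).
Local Notation sigd := (@qsigd R t G).
Local Notation H := (@qH R t G).

Definition psir (a : qAd G) : K -> K := rep_ext rho (gpsi P a).

Lemma psir_rep : rep psir.
Proof. exact: rep_mor (gpsi_mor P) hrho. Qed.

Lemma Vpsi_rep : rep_ext (rep_ten rho sig) (Vpsi P) = Wp psir.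
Proof.
have mf := mor_ten_mor (t := t) (gpsi_mor P) (minj_mor t (X := qA G)).
have hs := @qsig_rep R t G.
rewrite /Vpsi (rx_ext t _ mf (rt_rep hrho hs)).
rewrite (rt_mor_ten (gpsi_mor P) (minj_mor t (X := qA G)) hrho hs).
rewrite /Wp; congr (rep_ext (rep_ten _ _) _).
by apply/funext => y; rewrite rx_minj.
Qed.

Lemma Vpsi_isom : star (Vpsi P) ** Vpsi P = mone.
Proof.
have mf := mor_ten_mor (t := t) (gpsi_mor P) (minj_mor t (X := qA G)).
have hf := ext_star_hom (t := t) mf.
by rewrite /Vpsi -(sh_star hf) -(shM hf) V_isom (ext_one (t := t) mf).
Qed.

Definition Am (d : multiplier P) : hten t K H -> hten t K H :=
  rep_ext (rep_ten rho sig) (mten d mone).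

Definition Ud (d : multiplier P) : hten t K H -> hten t K H :=
  rep_ext (rep_ten rho sig) (Vpsi P ** mten d mone ** star (Vpsi P)).

Lemma Ud_W d u : Ud d (Wp psir u) = Wp psir (Am d u).
Proof.
have hr := rt_rep (t := t) hrho (@qsig_rep R t G).
rewrite /Ud !rxM // -Vpsi_rep /Am; congr (rep_ext _ _ (rep_ext _ _ _)).
by rewrite -(rxM hr) Vpsi_isom rx_one.
Qed.

Lemma landstad_coef d y1 y2 v w xi eta :
  dot xi (rep_ext rho (landstad_action (vfun sig y1 y2 v w) d) eta) =
  dot (vten xi (sig y1 v)) (Ud d (vten eta (sig y2 w))).
Proof. exact: (slice_rep (@qsig_rep R t G)). Qed.

Definition betar (b : P) : hten t H K -> hten t H K :=
  rep_ext (rep_ten sigd rho) (gbeta b).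

(** The flipped image of [beta b], conjugated by [V_psi]. The conjugation separates the two factors
    of [psi a d] into different legs. *)
Definition Xop (b : P) (u : hten t K H) : hten t K H :=
  Wp psir (hflip (betar b (hflip (Wps psir u)))).

Let hsd := @qsigd_rep R t G.
Let hdr : rep (rep_ten (t := t) sigd rho). Proof. exact: rt_rep. Qed.
Let bmor : mor (@gbeta R t G P). Proof. by have [] := gbeta_action P. Qed.

Lemma Am_flip d (z : hten t K H) :
  hflip (rep_ext (rep_ten sigd rho) (mten mone d) (hflip z)) = Am d z.
Proof.
have hr := rt_rep (t := t) hrho (@qsig_rep R t G).
pose S z := hflip (rep_ext (rep_ten sigd rho) (mten mone d) (hflip z)) : hten t K H.
rewrite -/(S z); suff -> : S = Am d by [].
apply: vten_ext => [||x y].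
- apply: (@bop_comp _ _ _ _ hflip (fun z : hten t K H =>
    rep_ext (rep_ten sigd rho) (mten mone d) (hflip z)) (hflip_bop _ _)).
  exact: (@bop_comp _ _ _ _ (rep_ext (rep_ten sigd rho) (mten mone d)) hflip
    (rx_bop hdr _) (hflip_bop _ _)).
- exact: rx_bop.
have hs := @qsig_rep R t G.
by rewrite /S /Am hflipE !rx_mten // hflipE !rx_one.
Qed.

(** Since [beta] sends [psi a] to [(id ⊗ psi) Deltad a] and [d] to [1 ⊗ d], [heisenberg] moves the
    first factor to [1 ⊗ sigd a], and conjugating the second gives [Ud d]. *)
Lemma Xop_gen a d b u : D d -> minj b = gpsi P a ** d ->
  Xop b u = Rp psir a (Ud d u).
Proof.
have hp := psir_rep.
have [_ betaD _ _] := hD => Dd be.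
have eb : gbeta b = ext (mor_ten minj (gpsi P)) (qDeltad G a) ** mten mone d.
  rewrite -(ext_minj (t := t) bmor) be (shM (ext_star_hom (t := t) bmor)) (betaD d Dd).
  by rewrite gbeta_psi.
have eN z : betar b z =
    Dp psir a (rep_ext (rep_ten sigd rho) (mten mone d) z).
  rewrite /betar eb rxM // /Dp.
  rewrite (rx_ext t _ (mor_ten_mor (t := t) (minj_mor t (X := qAd G)) (gpsi_mor P)) hdr).
  rewrite (rt_mor_ten (minj_mor t (X := qAd G)) (gpsi_mor P) hsd hrho).
  congr (rep_ext (rep_ten _ _) _ _).
  by apply/funext => y; rewrite rx_minj.
rewrite /Xop eN -[X in Dp psir a X]hflipK heisenberg // Am_flip.
by rewrite -Ud_W WpK.
Qed.

(** Conjugation by a unitary and the flip lose nothing; what remains is faithfulness of the tensor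
    representation and injectivity of [beta]. *)
Lemma Xop_inj b : (forall u, Xop b u = 0) -> b = 0.
Proof.
have hp := psir_rep; have [_ binj _ _] := gbeta_action P.
move=> h; apply: binj; apply: (rx_inj hdr).
  exact: rt_inj (@qsigd_inj R t G) rhoI.
move=> z; rewrite (sh0 bmor.1) rx0 //.
have := h (Wp psir (hflip z)); rewrite /Xop WpsK // hflipK => /(congr1 (Wps psir)).
rewrite WpsK // (lin0 (bop_lin (Wps_bop hp))) => /(congr1 hflip).
by rewrite hflipK (lin0 (bop_lin (hflip_bop _ _))).
Qed.

Lemma XopD b b' u : Xop (b + b') u = Xop b u + Xop b' u.
Proof.
have hp := psir_rep.
rewrite /Xop /betar (shD bmor.1) rxD // (linD (bop_lin (hflip_bop _ _))).
by rewrite (linD (bop_lin (Wp_bop hp))).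
Qed.

Lemma Xop0 u : Xop 0 u = 0.
Proof. by apply: (addrI (Xop 0 u)); rewrite -XopD !addr0. Qed.

Lemma Xop_nrm b u : nrm (Xop b u) <= nrm b * nrm u.
Proof.
have hp := psir_rep.
rewrite /Xop Wp_nrm // hflip_nrm.
have bb : mbnd (gbeta b) (nrm b) by exact: star_hom_mbnd bmor.1.
apply: le_trans (rx_bnd hdr _ (nrm_ge0 _) bb) _.
by rewrite hflip_nrm -(Wp_nrm hp) WpK.
Qed.

Lemma Rp_coef a xi v u :
  dot (vten xi v) (Rp psir a u) = dot (vten xi (sigd (star a) v)) u.
Proof.
have hr := rt_rep (t := t) psir_rep hsd.
rewrite /Rp -[mten _ _]starK -(rx_dot hr) mten_star star_mone.
rewrite rx_mten ?rx_one //; last exact: psir_rep; last exact: psir_rep.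
by rewrite -(sh_star minj_star_hom) rx_minj.
Qed.

End OneProduct.

(** Completeness of [M(X)]: the left and right actions converge pointwise, the right one because the
    star preserves bounds. *)
Lemma mcomplete {R : realType} {X : cstarType R} (u : nat -> multiplier X) :
  (forall e : R, 0 < e -> exists N, forall n m, (N <= n)%N -> (N <= m)%N ->
     mbnd (u n - u m) e) ->
  exists l, forall e : R, 0 < e -> exists N, forall n, (N <= n)%N -> mbnd (u n - l) e.
Proof.
move=> cu.
have lim (f : nat -> X -> X) (h : X -> X) :
    (forall n m x, nrm (f n x - f m x) <= nrm ((u n - u m) (h x)) \/
       nrm (f n x - f m x) <= nrm (star (u n - u m) (h x))) ->
    exists L : X -> X, forall x (e : R), 0 < e ->
      exists N, forall n, (N <= n)%N -> nrm (f n x - L x) <= e.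
  move=> hf; suff hx x : exists l : X, forall e : R, 0 < e ->
      exists N, forall n, (N <= n)%N -> nrm (f n x - l) <= e.
    by have [L hL] := choice hx; exists L.
  apply: nrm_complete => e e0.
  have [d d0 hd] := small_factor (nrm_ge0 (h x)) e0.
  have [N hN] := cu d d0; exists N => n m Nn Nm.
  apply: le_trans hd; rewrite mulrC.
  have b := hN n m Nn Nm; have bs := mbnd_star (ltW d0) b.
  by case: (hf n m x) => /le_trans; apply.
have [|L hL] := lim u id; first by move=> n m x; left; rewrite mE_sub.
have [|L' hL'] := lim (fun n => mright (u n)) (@star R X).
  move=> n m x; right; rewrite !mrightE -starB nrm_star.
  by rewrite -mE_sub -(starB (u n)).
have LP x y : x ** L y = L' x ** y.
  apply: nrm_eq => e e0.
  have [d d0 hd] := small_factor (addr_ge0 (nrm_ge0 x) (nrm_ge0 y)) e0.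
  have [N hN] := hL y d d0; have [N' hN'] := hL' x d d0.
  pose n := maxn N N'; apply: le_trans hd.
  apply: le_trans (nrm_tri _ (x ** u n y) _) _; rewrite mulrDl; apply: lerD.
    rewrite -smulBr; apply: le_trans (nrmM _ _) _.
    by rewrite ler_wpM2l ?nrm_ge0 // nrmC; apply: hN; exact: leq_maxl.
  rewrite multiplierP -smulBl mulrC; apply: le_trans (nrmM _ _) _.
  by rewrite ler_wpM2r ?nrm_ge0 //; apply: hN'; exact: leq_maxr.
exists (Multiplier LP) => e e0.
have e20 : 0 < e / 2 by rewrite divr_gt0.
have [N hN] := cu _ e20; exists N => n Nn x; rewrite mE_sub /=.
apply/ler_addgt0Pr => d d0; have [M hM] := hL x d d0.
pose m := maxn N M; apply: le_trans (nrm_tri _ (u m x) _) _; apply: lerD.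
  rewrite -mE_sub; apply: le_trans (hN n m Nn (leq_maxl _ _) x) _.
  by apply: ler_wpM2r; [exact: nrm_ge0|lra].
by apply: hM; exact: leq_maxr.
Qed.

(** * Pairs of forms induced by [d] and [i d] *)

Section Matched.
Context {R : realType} (X1 X2 : cstarType R) (K1 K2 : hilbertType R).
Context (rho1 : X1 -> K1 -> K1) (rho2 : X2 -> K2 -> K2).
Context (hr1 : rep rho1) (rI1 : injective rho1) (hr2 : rep rho2).
Context (D1 : set (multiplier X1)) (i : multiplier X1 -> multiplier X2).
Context (hD : cstar_subalgebra D1) (hi : hom_on D1 i).

Definition matched (f1 : K1 -> K1 -> R[i]) (f2 : K2 -> K2 -> R[i]) : Prop :=
  exists d, [/\ D1 d, forall xi eta, dot xi (rep_ext rho1 d eta) = f1 xi eta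
    & forall xi eta, dot xi (rep_ext rho2 (i d) eta) = f2 xi eta].

Definition bounded_family (V : normedModType R[i]) (K : hilbertType R)
    (L : V -> K -> K -> R[i]) : Prop :=
  (forall u v xi eta, L (u - v) xi eta = L u xi eta - L v xi eta) /\
  exists2 C : R, 0 <= C & forall u xi eta, cn (L u xi eta) <= C * nrm u * nrm xi * nrm eta.

Lemma family_lim (V : normedModType R[i]) (X : cstarType R) (K : hilbertType R)
    (rho : X -> K -> K) (L : V -> K -> K -> R[i]) (v : nat -> V) (m : nat -> multiplier X)
    u l : rep rho -> bounded_family L ->
  (forall e : R, 0 < e -> exists N, forall n, (N <= n)%N -> nrm (u - v n) <= e) ->
  (forall e : R, 0 < e -> exists N, forall n, (N <= n)%N -> mbnd (m n - l) e) ->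
  (forall n xi eta, dot xi (rep_ext rho (m n) eta) = L (v n) xi eta) ->
  forall xi eta, dot xi (rep_ext rho l eta) = L u xi eta.
Proof.
move=> hr [LB [C C0 hC]] hv hm h xi eta; apply/(@nrm_eq _ R[i]^o) => e e0.
have K0 : 0 <= (C + 1) * nrm xi * nrm eta by rewrite !mulr_ge0 ?nrm_ge0 ?addr_ge0.
have [d d0 hd] := small_factor K0 e0.
have [N hN] := hv d d0; have [N' hN'] := hm d d0; pose n := maxn N N'.
apply: le_trans hd; apply: le_trans (nrm_tri _ (L (v n) xi eta : R[i]^o) _) _.
have -> : (C + 1) * nrm xi * nrm eta * d =
  nrm xi * (d * nrm eta) + C * d * nrm xi * nrm eta by ring.
apply: lerD.
  rewrite -h -dotBr -(rxB hr).
  apply: (le_trans (cauchy_schwarz xi (rep_ext rho (l - m n) eta))).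
  apply: ler_wpM2l; first exact: nrm_ge0.
  rewrite -[l - m n]opprB -scaleN1r -[_ *: _]addr0 (rx_lc hr) (rx0 hr) addr0 scaleN1r nrmN.
  by apply: (rx_bnd hr _ (ltW d0)); apply: hN'; exact: leq_maxr.
rewrite nrmC -LB; apply: (le_trans (hC _ _ _)).
do 2 (apply: ler_wpM2r; first exact: nrm_ge0).
by apply: ler_wpM2l => //; apply: hN; exact: leq_maxl.
Qed.

Lemma family_subD (V : normedModType R[i]) (K : hilbertType R)
    (L : V -> K -> K -> R[i]) : bounded_family L ->
  (forall xi eta, L 0 xi eta = 0) /\
  forall u v xi eta, L (u + v) xi eta = L u xi eta + L v xi eta.
Proof.
move=> [LB _].
have L0 xi eta : L 0 xi eta = 0 by rewrite -(subrr 0) LB subrr.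
split=> // u v xi eta; rewrite -{1}[v]opprK LB; congr (_ + _).
by rewrite -[- v]sub0r LB L0 sub0r opprK.
Qed.

(** Along a convergent sequence the elements [d] are Cauchy, as [rho1] is isometric. Their limit
    stays in the closed [D1], and the images under [i] converge because [i] is contractive. *)
Lemma matched_closed (V : normedModType R[i]) (L1 : V -> K1 -> K1 -> R[i])
    (L2 : V -> K2 -> K2 -> R[i]) : bounded_family L1 -> bounded_family L2 ->
  closed_sub (fun u => matched (L1 u) (L2 u)).
Proof.
move=> b1 b2; have [L10 L1D] := family_subD b1.
have [L20 L2D] := family_subD b2.
have [hilin _ _] := hi.
have i0 : i 0 = 0.
  have D0 := cs0 hD; have := hilin 1 0 0 D0 D0; rewrite !scale1r addr0 => h.
  by apply: (addrI (i 0)); rewrite -h addr0.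
split=> [|u v [d [Dd h1 h2]] [d' [Dd' h1' h2']]|u hu].
- exists 0; split=> [|xi eta|xi eta]; first exact: cs0.
    by rewrite rx0 // dot0r L10.
  by rewrite i0 rx0 // dot0r L20.
- exists (d + d'); split=> [|xi eta|xi eta]; first exact: csD.
    by rewrite rxD // dotDr h1 h1' L1D.
  have := hilin 1 d d' Dd Dd'; rewrite !scale1r => ->.
  by rewrite rxD // dotDr h2 h2' L2D.
have hs n : exists p : V * multiplier X1, [/\ D1 p.2, nrm (u - p.1) <= n.+1%:R^-1,
    forall xi eta, dot xi (rep_ext rho1 p.2 eta) = L1 p.1 xi eta
  & forall xi eta, dot xi (rep_ext rho2 (i p.2) eta) = L2 p.1 xi eta].
  have n0 : (0 : R) < n.+1%:R^-1 by rewrite invr_gt0.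
  by have [v [d [Dd h1 h2]] hv] := hu _ n0; exists (v, d).
have [s hs'] := choice hs.
have vc (e : R) : 0 < e -> exists N, forall n, (N <= n)%N -> nrm (u - (s n).1) <= e.
  move=> e0; have [N hN] := small_inv e0; exists N => n Nn.
  by have [_ h _ _] := hs' n; apply: le_trans h (hN n Nn).
have [_ [C C0 hC]] := b1.
have [e e0|l hl] := mcomplete (u := fun n => (s n).2).
  have [d d0 hd] := small_factor C0 e0.
  have d20 : 0 < d / 2 by rewrite divr_gt0.
  have [N hN] := vc _ d20; exists N => n m Nn Nm.
  apply: (mbnd_le hd); apply: (rx_isom hr1 rI1) => [|v]; first by rewrite mulr_ge0 // ltW.
  apply: nrm_dot_le => [|z]; first by rewrite !mulr_ge0 ?nrm_ge0 // ltW.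
  have [_ _ hn _] := hs' n; have [_ _ hm _] := hs' m.
  rewrite rxB // dotBr hn hm -(proj1 b1); apply: le_trans (hC _ _ _) _.
  rewrite mulrAC; do 2 (apply: ler_wpM2r; first exact: nrm_ge0).
  apply: ler_wpM2l => //; apply: le_trans (nrm_tri _ u _) _.
  by rewrite nrmC [leRHS]splitr lerD ?hN.
have Dl : D1 l.
  apply: cs_closed hD _ => e e0; have [N hN] := hl e e0.
  have [DN _ _ _] := hs' N; exists (s N).2 => // x.
  rewrite mE_sub nrmC -mE_sub; exact: hN.
exists l; split=> //.
  apply: (family_lim hr1 b1 vc hl) => n; by have [] := hs' n.
apply: (family_lim (m := fun n => i (s n).2) hr2 b2 vc) => [e e0|n]; last by have [] := hs' n.
have [N hN] := hl e e0; exists N => n Nn.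
have [Dn _ _ _] := hs' n.
have iB : i (s n).2 - i l = i ((s n).2 - l).
  rewrite -[(s n).2 - l]addrC -[- l]scaleN1r hilin // scaleN1r addrC //.
have idh : star_hom (id : multiplier X1 -> multiplier X1) by split.
have hD' : cstar_subalgebra [set id x | x in D1] by rewrite image_id.
rewrite iB; apply: (mhom_contr idh (@inj_id _) hD' hi) => //; first exact: csB.
  exact: ltW.
exact: hN.
Qed.

End Matched.

(** Only additivity of [f] is assumed, so that the antilinear star is covered. *)
Lemma cspan_map {R : realType} {V W : normedModType R[i]} (S : set V) (S' : set W)
    (f : V -> W) (C : R) : 0 <= C -> (forall x y, f (x - y) = f x - f y) ->
  (forall x, nrm (f x) <= C * nrm x) -> (forall y, S y -> S' (f y)) ->
  forall x, cspan S x -> cspan S' (f x).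
Proof.
move=> C0 fB fb fS x hx.
have f0 : f 0 = 0 by rewrite -(subrr 0) fB subrr.
have fD u v : f (u + v) = f u + f v.
  by rewrite -{1}[v]opprK fB -[- v]sub0r fB f0 sub0r opprK.
have [c0 cD cc] := cspan_closed S'.
suff cl : closed_sub (fun x => cspan S' (f x)).
  by apply: cspan_ind cl _ x hx => y Sy; exact/cspan_in/fS.
split=> [|u v hu hv|u hu]; first by rewrite f0.
  by rewrite fD; exact: cD.
apply: cc => e e0; have [d d0 hd] := small_factor C0 e0.
have [v hv huv] := hu d d0; exists (f v) => //.
rewrite -fB; apply: le_trans (fb _) _; apply: le_trans hd.
exact: ler_wpM2l.
Qed.

(** * Closed graphs in a product of two C*-algebras *)

Section Graph.
Context {R : realType} (t : tensor_models R) (X Y : cstarType R).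
Context (J : set (X * Y)%type) (hJ : closed_star_subalgebra J).

Lemma css_sub u v : J u -> J v -> J (u - v).
Proof. by have [_ JL _ _ _] := hJ => Ju Jv; rewrite addrC -scaleN1r; exact: JL. Qed.

Hypothesis J0 : forall y, J (0, y) -> y = 0.

Lemma graph_fun x y y' : J (x, y) -> J (x, y') -> y = y'.
Proof.
move=> h h'; apply/eqP; rewrite -subr_eq0; apply/eqP/J0.
by rewrite -(subrr x); exact: css_sub h h'.
Qed.

(** By [J0] the first projection, followed by a faithful representation of [X], is a faithful
    representation of [J], hence isometric by [rep_isom]. *)
Lemma graph_contr z : J z -> nrm z.2 <= nrm z.1.
Proof.
move=> Jz; have [H [rho [hr rI]]] := faithful_rep t X.
have := @rep_isom R _ _ (@minj R (X * Y)%type) J (minj_star_hom (X := (X * Y)%type))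
  (@minj_inj _ _) (minj_cstar_subalgebra hJ) H (fun z => rho z.1).
move=> /(_ _ _ z (nrm z.1)) h.
have {h} h : mbnd (minj z) (nrm z.1).
  apply: h => //; last by move=> v; exact: rep_nrm.
  - split=> [a u v w _ _|u v w _ _|u v w _]; first by rewrite /= repD // repZ.
      exact: repM.
    exact: rep_dot.
  - move=> [x y] Jxy h; have x0 : x = 0.
      by apply: rI; apply/funext => v; rewrite rep0 // h.
    by move: Jxy; rewrite /= x0 => /J0 ->.
  exact: nrm_ge0.
apply: le_trans (nrm_snd z) _.
have [->|z0] := eqVneq (nrm z) 0; first exact: nrm_ge0.
have zp : 0 < nrm z by rewrite lt0r z0 nrm_ge0.
(* Tested on [star z], the bound becomes the C*-identity: the squared norm of [z] is at most
   [nrm z.1 * nrm z]. *)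
have := h (star z); rewrite /= -{1}[z]starK nrm_starM nrm_star expr2 ler_pM2r //.
Qed.

Lemma graph_dom_closed : closed_sub (fun x => exists y, J (x, y)).
Proof.
have [J00 JL _ _ Jc] := hJ.
split=> [|u v [y hy] [y' hy']|u hu]; first by exists 0.
  exists (y + y'); have := JL 1 _ _ hy hy'; rewrite scale1r; exact.
have hs n : exists p : X * Y, J p /\ nrm (u - p.1) <= n.+1%:R^-1.
  have n0 : (0 : R) < n.+1%:R^-1 by rewrite invr_gt0.
  by have [v [y Jy] hv] := hu _ n0; exists (v, y).
have [s /all_and2[Js hs']] := choice hs.
have vc (e : R) : 0 < e -> exists N, forall n, (N <= n)%N -> nrm (u - (s n).1) <= e.
  move=> e0; have [N hN] := small_inv e0; exists N => n Nn.
  exact: le_trans (hs' n) (hN n Nn).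
have [e e0|l hl] := nrm_complete (u := fun n => (s n).2).
  have e20 : 0 < e / 2 by rewrite divr_gt0.
  have [N hN] := vc _ e20; exists N => n m Nn Nm.
  apply: le_trans (graph_contr (css_sub (Js n) (Js m))) _.
  by apply: le_trans (nrm_tri _ u _) _; rewrite nrmC [leRHS]splitr lerD ?hN.
exists l; apply: Jc => e e0; have [N hN] := vc e e0; have [N' hN'] := hl e e0.
pose n := maxn N N'; exists (s n) => //; rewrite prod_nrm ge_max; apply/andP; split.
  by apply: hN; exact: leq_maxl.
by rewrite nrmC; apply: hN'; exact: leq_maxr.
Qed.

End Graph.

Section OneProductBounds.
Context {R : realType} {t : tensor_models R} (G : lcqg t) (P : gproduct G).
Context (K : hilbertType R) (rho : P -> K -> K) (hrho : rep rho).
Context (D : set (multiplier P)) (hD : landstad_algebra D).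

Local Notation sig := (@qsig R t G).
Local Notation H := (@qH R t G).

Lemma landstad_action_in om d : @predual R t G om -> D d -> D (landstad_action om d).
Proof.
have [_ _ _ e] := hD => po Dd; rewrite -e => S [hS]; apply.
by apply: closed_span_in; exists (om, d).
Qed.

Lemma Ud_bnd d : exists2 C : R, 0 <= C & forall u, nrm (Ud rho d u) <= C * nrm u.
Proof.
have hr := rt_rep (t := t) hrho (@qsig_rep R t G).
by have /bounded_opP[_] := rx_bop hr (Vpsi P ** mten d mone ** star (Vpsi P)).
Qed.

Lemma Ud_lin d : linear (Ud rho d).
Proof. exact: rx_lin (rt_rep (t := t) hrho (@qsig_rep R t G)) _. Qed.

Lemma Ud_family_l d w : bounded_family
  (fun v xi eta => dot (vten (t := t) xi v) (Ud rho d (vten eta w)) : R[i]).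
Proof.
have [C C0 hC] := Ud_bnd d; split=> [v v' xi eta|].
  have := hpairDr (hilbert_model t K H) xi (v - v') v'; rewrite subrK => e.
  by rewrite /vten e dotDl addrK.
exists (C * nrm w); first by rewrite mulr_ge0 ?nrm_ge0.
move=> v xi eta; apply: le_trans (cauchy_schwarz _ _) _.
apply: le_trans (_ : nrm xi * nrm v * (C * (nrm eta * nrm w)) <= _).
  rewrite vten_nrm; apply: ler_wpM2l; first by rewrite mulr_ge0 ?nrm_ge0.
  by rewrite -(vten_nrm (t := t)); exact: hC.
by rewrite le_eqVlt; apply/orP; left; apply/eqP; ring.
Qed.

Lemma Ud_family_r d v : bounded_family
  (fun w xi eta => dot (vten (t := t) xi v) (Ud rho d (vten eta w)) : R[i]).
Proof.
have [C C0 hC] := Ud_bnd d; split=> [w w' xi eta|].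
  have := hpairDr (hilbert_model t K H) eta (w - w') w'; rewrite subrK => e.
  by rewrite /vten e (linD (Ud_lin d)) dotDr addrK.
exists (C * nrm v); first by rewrite mulr_ge0 ?nrm_ge0.
move=> w xi eta; apply: le_trans (cauchy_schwarz _ _) _.
apply: le_trans (_ : nrm xi * nrm v * (C * (nrm eta * nrm w)) <= _).
  rewrite vten_nrm; apply: ler_wpM2l; first by rewrite mulr_ge0 ?nrm_ge0.
  by rewrite -(vten_nrm (t := t)); exact: hC.
by rewrite le_eqVlt; apply/orP; left; apply/eqP; ring.
Qed.

Lemma Xop_family v w : bounded_family
  (fun b xi eta => dot (vten (t := t) xi v) (Xop rho b (vten eta w)) : R[i]).
Proof.
split=> [b b' xi eta|].
  have := XopD hrho (b - b') b' (vten eta w); rewrite subrK => ->.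
  by rewrite dotDr addrK.
exists (nrm v * nrm w); first by rewrite mulr_ge0 ?nrm_ge0.
move=> b xi eta; apply: le_trans (cauchy_schwarz _ _) _.
rewrite vten_nrm; apply: le_trans (_ : nrm xi * nrm v * (nrm b * (nrm eta * nrm w)) <= _).
  apply: ler_wpM2l; first by rewrite mulr_ge0 ?nrm_ge0.
  by rewrite -(vten_nrm (t := t)); exact: Xop_nrm.
by rewrite le_eqVlt; apply/orP; left; apply/eqP; ring.
Qed.

End OneProductBounds.

(** * The span of the generators is the graph of an injective map *)

Section LinkedPairs.
Context {R : realType} {t : tensor_models R} (G : lcqg t) (P1 P2 : gproduct G).
Context (D1 : set (multiplier P1)) (D2 : set (multiplier P2)).
Context (hD1 : landstad_algebra D1) (hD2 : landstad_algebra D2).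
Context (i : multiplier P1 -> multiplier P2) (hi : landstad_iso D1 D2 i).
Context (K1 K2 : hilbertType R) (rho1 : P1 -> K1 -> K1) (rho2 : P2 -> K2 -> K2).
Context (hr1 : rep rho1) (rI1 : injective rho1) (hr2 : rep rho2) (rI2 : injective rho2).

Local Notation sig := (@qsig R t G).
Local Notation sigd := (@qsigd R t G).
Local Notation H := (@qH R t G).

Local Notation coef rho U v w :=
  (fun xi eta => dot (vten (t := t) xi v) (U (vten eta w)) : R[i]).

Lemma iso_hom_on : hom_on D1 i.
Proof. by have [_ ? ? ? _] := hi. Qed.

Lemma iso_in d : D1 d -> D2 (i d).
Proof. by have [[h _ _] _ _ _ _] := hi; exact: h. Qed.

Lemma landstad_cs1 : cstar_subalgebra D1. Proof. by have [] := hD1. Qed.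

Lemma iso0 : i 0 = 0.
Proof.
have [hl _ _] := iso_hom_on; have D0 := cs0 landstad_cs1.
by apply: (addrI (i 0)); rewrite -{1}[i 0]scale1r -hl // addr0 scale1r addr0.
Qed.

Local Notation mt := (matched rho1 rho2 D1 i).

(** For vectors in the image of [sig] the form is a value of the Landstad action, which [i]
    intertwines; all other vectors are reached by density. *)
Lemma matched_Ud d v w : D1 d ->
  mt (coef rho1 (Ud rho1 d) v w) (coef rho2 (Ud rho2 (i d)) v w).
Proof.
move=> Dd; have hs := @qsig_rep R t G.
move: v; apply: (dense_ind (rep_dense hs)) => [|y1 v].
  exact: (matched_closed hr1 rI1 hr2 landstad_cs1 iso_hom_on
    (Ud_family_l hr1 d w) (Ud_family_l hr2 (i d) w)).
move: w; apply: (dense_ind (rep_dense hs)) => [|y2 w].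
  exact: (matched_closed hr1 rI1 hr2 landstad_cs1 iso_hom_on
    (Ud_family_r hr1 d (sig y1 v)) (Ud_family_r hr2 (i d) (sig y1 v))).
have po := vfun_predual y1 y2 v w.
exists (landstad_action (vfun sig y1 y2 v w) d); split=> [|xi eta|xi eta].
- exact: (landstad_action_in hD1).
- exact: landstad_coef.
by have [_ _ _ _ ->] := hi => //; exact: landstad_coef.
Qed.

(* [Xop rho b] represents [b] as an element of the crossed product, so that the *)
(* slices of [Xop rho b] in the second leg lie in the Landstad algebra.  A      *)
(* closed condition which pairs of corresponding generators satisfy, and which  *)
(* determines either component from the other one.                              *)
Definition linked (z : (P1 * P2)%type) : Prop := forall v w : H,
  mt (coef rho1 (Xop rho1 z.1) v w) (coef rho2 (Xop rho2 z.2) v w).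

Lemma fst_bop (V W : normedModType R[i]) : bounded_op (fst : V * W -> V).
Proof. by apply: (bopI (C := 1)) => // u; rewrite mul1r nrm_fst. Qed.

Lemma snd_bop (V W : normedModType R[i]) : bounded_op (snd : V * W -> W).
Proof. by apply: (bopI (C := 1)) => // u; rewrite mul1r nrm_snd. Qed.

Lemma family_comp (V W : normedModType R[i]) (K : hilbertType R)
    (L : V -> K -> K -> R[i]) (f : W -> V) :
  bounded_op f -> bounded_family L -> bounded_family (fun u => L (f u)).
Proof.
move=> /bounded_opP[lf [B B0 hB]] [LB [C C0 hC]]; split=> [u v xi eta|].
  by rewrite (linB lf) LB.
exists (C * B); first exact: mulr_ge0.
move=> u xi eta; apply: le_trans (hC _ _ _) _.
do 2 (apply: ler_wpM2r; first exact: nrm_ge0).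
by rewrite -mulrA; apply: ler_wpM2l.
Qed.

Lemma linked_closed : closed_sub linked.
Proof.
apply: closed_sub_and => v; apply: closed_sub_and => w.
apply: (matched_closed hr1 rI1 hr2 landstad_cs1 iso_hom_on
  (L1 := fun z : P1 * P2 => coef rho1 (Xop rho1 z.1) v w)
  (L2 := fun z : P1 * P2 => coef rho2 (Xop rho2 z.2) v w)).
  exact: family_comp (fst_bop _ _) (Xop_family hr1 v w).
exact: family_comp (snd_bop _ _) (Xop_family hr2 v w).
Qed.

Definition gens (z : (P1 * P2)%type) : Prop := exists a d,
  [/\ D1 d, minj z.1 = gpsi P1 a ** d & minj z.2 = gpsi P2 a ** i d].

(** The factor [1 ⊗ sigd a] in [Xop_gen] is absorbed by the functional, replacing [v] by
    [sigd (star a) v]; the rest is [matched_Ud]. *)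
Lemma linked_gens z : gens z -> linked z.
Proof.
move=> [a [d [Dd e1 e2]]] v w.
have [d' [Dd' h1 h2]] := matched_Ud (sigd (star a) v) w Dd.
exists d'; split=> // xi eta.
  by rewrite (Xop_gen hr1 hD1 _ Dd e1) Rp_coef.
by rewrite (Xop_gen hr2 hD2 _ (iso_in Dd) e2) Rp_coef.
Qed.

Lemma coef_eq0 (X : cstarType R) (K : hilbertType R) (rho : X -> K -> K) m :
  rep rho -> injective rho -> (forall xi eta, dot xi (rep_ext rho m eta) = 0) -> m = 0.
Proof.
move=> hr rI h; apply: (rx_inj hr) => // v; rewrite rx0 //.
by apply: dot_eqP => x; rewrite h dot0r.
Qed.

Lemma Xop_eq0 (P : gproduct G) (K : hilbertType R) (rho : P -> K -> K) b :
  rep rho -> injective rho ->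
  (forall v w xi eta, coef rho (Xop rho b) v w xi eta = 0) -> b = 0.
Proof.
move=> hr rI h; apply: (Xop_inj hr rI) => u.
have bX : bounded_op (Xop rho b).
  apply: (bopI (C := nrm b)); [|exact: nrm_ge0|by move=> z; exact: Xop_nrm].
  have hp := psir_rep hr; have hdr := rt_rep (t := t) (@qsigd_rep R t G) hr.
  move=> c x y; rewrite /Xop (bop_lin (Wps_bop hp)) (bop_lin (hflip_bop _ _)).
  by rewrite /betar (rx_lin hdr) (bop_lin (hflip_bop _ _)) (bop_lin (Wp_bop hp)).
have bz : bounded_op ((fun=> 0) : hten t K H -> hten t K H).
  apply: (bopI (C := 0)) => // [c x y|x]; first by rewrite scaler0 addr0.
  by rewrite nrm0 mul0r.
have -> // : Xop rho b = fun=> 0.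
apply: vten_ext => // eta w; apply: vten_sep => xi v.
by rewrite dot0r; exact: h.
Qed.

(** The element [d] linking the slices of [Xop 0] and [Xop b] is 0 since [rho1] is faithful, so
    every coefficient of [Xop b] vanishes. *)
Lemma linked0l b : linked (0, b) -> b = 0.
Proof.
move=> h; apply: (Xop_eq0 hr2 rI2) => v w xi eta.
have [d [Dd h1 h2]] := h v w; rewrite -h2.
have d0 : d = 0.
  by apply: (coef_eq0 hr1 rI1) => x y; rewrite h1 /= (Xop0 hr1) dot0r.
by rewrite d0 iso0 rx0 // dot0r.
Qed.

Lemma linked0r b : linked (b, 0) -> b = 0.
Proof.
move=> h; apply: (Xop_eq0 hr1 rI1) => v w xi eta.
have [d [Dd h1 h2]] := h v w; rewrite -h1.
suff -> : d = 0 by rewrite rx0 // dot0r.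
have [[_ iI _] _ _ _ _] := hi; apply: iI; rewrite ?inE ?iso0 //; first exact: cs0 landstad_cs1.
by apply: (coef_eq0 hr2 rI2) => x y; rewrite h2 /= (Xop0 hr2) dot0r.
Qed.

End LinkedPairs.

(** * Invariance of the adjoint generators under the dual algebra *)

Section SlicedProduct.
Context {R : realType} {t : tensor_models R} (G : lcqg t) (P : gproduct G).
Context (K : hilbertType R) (rho : P -> K -> K) (hrho : rep rho).

Local Notation sig := (@qsig R t G).
Local Notation H := (@qH R t G).
Local Notation psir := (psir rho).

Let hs := @qsig_rep R t G.
Let hp := psir_rep hrho.
Let hps := rt_rep (t := t) hp hs.

(** The form of the slice, by the vector functional of [sig y1 v] and [w], of
    [V_psi (d ⊗ 1) star V_psi] times the image of [q]. As a function of [q] it interpolates between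
    [sliced_psi] and [sliced_landstad]. *)
Definition sliced (y1 : qA G) (v w : H) (d : multiplier P) (q : cten t (qAd G) (qA G))
    (xi eta : K) : R[i] :=
  dot (vten xi (sig y1 v)) (Ud rho d (rep_ten psir sig q (vten eta w))).

Lemma rep_mul_minj d x b eta : minj b = d ** gpsi P x ->
  rho b eta = rep_ext rho d (psir x eta).
Proof. by move=> e; rewrite -(rx_minj hrho) e (rxM hrho). Qed.

(** Inserting [star V_psi ** V_psi = 1] after [d ⊗ 1] makes the Landstad action appear and leaves
    [V (x ⊗ y2)], an element of the tensor product. *)
Lemma sliced_psi y1 y2 v w d x b xi eta : minj b = d ** gpsi P x ->
  dot xi (rho (ext (gpsi P) (slice (vfun sig y1 y2 v w) (qV G)) b) eta) =
  sliced y1 v w d (qV G (aten x y2)) xi eta.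
Proof.
move=> e; rewrite -(rxE hrho) (rep_mul_minj _ e) (rx_ext t _ (gpsi_mor P) hrho).
rewrite (slice_rep hs _ _ _ _ _ _ _ hp) /sliced -/(Wp psir).
have -> : vten (rep_ext rho d (psir x eta)) (sig y2 w) =
    Am rho d (vten (psir x eta) (sig y2 w)).
  by rewrite /Am rx_mten // rx_one.
rewrite -(Ud_W hrho); congr (dot _ (Ud rho d _)).
by rewrite /Wp -rxE // rtE.
Qed.

Lemma sliced_landstad y1 y v w d x c xi eta :
  minj c = landstad_action (vfun sig y1 y v w) d ** gpsi P x ->
  dot xi (rho c eta) = sliced y1 v w d (aten x y) xi eta.
Proof. by move=> e; rewrite (rep_mul_minj _ e) landstad_coef // /sliced rtE. Qed.

Lemma sliced_family y1 v w d : bounded_family (sliced y1 v w d).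
Proof.
have [C C0 hC] := Ud_bnd hrho d; split=> [q q' xi eta|].
  by rewrite /sliced (repB hps) (linB (Ud_lin hrho d)) dotBr.
exists (C * nrm w * nrm (sig y1 v)); first by rewrite !mulr_ge0 ?nrm_ge0.
move=> q xi eta; apply: le_trans (cauchy_schwarz _ _) _.
apply: le_trans (_ : nrm xi * nrm (sig y1 v) * (C * (nrm q * (nrm eta * nrm w))) <= _).
  rewrite vten_nrm; apply: ler_wpM2l; first by rewrite mulr_ge0 ?nrm_ge0.
  apply: le_trans (hC _) _; apply: ler_wpM2l => //.
  by rewrite -(vten_nrm (t := t)); exact: rep_nrm.
by rewrite le_eqVlt; apply/orP; left; apply/eqP; ring.
Qed.

End SlicedProduct.

Lemma family_nrm {R : realType} (V : normedModType R[i]) (X : cstarType R)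
    (K : hilbertType R) (rho : X -> K -> K) (L : V -> K -> K -> R[i]) :
  rep rho -> injective rho -> bounded_family L ->
  exists2 C : R, 0 <= C & forall b c q q',
    (forall xi eta, dot xi (rho b eta) = L q xi eta) ->
    (forall xi eta, dot xi (rho c eta) = L q' xi eta) -> nrm (b - c) <= C * nrm (q - q').
Proof.
move=> hr rI [LB [C C0 hC]]; exists C => // b c q q' hb hc.
apply: (rep_inj_nrm hr) => // [|eta]; first by rewrite mulr_ge0 ?nrm_ge0.
apply: nrm_dot_le => [|xi]; first by rewrite !mulr_ge0 ?nrm_ge0.
rewrite (repB hr) dotBr hb hc -LB mulrAC; exact: hC.
Qed.

Lemma ext_bnd {R : realType} (t : tensor_models R) (X Y : cstarType R)
    (f : X -> multiplier Y) m (c : R) : mor f -> 0 <= c -> mbnd m c -> mbnd (ext f m) c.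
Proof.
move=> hf c0 hm; have [K [rho [hr rI]]] := faithful_rep t Y.
apply: (rx_isom hr) => // v; rewrite (rx_ext t) //.
by apply: rx_bnd => //; exact: rep_mor.
Qed.

Section LandstadSpan.
Context {R : realType} {t : tensor_models R} (G : lcqg t) (P : gproduct G).
Context (D : set (multiplier P)) (hD : landstad_algebra D).

Let cD : cstar_subalgebra D. Proof. by have [] := hD. Qed.
Let sP : star_hom (gpsi P). Proof. by have [] := gpsi_mor P. Qed.

Lemma psi_landstad a d : D d -> exists b, minj b = gpsi P a ** d.
Proof.
move=> Dd; have [_ _ e _] := hD.
have : closed_product (range (gpsi P)) D (gpsi P a ** d).
  by apply: closed_span_in; exists (gpsi P a, d) => //; split=> //; exists a.
by rewrite -e => -[b _ hb]; exists b.
Qed.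

Lemma landstad_psi a d : D d -> exists b, minj b = d ** gpsi P a.
Proof.
move=> Dd; have [b hb] := psi_landstad (star a) (cs_star cD Dd).
exists (star b); rewrite (sh_star minj_star_hom) hb starM starK.
by rewrite -(sh_star sP) starK.
Qed.

Lemma landstad_span b : cspan [set c | exists a d, D d /\ minj c = gpsi P a ** d] b.
Proof.
set S := [set c | _]; have [_ _ e _] := hD.
have hS a y : S y -> S (a *: y).
  move=> [x [d [Dd hy]]]; exists (a *: x), d; split=> //.
  by rewrite (shZ minj_star_hom) hy (shZ sP) smulZl.
have hc := minj_closed_subspace (cspan_closed S) (fun a x => cspanZ (hS a)).
have [x Sx /minj_inj <- //] : [set minj x | x in cspan S] (minj b).
apply: (closed_span_sub hc (S := [set p.1 ** p.2 | p in range (gpsi P) `*` D])).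
  move=> _ [[_ d] /= [[a _ <-] Dd] <-]; have [c hc'] := psi_landstad a Dd.
  by exists c => //; apply: cspan_in; exists a, d.
rewrite -/(closed_product (range (gpsi P)) D) -e; by exists b.
Qed.

Lemma landstad_span' b : cspan [set c | exists a d, D d /\ minj c = d ** gpsi P a] b.
Proof.
rewrite -[b]starK.
apply: (cspan_map (f := @star R P) (C := 1) _ _ _ _ (landstad_span (star b))) => //.
- exact: starB.
- by move=> x; rewrite mul1r nrm_star.
move=> c [a [d [Dd hc]]]; exists (star a), (star d); split; first exact: cs_star.
by rewrite (sh_star minj_star_hom) hc starM (sh_star sP).
Qed.

End LandstadSpan.

Section PairAction.
Context {R : realType} (X Y : cstarType R).

Definition pact (m : multiplier X) (n : multiplier Y) (z : X * Y) : X * Y := (m z.1, n z.2).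

Lemma pact_bop m n : bounded_op (pact m n).
Proof.
have [C C0 hC] := mbound m; have [C' C0' hC'] := mbound n.
apply: (bopI (C := C + C')); [|exact: addr_ge0|].
  by move=> a u v; congr pair; exact: m_lin.
move=> u; rewrite prod_nrm ge_max; apply/andP; split.
  apply: le_trans (hC _) _; rewrite mulrDl -[leLHS]addr0; apply: lerD.
    by rewrite ler_wpM2l // nrm_fst.
  by rewrite mulr_ge0 ?nrm_ge0.
apply: le_trans (hC' _) _; rewrite mulrDl -[leLHS]add0r; apply: lerD.
  by rewrite mulr_ge0 ?nrm_ge0.
by rewrite ler_wpM2l // nrm_snd.
Qed.

Lemma cspan_pact (S S' : set (X * Y)) m n z :
  (forall y, S y -> cspan S' (pact m n y)) -> cspan S z -> cspan S' (pact m n z).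
Proof.
move=> h hz; apply: (cspan_ind (P := fun z => cspan S' (pact m n z)) _ h hz).
exact: closed_sub_comp (pact_bop m n) (cspan_closed S').
Qed.

End PairAction.

Section PairedGenerators.
Context {R : realType} {t : tensor_models R} (G : lcqg t) (P1 P2 : gproduct G).
Context (D1 : set (multiplier P1)) (D2 : set (multiplier P2)).
Context (hD1 : landstad_algebra D1) (hD2 : landstad_algebra D2).
Context (i : multiplier P1 -> multiplier P2) (hi : landstad_iso D1 D2 i).

Local Notation sig := (@qsig R t G).
Local Notation sl p := (slice (vfun sig p.1.1 p.2.1 p.1.2 p.2.2) (qV G)).

Definition cogens (z : (P1 * P2)%type) : Prop := exists a d,
  [/\ D1 d, minj z.1 = d ** gpsi P1 a & minj z.2 = i d ** gpsi P2 a].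

Lemma cogens_slices y1 v w d (s : seq (qAd G * qA G)) (K1 K2 : hilbertType R)
    (rho1 : P1 -> K1 -> K1) (rho2 : P2 -> K2 -> K2) : rep rho1 -> rep rho2 -> D1 d ->
  exists c, [/\ cspan cogens c,
    forall xi eta, dot xi (rho1 c.1 eta) = sliced rho1 y1 v w d (psum aten s) xi eta
  & forall xi eta, dot xi (rho2 c.2 eta) = sliced rho2 y1 v w (i d) (psum aten s) xi eta].
Proof.
move=> hr1 hr2 Dd.
have [s01 s1D] := family_subD (sliced_family hr1 y1 v w d).
have [s02 s2D] := family_subD (sliced_family hr2 y1 v w (i d)).
have [cc0 ccD _] := cspan_closed cogens.
elim: s => [|[x y] s [c [cc h1 h2]]].
  rewrite /psum big_nil; exists 0; split=> // xi eta.
    by rewrite s01 (rep0 hr1) dot0r.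
  by rewrite s02 (rep0 hr2) dot0r.
have po := vfun_predual y1 y v w.
have Dd' := landstad_action_in hD1 po Dd.
have [_ _ _ _ ai] := hi.
have [c1 e1] := landstad_psi hD1 x Dd'.
have [c2 e2] := landstad_psi hD2 x (iso_in hi Dd').
exists ((c1, c2) + c); split=> [|xi eta|xi eta].
- refine (ccD _ _ (cspan_in _) cc).
  exact: (ex_intro _ x (ex_intro _ _ (And3 Dd' e1 e2))).
- rewrite (repD hr1) dotDr h1 (sliced_landstad hr1 _ _ e1).
  by rewrite /psum big_cons s1D.
rewrite ai // in e2.
rewrite (repD hr2) dotDr h2 (sliced_landstad hr2 _ _ e2).
by rewrite /psum big_cons s2D.
Qed.

(** Approximate [V (x ⊗ y2)] by a sum of [x_k ⊗ y_k]: the same sum serves both components, and each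
    term contributes a pair in [cogens] with [d] replaced by a value of the Landstad action. *)
Lemma cogens_slice y1 y2 v w z : cogens z -> cspan cogens
  (pact (ext (gpsi P1) (slice (vfun sig y1 y2 v w) (qV G)))
        (ext (gpsi P2) (slice (vfun sig y1 y2 v w) (qV G))) z).
Proof.
move=> [x [d [Dd e1 e2]]].
have [K1 [rho1 [hr1 rI1]]] := faithful_rep t P1.
have [K2 [rho2 [hr2 rI2]]] := faithful_rep t P2.
have [C1 C10 hC1] := family_nrm hr1 rI1 (sliced_family hr1 y1 v w d).
have [C2 C20 hC2] := family_nrm hr2 rI2 (sliced_family hr2 y1 v w (i d)).
have [_ _] := cspan_closed cogens; apply => e e0.
have [d1 d10 hd1] := small_factor (addr_ge0 C10 C20) e0.
have [_ [s _ <-] hs] := closureT_dense (aten_dense _ _) (qV G (aten x y2)) d10.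
have [c [cc h1 h2]] := cogens_slices y1 v w s hr1 hr2 Dd.
exists c => //; rewrite prod_nrm ge_max; apply/andP; split.
  apply: le_trans (hC1 _ _ _ _ (fun xi eta => sliced_psi hr1 y1 y2 v w xi eta e1) h1) _.
  apply: le_trans hd1; rewrite mulrDl -[leLHS]addr0; apply: lerD.
    exact: ler_wpM2l.
  by rewrite mulr_ge0 // ltW.
apply: le_trans (hC2 _ _ _ _ (fun xi eta => sliced_psi hr2 y1 y2 v w xi eta e2) h2) _.
apply: le_trans hd1; rewrite mulrDl -[leLHS]add0r; apply: lerD; last exact: ler_wpM2l.
by rewrite mulr_ge0 // ltW.
Qed.

Lemma psi_slices (P : gproduct G) a (s : seq (qA G * qH G * (qA G * qH G))) (e : R) b :
  0 <= e -> mbnd (minj a - \sum_(p <- s) sl p) e ->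
  nrm (gpsi P a b - \sum_(p <- s) ext (gpsi P) (sl p) b) <= e * nrm b.
Proof.
move=> e0 h; have hP := gpsi_mor P.
have := ext_bnd t hP e0 h b; have le := sh_lin (ext_star_hom (t := t) hP).
by rewrite (linB le) (lin_sum le) (ext_minj (t := t) hP) mE_sub mE_sum.
Qed.

Lemma cogens_psi a z : cspan cogens z -> cspan cogens (pact (gpsi P1 a) (gpsi P2 a) z).
Proof.
apply: cspan_pact => {}z hz.
have [_ _] := cspan_closed cogens; apply => e e0.
have [d d0 hd] := small_factor (nrm_ge0 z) e0.
have [s hs] := slice_dense a d0.
exists (\sum_(p <- s) pact (ext (gpsi P1) (sl p)) (ext (gpsi P2) (sl p)) z).
  have := @closed_sub_sum _ _ _ _ s (fun p => pact (ext (gpsi P1) (sl p)) (ext (gpsi P2) (sl p)) z) (cspan_closed cogens).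
  by apply=> p; apply: cogens_slice.
have f1 : (\sum_(p <- s) pact (ext (gpsi P1) (sl p)) (ext (gpsi P2) (sl p)) z).1 =
    \sum_(p <- s) ext (gpsi P1) (sl p) z.1.
  exact: (lin_sum (bop_lin (fst_bop P1 P2))).
have f2 : (\sum_(p <- s) pact (ext (gpsi P1) (sl p)) (ext (gpsi P2) (sl p)) z).2 =
    \sum_(p <- s) ext (gpsi P2) (sl p) z.2.
  exact: (lin_sum (bop_lin (snd_bop P1 P2))).
rewrite prod_nrm ge_max; apply/andP; split; apply: le_trans hd; rewrite mulrC /= ?f1 ?f2.
  apply: le_trans (psi_slices _ (ltW d0) hs) _.
  by apply: ler_wpM2l; [exact: ltW|exact: nrm_fst].
apply: le_trans (psi_slices _ (ltW d0) hs) _.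
by apply: ler_wpM2l; [exact: ltW|exact: nrm_snd].
Qed.

End PairedGenerators.

Lemma css_swap {R : realType} (X Y : cstarType R) (J : set (X * Y)%type) :
  closed_star_subalgebra J ->
  closed_star_subalgebra [set z : (Y * X)%type | J (z.2, z.1)].
Proof.
move=> [J0 JL JM JS Jc]; split=> //= [a x y|x y|x|x hx]; [exact: JL|exact: JM|exact: JS|].
apply: Jc => e e0; have [y Jy hy] := hx e e0; exists (y.2, y.1) => //.
by move: hy; rewrite !prod_nrm /= maxC.
Qed.

(** * The graph as a C*-algebra *)

Section GraphAlgebra.
Context {R : realType} {t : tensor_models R} (G : lcqg t) (P1 P2 : gproduct G).
Context (D1 : set (multiplier P1)) (D2 : set (multiplier P2)).
Context (hD1 : landstad_algebra D1) (hD2 : landstad_algebra D2).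
Context (i : multiplier P1 -> multiplier P2) (hi : landstad_iso D1 D2 i).

Local Notation gens := (gens D1 i).
Local Notation cogens := (cogens D1 i).
Local Notation pair_alg := (P1 * P2)%type.

Let cD1 : cstar_subalgebra D1. Proof. by have [] := hD1. Qed.
Let s1 : star_hom (gpsi P1). Proof. by have [] := gpsi_mor P1. Qed.
Let s2 : star_hom (gpsi P2). Proof. by have [] := gpsi_mor P2. Qed.

Lemma gens0l b : cspan gens (0, b) -> b = 0.
Proof.
have [K1 [rho1 [hr1 rI1]]] := faithful_rep t P1.
have [K2 [rho2 [hr2 rI2]]] := faithful_rep t P2.
move=> h; apply: (linked0l hD1 hi hr1 rI1 hr2 rI2).
apply: cspan_ind (linked_closed hD1 hi hr1 rI1 hr2) _ _ h.
exact: (linked_gens hD1 hD2 hi hr1 rI1 hr2).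
Qed.

Lemma gens0r b : cspan gens (b, 0) -> b = 0.
Proof.
have [K1 [rho1 [hr1 rI1]]] := faithful_rep t P1.
have [K2 [rho2 [hr2 rI2]]] := faithful_rep t P2.
move=> h; apply: (linked0r hD1 hi hr1 rI1 hr2 rI2).
apply: cspan_ind (linked_closed hD1 hi hr1 rI1 hr2) _ _ h.
exact: (linked_gens hD1 hD2 hi hr1 rI1 hr2).
Qed.

Lemma star_gens z : gens z -> cogens (star z).
Proof.
move=> [a [d [Dd e1 e2]]]; exists (star a), (star d); have [_ _ _ iS _] := hi.
split; first exact: cs_star.
  by rewrite /= (sh_star minj_star_hom) e1 starM (sh_star s1).
by rewrite /= (sh_star minj_star_hom) e2 starM (sh_star s2) iS.
Qed.

Lemma star_cogens z : cogens z -> gens (star z).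
Proof.
move=> [a [d [Dd e1 e2]]]; exists (star a), (star d); have [_ _ _ iS _] := hi.
split; first exact: cs_star.
  by rewrite /= (sh_star minj_star_hom) e1 starM (sh_star s1).
by rewrite /= (sh_star minj_star_hom) e2 starM (sh_star s2) iS.
Qed.

Lemma star_span (S S' : set pair_alg) z :
  (forall y, S y -> S' (star y)) -> cspan S z -> cspan S' (star z).
Proof.
move=> hS; apply: (cspan_map (C := 1)) => //; first exact: starB.
by move=> x; rewrite mul1r nrm_star.
Qed.

Lemma cogens0l b : cspan cogens (0, b) -> b = 0.
Proof.
move=> h; have h' := star_span star_cogens h.
have e : star ((0, b) : pair_alg) = (0, star b) by congr pair; exact: star0.
by rewrite e in h'; rewrite -[b]starK (gens0l h') star0.
Qed.

Lemma gensZ (a : R[i]) y : gens y -> gens (a *: y).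
Proof.
move=> [x [d [Dd e1 e2]]]; exists (a *: x), d; split=> //=.
  by rewrite (shZ minj_star_hom) e1 (shZ s1) smulZl.
by rewrite (shZ minj_star_hom) e2 (shZ s2) smulZl.
Qed.

Lemma cogensZ (a : R[i]) y : cogens y -> cogens (a *: y).
Proof.
move=> [x [d [Dd e1 e2]]]; exists (a *: x), d; split=> //=.
  by rewrite (shZ minj_star_hom) e1 (shZ s1) smulZr.
by rewrite (shZ minj_star_hom) e2 (shZ s2) smulZr.
Qed.

(** The larger set [cspan cogens] is already single-valued, so a pair lying there, and not only in
    [graph], determines the value of the isomorphism. *)
Lemma cogens_fun b c c' : cspan cogens (b, c) -> cspan cogens (b, c') -> c = c'.
Proof.
move=> h h'; apply/eqP; rewrite -subr_eq0; apply/eqP/cogens0l.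
have [_ cD _] := cspan_closed cogens.
have := cD _ _ h (cspanZ (cogensZ (-1)) h').
have -> // : ((b, c) : pair_alg) + -1 *: (b, c') = (0, c - c').
by rewrite scaleN1r; congr pair; rewrite subrr.
Qed.

Lemma cogens_landstad d z : D1 d -> cspan cogens z -> cspan cogens (pact d (i d) z).
Proof.
move=> Dd; apply: cspan_pact => {}z [x [d' [Dd' e1 e2]]]; apply: cspan_in.
have [_ _ iM _ _] := hi; have [_ cM _] := cD1.
exists x, (d ** d'); split=> /=; first exact: cM.
  by rewrite -mul_minj e1 smulA.
by rewrite -mul_minj e2 iM // smulA.
Qed.

(** A generator on the left acts by [(psi1 a, psi2 a)] followed by [(d, i d)]; both preserve the
    span. *)
Lemma cogens_mul z w : cspan cogens z -> cspan cogens w -> cspan cogens (z ** w).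
Proof.
move=> hz hw; move: z hz; apply: cspan_ind.
  exact: (closed_sub_comp (sm_bop_l w) (cspan_closed cogens)).
move=> z [a [d [Dd e1 e2]]].
have -> : z ** w = pact d (i d) (pact (gpsi P1 a) (gpsi P2 a) w).
  congr pair; first by rewrite -[LHS]/(minj z.1 w.1) e1.
  by rewrite -[LHS]/(minj z.2 w.2) e2.
exact: (cogens_landstad Dd (cogens_psi hD1 hD2 hi a hw)).
Qed.

Lemma gens_mul z w : cspan gens z -> cspan gens w -> cspan gens (z ** w).
Proof.
move=> hz hw; rewrite -[z ** w]starK starM; apply: (star_span star_cogens).
exact: cogens_mul (star_span star_gens hw) (star_span star_gens hz).
Qed.

Lemma gens_mright a z : cspan gens z ->
  cspan gens (mright (gpsi P1 a) z.1, mright (gpsi P2 a) z.2).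
Proof.
move=> hz; have -> : (mright (gpsi P1 a) z.1, mright (gpsi P2 a) z.2) =
    star (pact (gpsi P1 (star a)) (gpsi P2 (star a)) (star z)).
  by congr pair; rewrite mrightE ?(sh_star s1) ?(sh_star s2).
apply: (star_span star_cogens).
exact: (cogens_psi hD1 hD2 hi _ (star_span star_gens hz)).
Qed.

(** Each of the two spans is an algebra and the star exchanges them, so the intersection is
    selfadjoint. *)
Definition graph : set pair_alg := cspan gens `&` cspan cogens.

Lemma graph_alg : closed_star_subalgebra graph.
Proof.
have [g0 gD gc] := cspan_closed gens; have [c0 cD cc] := cspan_closed cogens.
split=> [|a x y [gx cx] [gy cy]|x y [gx cx] [gy cy]|x [gx cx]|x hx].
- exact: conj g0 c0.
- exact: conj (gD _ _ (cspanZ (gensZ a) gx) gy) (cD _ _ (cspanZ (cogensZ a) cx) cy).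
- exact: conj (gens_mul gx gy) (cogens_mul cx cy).
- exact: conj (star_span star_cogens cx) (star_span star_gens gx).
by split; [apply: gc|apply: cc] => e e0; have [y [gy cy] hy] := hx e e0; exists y.
Qed.

Lemma graph0l b : graph (0, b) -> b = 0.
Proof. by move=> [/gens0l]. Qed.

Lemma graph0r b : graph (b, 0) -> b = 0.
Proof. by move=> [/gens0r]. Qed.

(** The product [psi a d psi x] lies in both spans: multiply [d psi x] by [psi a] on the left, or
    [psi a d] by [psi x] on the right. *)
Lemma graph_psi_cogens a z : cogens z -> graph (pact (gpsi P1 a) (gpsi P2 a) z).
Proof.
move=> hz; split; last by apply: (cogens_psi hD1 hD2 hi); exact: cspan_in.
have [x [d [Dd e1 e2]]] := hz.
have [b1 h1] := psi_landstad hD1 a Dd.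
have [b2 h2] := psi_landstad hD2 a (iso_in hi Dd).
have -> : pact (gpsi P1 a) (gpsi P2 a) z =
    (mright (gpsi P1 x) b1, mright (gpsi P2 x) b2).
  congr pair; apply: minj_inj; rewrite -mul_minj -minj_mul.
    by rewrite e1 h1 smulA.
  by rewrite e2 h2 smulA.
by apply: (@gens_mright x (b1, b2)); apply: cspan_in; exists a, d.
Qed.

(** The domain is closed by [graph_dom_closed] and contains the elements [psi a d psi x], which are
    total since [psi] is nondegenerate and the products [d psi x] span [B1]. *)
Lemma graph_total b1 : exists b2, graph (b1, b2).
Proof.
have cl := graph_dom_closed t graph_alg graph0l.
apply: (dense_ind (mor_dense (gpsi_mor P1)) cl) => a {}b1.
apply: (cspan_ind (closed_sub_comp (m_bop (gpsi P1 a)) cl) _ (landstad_span' hD1 b1)).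
move=> b [x [d [Dd hb]]].
have [c hc] := landstad_psi hD2 x (iso_in hi Dd).
by exists (gpsi P2 a c); apply: (@graph_psi_cogens a (b, c)); exists x, d.
Qed.

(** The argument of [graph_total] with the components exchanged; surjectivity of [i] supplies the
    elements of [D2]. *)
Lemma graph_onto b2 : exists b1, graph (b1, b2).
Proof.
have cl := graph_dom_closed t (css_swap graph_alg) graph0r.
apply: (dense_ind (mor_dense (gpsi_mor P2)) cl) => a {}b2.
apply: (cspan_ind (closed_sub_comp (m_bop (gpsi P2 a)) cl) _ (landstad_span' hD2 b2)).
move=> b [x [d2 [Dd2 hb]]].
have [[_ _ iS] _ _ _ _] := hi; have [d Dd id2] := iS _ Dd2.
have [c hc] := landstad_psi hD1 x Dd.
exists (gpsi P1 a c); apply: (@graph_psi_cogens a (c, b)); exists x, d.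
by split=> //; rewrite id2.
Qed.

End GraphAlgebra.

(** * Compatibility with the dual actions *)

Section Intertwine.
Context {R : realType} {t : tensor_models R} (G : lcqg t) (P1 P2 : gproduct G).
Context (D1 : set (multiplier P1)) (D2 : set (multiplier P2)).
Context (hD1 : landstad_algebra D1) (hD2 : landstad_algebra D2).
Context (i : multiplier P1 -> multiplier P2) (hi : landstad_iso D1 D2 i).
Context (j : P1 -> P2) (hj : star_hom j) (jS : forall b, exists a, j a = b).
Hypothesis jpsi : forall a, ext (minj \o j) (gpsi P1 a) = gpsi P2 a.
Hypothesis jD : forall d, D1 d -> ext (minj \o j) d = i d.

(** Both sides are continuous in [b] and agree on [psi a d]: there [beta] is given by the
    comultiplication on [psi a] and by [1 ⊗ d] on [d]. *)
Lemma landstad_intertwine b :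
  ext (mor_ten minj (minj \o j)) (gbeta b) = gbeta (j b).
Proof.
have mj : mor (minj \o j) := surj_mor t hj jS.
have m0 : mor (@minj R (qAd G)) := minj_mor t.
have mF : mor (mor_ten (t := t) (@minj R (qAd G)) (minj \o j)) := mor_ten_mor (t := t) m0 mj.
have sF := ext_star_hom (t := t) mF.
have [mb1 _ _ _] := gbeta_action P1; have [mb2 _ _ _] := gbeta_action P2.
have sb2 := ext_star_hom (t := t) mb2; have sb1 := ext_star_hom (t := t) mb1.
have sjx := ext_star_hom (t := t) mj.
apply: meq => y.
have bnd (X Y : cstarType R) (f : X -> multiplier Y) (v : Y) :
    star_hom f -> bounded_op (fun x => f x v).
  move=> sf; apply: (bopI (C := nrm v)); [|exact: nrm_ge0|].
    by move=> a u w; rewrite (sh_lin sf).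
  by move=> x; rewrite mulrC; exact: (star_hom_mbnd x sf v).
have c1 := bnd _ _ _ y (sh_comp mb1.1 sF).
have c2 := bnd _ _ _ y (sh_comp hj mb2.1).
apply: (cspan_ind (closed_sub_eq c1 c2) _ (landstad_span hD1 b)).
move=> {}b [a [d [Dd e1]]] /=; congr (mleft _ y).
have e2 : minj (j b) = gpsi P2 a ** i d.
  by rewrite -[LHS](ext_minj (t := t) mj b) e1 (shM sjx) jpsi jD.
have [_ bD1 _ _] := hD1; have [_ bD2 _ _] := hD2.
rewrite -(ext_minj (t := t) mb1) -(ext_minj (t := t) mb2) e1 e2.
rewrite (shM sb1) (shM sb2) (shM sF) !gbeta_psi.
rewrite (bD1 _ Dd) (bD2 _ (iso_in hi Dd)); congr (_ ** _).
  have mg1 := mor_ten_mor (t := t) m0 (gpsi_mor P1).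
  rewrite (ext_comp t _ mg1 mF); congr (ext _ _).
  apply: (mor_ten_uniq m0 (gpsi_mor P2)); first exact: mor_comp.
  move=> x y'; rewrite (mor_tenE m0 (gpsi_mor P1)) (ext_mor_ten m0 mj).
  by rewrite (ext_minj (t := t) m0) jpsi.
by rewrite (ext_mor_ten m0 mj) jD // (ext_one (t := t) m0).
Qed.

Lemma landstad_gen_image a d b : D1 d -> minj b = gpsi P1 a ** d ->
  minj (j b) = gpsi P2 a ** i d.
Proof.
move=> Dd e; have mj : mor (minj \o j) := surj_mor t hj jS.
by rewrite -[LHS](ext_minj (t := t) mj b) e (shM (ext_star_hom (t := t) mj)) jpsi jD.
Qed.

End Intertwine.

Theorem theorem3p7 (R : realType) (t : tensor_models R) (G : lcqg t)
    (P1 P2 : gproduct G)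
    (D1 : set (multiplier P1)) (D2 : set (multiplier P2))
    (hD1 : landstad_algebra D1) (hD2 : landstad_algebra D2)
    (i : multiplier P1 -> multiplier P2) (hi : landstad_iso D1 D2 i) :
  exists! j : P1 -> P2,
    gproduct_iso j /\ forall d, D1 d -> ext (minj \o j) d = i d.
Proof.
have [j Jj] := choice (graph_total hD1 hD2 hi).
have galg := graph_alg hD1 hD2 hi; have [_ gL gM gS _] := galg.
have fn b c : graph D1 i (b, c) -> c = j b.
  by move=> h; exact: (graph_fun galg (graph0l hD1 hD2 hi) h (Jj b)).
(* The pairs obtained below by acting with [psi] or with [d] are known to lie in [cspan cogens];
   this suffices to read off [j]. *)
have cofn b c : cspan (cogens D1 i) (b, c) -> c = j b.
  move=> h; exact: (cogens_fun hD1 hD2 hi h (Jj b).2).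
have jh : star_hom j.
  split=> [a x y|x y|x]; apply/esym/fn; first exact: gL (Jj x) (Jj y).
    exact: gM (Jj x) (Jj y).
  exact: gS (Jj x).
have jS b : exists a, j a = b.
  by have [a /fn ->] := graph_onto hD1 hD2 hi b; exists a.
have jI : injective j.
  move=> b c e; apply/eqP; rewrite -subr_eq0; apply/eqP; apply: (graph0r hD1 hD2 hi).
  have := css_sub galg (Jj b) (Jj c); rewrite e.
  by rewrite (_ : (b, j c) - (c, j c) = (b - c, 0)) //; congr pair; rewrite subrr.
have mj : mor (minj \o j) := surj_mor t jh jS.
have jpsi a : ext (minj \o j) (gpsi P1 a) = gpsi P2 a.
  apply: (ext_uniq (t := t) mj) => x y; rewrite /= mleftM; congr (_ ** y).
  exact: (cofn _ _ (cogens_psi hD1 hD2 hi a (Jj x).2)).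
have jD d : D1 d -> ext (minj \o j) d = i d.
  move=> Dd; apply: (ext_uniq (t := t) mj) => x y; rewrite /= mleftM; congr (_ ** y).
  exact: (cofn _ _ (cogens_landstad hD1 hi Dd (Jj x).2)).
exists j; split.
  split=> //; split=> //.
    have [k hk] := choice jS; exists k => // x; apply: jI; exact: hk.
  exact: (landstad_intertwine hD1 hD2 hi jh jS jpsi jD).
move=> j' [[jh' [k kj' j'k] jpsi' _] jD']; apply/funext => b.
have jS' c : exists a, j' a = c by exists (k c).
have bj (f : P1 -> P2) : star_hom f -> bounded_op f.
  move=> sf; apply: (bopI (C := 1)) => //; first exact: sh_lin.
  by move=> x; rewrite mul1r; exact: star_hom_nrm.
(* Uniqueness: two continuous homomorphisms that agree on the total set of elements [psi a d]. *)
apply: (cspan_ind (closed_sub_eq (bj _ jh) (bj _ jh')) _ (landstad_span hD1 b)).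
move=> c [a [d [Dd e]]]; apply: minj_inj.
rewrite (landstad_gen_image jh jS jpsi jD Dd e).
by rewrite (landstad_gen_image jh' jS' jpsi' jD' Dd e).
Qed.
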